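(* For non-negative integers $m,n$ there are isomorphisms, respecting the actions of the indicated symmetric groups: \begin{enumerate} \item $$\mathrm{Ext}^i(\mathrm T^m\circ\mathrm{ab},\mathrm T^n\circ\mathrm{ab})\cong\begin{cases}\mathbb Z[\mathrm{Sur}(n,m)]& i=n-m\\0&\text{otherwise,}\end{cases}$$ where the natural action of $\Sigma_m\times\Sigma_n$ on $\mathbb Z[\mathrm{Sur}(n,m)]$ is twisted by the tensor product of the sign representations of $\Sigma_m$ and of $\Sigma_n$. \item $$\mathrm{Ext}^i(\mathrm T^m\circ\mathrm{ab},\Lambda^n\circ\mathrm{ab})\cong\begin{cases}\mathbb Z[\mathrm C(n,m)]& i=n-m\\0&\text{otherwise,}\end{cases}$$ where the action of $\Sigma_m$ on $\mathbb Z[\mathrm C(n,m)]$ is twisted by the sign representation. \item $$\mathrm{Ext}^i(\mathrm T^m\circ\mathrm{ab},\Gamma^n\circ\mathrm{ab})\cong\begin{cases}\mathbb Z& i=0,\ m=n\\0&\text{otherwise,}\end{cases}$$ where $\Sigma_m$ acts trivially on the right hand side. \end{enumerate}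
   Context: $\mathrm{Ext}$ is taken in the abelian category of functors from finitely generated free groups to abelian groups. $\mathrm{ab}$ is abelianization; $\mathrm T^n,\Lambda^n,\Gamma^n$ are the $n$-th tensor, exterior and divided power functors ($\Gamma^n(A)=(A^{\otimes n})^{\Sigma_n}$ for $A$ free abelian). $\Sigma_m$ and $\Sigma_n$ act on the Ext groups through permuting the tensor factors of $\mathrm T^m$ and of $\mathrm T^n$. $\mathrm{Sur}(n,m)$ is the set of surjections $\{1,\dots,n\}\to\{1,\dots,m\}$, with its action of $\Sigma_m\times\Sigma_n$ by post- and pre-composition, and $\mathrm C(n,m)=\Sigma_n\backslash\mathrm{Sur}(n,m)$ is the set of compositions of $n$ with $m$ components, i.e. ordered $m$-tuples of positive integers with sum $n$, permuted by $\Sigma_m$. *)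

(* Defs.v *)
From HB Require Import structures.
From mathcomp Require Import all_boot all_order all_algebra perm.
From mathcomp Require Import boolp freeg.

Set Implicit Arguments.
Unset Strict Implicit.
Unset Printing Implicit Defensive.

Import GRing.Theory.
Local Open Scope ring_scope.

Lemma additiveP (A B : zmodType) (f g : {additive A -> B}) : f =1 g -> f = g.
Proof.
case: f => f [[pf]]; case: g => g [[pg]] /= /funext e; subst g.
by rewrite (Prop_irrelevance pf pg).
Qed.

Section FreeAbelian.

Definition zlift (K : choiceType) (M : zmodType) (f : K -> M) :
  {freeg K} -> M := fglift (f : K -> zmodule M).

Fact zlift_is_additive (K : choiceType) (M : zmodType) (f : K -> M) : zmod_morphism (zlift f).
Proof. exact: (@lift_is_additive int K (zmodule M) f). Qed.

HB.instance Definition _ (K : choiceType) (M : zmodType) (f : K -> M) :=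
  GRing.isZmodMorphism.Build _ _ (zlift f) (zlift_is_additive f).

Lemma zliftU (K : choiceType) (M : zmodType) (f : K -> M) k : zlift f << k >> = f k.
Proof. by rewrite /zlift liftU scale1r. Qed.

Lemma freeg_additiveP (K : choiceType) (M : zmodType)
  (f g : {additive {freeg K} -> M}) : (forall k, f << k >> = g << k >>) -> f =1 g.
Proof.
move=> fg D; rewrite -(freeg_sumE D) !raddf_sum; apply: eq_bigr => k _ /=.
by rewrite -(intz (coeff k D)) -freegU_mulz !raddfMz fg.
Qed.

Definition fgmap (K K' : choiceType) (f : K -> K') : {freeg K} -> {freeg K'} :=
  zlift (fun k => << f k >>).

HB.instance Definition _ (K K' : choiceType) (f : K -> K') :=
  GRing.Additive.on (fgmap f).

Lemma fgmapU (K K' : choiceType) (f : K -> K') k : fgmap f << k >> = << f k >>.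
Proof. exact: zliftU. Qed.

End FreeAbelian.

Section Kernel.
Variables (A B : zmodType) (f : {additive A -> B}).

Record ker := Ker { kerval :> A; _ : f kerval == 0 }.
HB.instance Definition _ := [isSub for kerval].
HB.instance Definition _ := [Choice of ker by <:].

Fact ker_zmod_closed : zmod_closed (fun x => f x == 0).
Proof.
split=> [|x y /eqP fx /eqP fy]; rewrite unfold_in ?raddf0 // raddfB fx fy.
by rewrite subr0.
Qed.

HB.instance Definition _ :=
  GRing.SubChoice_isSubZmodule.Build A _ ker ker_zmod_closed.

Lemma kerP (x : ker) : f (val x) = 0.
Proof. by case: x => x /= /eqP. Qed.

End Kernel.

Section KernelMap.
Variables (A B A' B' : zmodType).
Variables (f : {additive A -> B}) (f' : {additive A' -> B'}).
Variables (g : {additive A -> A'}).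
Hypothesis fg : forall x, f x = 0 -> f' (g x) = 0.

Definition kermap (x : ker f) : ker f' :=
  Ker (introT eqP (fg (kerP x))).

Fact kermap_is_additive : zmod_morphism kermap.
Proof.
move=> x y; apply: val_inj; rewrite raddfB.
by rewrite -[LHS]/(g (val (x - y))) !raddfB.
Qed.

HB.instance Definition _ :=
  GRing.isZmodMorphism.Build _ _ kermap kermap_is_additive.

End KernelMap.

Section Quotient.
Variables (A : zmodType) (S : A -> Prop).

Inductive gen : A -> Prop :=
| gen0 : gen 0
| gen_in x : S x -> gen x
| genB x y : gen x -> gen y -> gen (x - y).

Definition gen_pred : {pred A} := fun x => `[< gen x >].

Fact gen_zmod_closed : zmod_closed gen_pred.
Proof.
split=> [|x y /asboolP gx /asboolP gy]; apply/asboolP; first exact: gen0.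
exact: genB.
Qed.

HB.instance Definition _ := GRing.isZmodClosed.Build A gen_pred gen_zmod_closed.

Definition gen_closed : zmodClosed A := gen_pred.

Definition zquot : Type := Quotient.quot gen_closed.
HB.instance Definition _ := GRing.Zmodule.on zquot.

Definition zpi (x : A) : zquot := (\pi_(Quotient.quot gen_closed) x)%qT.
Definition zrepr (x : zquot) : A := repr (x : Quotient.quot gen_closed).

Fact zpi_is_additive : zmod_morphism zpi.
Proof. exact: (pi_is_zmod_morphism (Quotient.quot gen_closed)). Qed.

HB.instance Definition _ := GRing.isZmodMorphism.Build _ _ zpi zpi_is_additive.

Lemma zreprK x : zpi (zrepr x) = x.
Proof. exact: reprK. Qed.

Lemma zpi_eq0 x : zpi x = 0 <-> gen x.
Proof.
have e := Quotient.idealrBE gen_closed x 0.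
rewrite subr0 in e; rewrite -(raddf0 zpi); split=> [/eqP | gx].
  by move=> zx; apply/asboolP; rewrite -[asbool _]/(x \in gen_closed) e.
by apply/eqP; rewrite -[_ == _]e; apply/asboolP.
Qed.

Variables (B : zmodType) (f : {additive A -> B}).
Hypothesis fS : forall x, S x -> f x = 0.

Lemma gen_kills x : gen x -> f x = 0.
Proof.
elim=> [|y /fS //|y z _ fy _ fz]; first exact: raddf0.
by rewrite raddfB fy fz subr0.
Qed.

Definition zquot_lift_fun (x : zquot) : B := f (zrepr x).

Fact zquot_lift_funE x : zquot_lift_fun (zpi x) = f x.
Proof.
apply/eqP; rewrite -subr_eq0 -raddfB; apply/eqP/gen_kills/zpi_eq0.
by rewrite raddfB /= zreprK subrr.
Qed.

Fact zquot_lift_is_additive : zmod_morphism zquot_lift_fun.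
Proof.
by move=> x y; rewrite -[x]zreprK -[y]zreprK -raddfB !zquot_lift_funE raddfB.
Qed.

Definition zquot_lift : {additive zquot -> B} :=
  HB.pack zquot_lift_fun
    (GRing.isZmodMorphism.Build _ _ zquot_lift_fun zquot_lift_is_additive).

Lemma zquot_liftE x : zquot_lift (zpi x) = f x.
Proof. exact: zquot_lift_funE. Qed.

End Quotient.

Lemma zquotP (A : zmodType) (S : A -> Prop) (B : zmodType)
    (f g : {additive zquot S -> B}) :
  (forall x, f (zpi S x) = g (zpi S x)) -> f =1 g.
Proof. by move=> fg x; rewrite -[x]zreprK. Qed.

Section QuotientMap.
Variables (A : zmodType) (S : A -> Prop) (A' : zmodType) (S' : A' -> Prop).
Variables (f : {additive A -> A'}).
Hypothesis fS : forall x, S x -> S' (f x).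

Fact zquot_map_subproof x : S x -> (zpi S' \o f) x = 0.
Proof. by move=> /fS Sfx; apply/zpi_eq0/gen_in. Qed.

Definition zquot_map : {additive zquot S -> zquot S'} :=
  zquot_lift zquot_map_subproof.

Lemma zquot_mapE x : zquot_map (zpi S x) = zpi S' (f x).
Proof. exact: (zquot_liftE zquot_map_subproof). Qed.

End QuotientMap.

Record category := Category {
  ob :> Type;
  hom : ob -> ob -> Type;
  idm : forall X, hom X X;
  cmp : forall X Y Z, hom Y Z -> hom X Y -> hom X Z;
  cmp_idl : forall X Y (f : hom X Y), cmp (idm Y) f = f;
  cmp_idr : forall X Y (f : hom X Y), cmp f (idm X) = f;
  cmpA : forall X Y Z W (f : hom X Y) (g : hom Y Z) (h : hom Z W),
    cmp h (cmp g f) = cmp (cmp h g) f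
}.
Arguments idm {c} X.

Record functor (C : category) := Functor {
  fobj :> C -> zmodType;
  fmap : forall X Y, hom X Y -> {additive fobj X -> fobj Y};
  fmap_id : forall X x, fmap (idm X) x = x;
  fmap_cmp : forall X Y Z (f : hom X Y) (g : hom Y Z) x,
    fmap (cmp g f) x = fmap g (fmap f x)
}.
Arguments fmap {C} _ {X Y} _.

Record natTrans (C : category) (F G : functor C) := NatTrans {
  napp :> forall X, F X -> G X;
  napp_additive : forall X, zmod_morphism (@napp X);
  napp_nat : forall X Y (h : hom X Y) x,
    @napp Y (fmap F h x) = fmap G h (@napp X x)
}.
Arguments napp {C F G} _ X _.

HB.instance Definition _ (C : category) (F G : functor C) (a : natTrans F G) X :=
  GRing.isZmodMorphism.Build (F X) (G X) (napp a X) (@napp_additive C F G a X).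

Definition nat_of (C : category) (F G : functor C)
    (a : forall X, {additive F X -> G X}) :
    (forall X Y (h : hom X Y) x, a Y (fmap F h x) = fmap G h (a X x)) ->
    natTrans F G :=
  NatTrans (fun X => raddfB (a X)).
Arguments nat_of {C F G} & a _.

Lemma natTransP (C : category) (F G : functor C) (a b : natTrans F G) :
  (forall X x, a X x = b X x) -> a = b.
Proof.
case: a b => a aD aN [b bD bN] /= ab.
have e : a = b by apply: functional_extensionality_dep => X; apply/funext/ab.
by subst b; rewrite (Prop_irrelevance aD bD) (Prop_irrelevance aN bN).
Qed.

Section NatTransGroup.
Variables (C : category) (F G : functor C).
Implicit Types a b : natTrans F G.

HB.instance Definition _ := gen_eqMixin (natTrans F G).
HB.instance Definition _ := gen_choiceMixin (natTrans F G).

Program Definition nat_zero : natTrans F G := nat_of (fun X => \0) _.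
Next Obligation. by rewrite raddf0. Qed.

Program Definition nat_opp a : natTrans F G := nat_of (fun X => \- (a X)) _.
Next Obligation. by rewrite napp_nat raddfN. Qed.

Program Definition nat_add a b : natTrans F G :=
  nat_of (fun X => a X \+ b X) _.
Next Obligation. by rewrite !napp_nat raddfD. Qed.

Fact nat_addA : associative nat_add.
Proof. by move=> a b c; apply: natTransP => X x; apply: addrA. Qed.
Fact nat_addC : commutative nat_add.
Proof. by move=> a b; apply: natTransP => X x; apply: addrC. Qed.
Fact nat_add0 : left_id nat_zero nat_add.
Proof. by move=> a; apply: natTransP => X x; apply: add0r. Qed.
Fact nat_addN : left_inverse nat_zero nat_opp nat_add.
Proof. by move=> a; apply: natTransP => X x; apply: addNr. Qed.

HB.instance Definition _ := GRing.isZmodule.Build (natTrans F G)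
  nat_addA nat_addC nat_add0 nat_addN.

End NatTransGroup.

Program Definition nat_id (C : category) (F : functor C) : natTrans F F :=
  nat_of (fun X => idfun) _.

Program Definition nat_comp (C : category) (F G H : functor C)
    (b : natTrans G H) (a : natTrans F G) : natTrans F H :=
  nat_of (fun X => b X \o a X) _.
Next Obligation. by rewrite !napp_nat. Qed.

Section FreeCover.
Variables (C : category) (F : functor C).

(* The direct sum, over all objects [Y] and all [y] in [F Y], of the
   projectives [Z[hom Y -]]. *)
Definition cover_basis (X : C) : Type := {Y : C & (F Y * hom Y X)%type}.

Definition cover_push X X' (f : hom X X') (k : {classic cover_basis X}) :
    {classic cover_basis X'} :=
  existT _ (tag k) ((tagged k).1, cmp f (tagged k).2).

Program Definition cover : functor C :=
  @Functor C (fun X => {freeg {classic cover_basis X}})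
    (fun X X' f => fgmap (@cover_push X X' f)) _ _.
Next Obligation.
apply: (freeg_additiveP (f := fgmap _) (g := idfun)) => -[Y [y h]].
by rewrite /= fgmapU /cover_push /= cmp_idl.
Qed.
Next Obligation.
apply: (freeg_additiveP (f := fgmap _) (g := fgmap _ \o fgmap _)) => -[U [u h]].
by rewrite /= !fgmapU /cover_push /= cmpA.
Qed.

Program Definition cover_eps : natTrans cover F :=
  nat_of (fun X => zlift (fun k : {classic cover_basis X} =>
                              fmap F (tagged k).2 (tagged k).1)) _.
Next Obligation.
apply: (freeg_additiveP (f := zlift _ \o fgmap _) (g := fmap F _ \o zlift _)).
by move=> [U [u k]]; rewrite /= fgmapU !zliftU /= fmap_cmp.
Qed.

Lemma cover_eps_surj X (y : F X) : exists x, cover_eps X x = y.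
Proof.
exists << existT _ X (y, idm X) : {classic cover_basis X} >>.
by rewrite /= zliftU /= fmap_id.
Qed.

Lemma cover_projective (G H : functor C) (p : natTrans G H)
    (a : natTrans cover H) :
  (forall X y, exists x, p X x = y) -> exists b, nat_comp p b = a.
Proof.
move=> p_surj.
pose gen_of Y y : {classic cover_basis Y} := existT _ Y (y, idm Y).
have g Y y := cid (p_surj Y (a Y << gen_of Y y >>)).
pose b X (k : {classic cover_basis X}) : G X :=
  fmap G (tagged k).2 (sval (g (tag k) (tagged k).1)).
have b_nat X X' (f : hom X X') x :
    zlift (b X') (fmap cover f x) = fmap G f (zlift (b X) x).
  apply: (freeg_additiveP (f := zlift (b X') \o fgmap _)
                          (g := fmap G f \o zlift (b X))) => -[Y [y h]].
  by rewrite /= fgmapU !zliftU /b /= fmap_cmp.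
exists (nat_of (fun X => zlift (b X) : {additive cover X -> G X}) b_nat).
apply: natTransP => X.
apply: (freeg_additiveP (f := p X \o zlift (b X))
                        (g := a X : {additive cover X -> H X})) => -[Y [y h]].
rewrite /= zliftU /b /= napp_nat (svalP (g Y y)) -(napp_nat a) /= fgmapU.
by rewrite /cover_push /= cmp_idr.
Qed.

End FreeCover.

Section KernelFunctor.
Variables (C : category) (F G : functor C) (a : natTrans F G).

Fact nat_ker_subproof X Y (f : hom X Y) x : a X x = 0 -> a Y (fmap F f x) = 0.
Proof. by rewrite napp_nat => ->; rewrite raddf0. Qed.

Program Definition nat_ker : functor C :=
  @Functor C (fun X => ker (a X))
    (fun X Y f => kermap (@nat_ker_subproof X Y f)) _ _.
Next Obligation. by apply: val_inj; rewrite /= fmap_id. Qed.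
Next Obligation. by apply: val_inj; rewrite /= fmap_cmp. Qed.

Program Definition nat_ker_incl : natTrans nat_ker F :=
  nat_of (fun X => val : {additive ker (a X) -> F X}) _.

End KernelFunctor.

Section CoverMap.
Variables (C : category) (F G : functor C) (a : natTrans F G).

Definition cover_map_basis X (k : {classic cover_basis F X}) :
    {classic cover_basis G X} :=
  existT _ (tag k) (a (tag k) (tagged k).1, (tagged k).2).

Program Definition cover_map : natTrans (cover F) (cover G) :=
  nat_of (fun X => fgmap (@cover_map_basis X)) _.
Next Obligation.
apply: (freeg_additiveP (f := fgmap _ \o fgmap _) (g := fgmap _ \o fgmap _)).
by move=> [U [u k]]; rewrite /= !fgmapU.
Qed.

Lemma cover_map_eps X x :
  cover_eps G X (cover_map X x) = a X (cover_eps F X x).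
Proof.
apply: (freeg_additiveP (f := zlift _ \o fgmap _) (g := a X \o zlift _)).
by move=> [U [u k]]; rewrite /= fgmapU !zliftU /= napp_nat.
Qed.

Fact syzygy_map_subproof X x :
  cover_eps F X x = 0 -> cover_eps G X (cover_map X x) = 0.
Proof. by rewrite cover_map_eps => ->; rewrite raddf0. Qed.

Program Definition syzygy_map1 :
    natTrans (nat_ker (cover_eps F)) (nat_ker (cover_eps G)) :=
  nat_of (fun X => kermap (@syzygy_map_subproof X)) _.
Next Obligation. by apply: val_inj; apply: (napp_nat cover_map). Qed.

End CoverMap.

Section Ext.
Variable C : category.
Implicit Types F G : functor C.

(* The functorial projective resolution
     ... -> res F 1 -> res F 0 -> F -> 0
   with [res F i] the cover of the i-th syzygy. *)
Fixpoint syzygy F i : functor C :=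
  if i is j.+1 then nat_ker (cover_eps (syzygy F j)) else F.

Definition res F i : functor C := cover (syzygy F i).

Definition res_aug F : natTrans (res F 0) F := cover_eps F.

Definition res_diff F i : natTrans (res F i.+1) (res F i) :=
  nat_comp (nat_ker_incl (cover_eps (syzygy F i))) (cover_eps (syzygy F i.+1)).

Fixpoint syzygy_map F F' (a : natTrans F F') i :
    natTrans (syzygy F i) (syzygy F' i) :=
  if i is j.+1 return natTrans (syzygy F i) (syzygy F' i)
  then syzygy_map1 (syzygy_map a j) else a.

Definition res_map F F' (a : natTrans F F') i : natTrans (res F i) (res F' i) :=
  cover_map (syzygy_map a i).

Lemma res_map_diff F F' (a : natTrans F F') i :
  nat_comp (res_map a i) (res_diff F i) = nat_comp (res_diff F' i) (res_map a i.+1).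
Proof.
apply: natTransP => X x.
exact: esym (congr1 val (cover_map_eps (syzygy_map a i.+1) x)).
Qed.

Lemma res_diff_diff F i : nat_comp (res_diff F i) (res_diff F i.+1) = 0.
Proof.
apply: natTransP => X x.
exact: (congr1 val (kerP (cover_eps (syzygy F i.+2) X x))).
Qed.

Section CochainMap.
Variables (F F' G G' : functor C) (a : natTrans F' F) (b : natTrans G G').

Definition nat_whisker (z : natTrans F G) : natTrans F' G' :=
  nat_comp b (nat_comp z a).

Fact nat_whisker_is_additive : zmod_morphism nat_whisker.
Proof. by move=> y z; apply: natTransP => X x; apply: raddfB. Qed.

HB.instance Definition _ :=
  GRing.isZmodMorphism.Build _ _ nat_whisker nat_whisker_is_additive.

End CochainMap.

Definition cocycle F G i : zmodType :=
  ker (nat_whisker (res_diff F i) (nat_id G)).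

Definition coboundary F G i : cocycle F G i -> Prop :=
  match i with
  | 0 => fun z => z = 0
  | j.+1 => fun z =>
      exists y : natTrans (res F j) G, val z = nat_comp y (res_diff F j)
  end.

Definition Ext i F G : zmodType := zquot (@coboundary F G i).

Section ExtMap.
Variables (i : nat) (F F' G G' : functor C).
Variables (a : natTrans F' F) (b : natTrans G G').

Fact cocycle_map_subproof (z : natTrans (res F i) G) :
  nat_whisker (res_diff F i) (nat_id G) z = 0 ->
  nat_whisker (res_diff F' i) (nat_id G') (nat_whisker (res_map a i) b z) = 0.
Proof.
move=> dz; apply: natTransP => X x /=.
have /= -> := congr1 (fun c => napp c X x) (res_map_diff a i).
have /= -> := congr1 (fun c => napp c X (res_map a i.+1 X x)) dz.
exact: raddf0.
Qed.

Definition cocycle_map : cocycle F G i -> cocycle F' G' i :=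
  kermap cocycle_map_subproof.

HB.instance Definition _ := GRing.Additive.on cocycle_map.

Fact ext_map_subproof (z : cocycle F G i) :
  coboundary z -> coboundary (cocycle_map z).
Proof.
rewrite /cocycle_map; move: cocycle_map_subproof z.
case: i => [|j] sub z /=; first by move=> ->; rewrite raddf0.
case=> y zy; exists (nat_whisker (res_map a j) b y).
apply: natTransP => X x /=; rewrite [kerval z]zy /=.
by have /= -> := congr1 (fun c => napp c X x) (res_map_diff a j).
Qed.

Definition ext_map : {additive Ext i F G -> Ext i F' G'} :=
  zquot_map ext_map_subproof.

End ExtMap.

End Ext.

(* The groupType with the given operations, with a choice structure
   provided by classical choice. *)
Section GroupOf.
Variables (T : Type) (one : T) (inv : T -> T) (mul : T -> T -> T).
Hypotheses (mulA : associative mul) (mul1 : left_id one mul).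
Hypotheses (mul1r : right_id one mul) (mulV : left_inverse one inv mul).
Hypothesis mulVr : right_inverse one inv mul.

Definition group_of : groupType :=
  HB.pack T (gen_eqMixin T) (gen_choiceMixin T)
    (isGroup.Build {classic T} mulA mul1 mul1r mulV mulVr).

End GroupOf.

Definition fg_free (G : groupType) : Prop :=
  exists (n : nat) (e : 'I_n -> G), forall (H : groupType) (f : 'I_n -> H),
    exists! g : {multiplicative G -> H}, forall i, g (e i) = f i.

(* Underlying sets live in [Set], so that the category is small. *)
Record fgFreeGroup := FgFreeGroup {
  fg_sort :> Set;
  fg_one : fg_sort;
  fg_inv : fg_sort -> fg_sort;
  fg_mul : fg_sort -> fg_sort -> fg_sort;
  fg_mulA : associative fg_mul;
  fg_mul1l : left_id fg_one fg_mul;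
  fg_mul1r : right_id fg_one fg_mul;
  fg_mulVl : left_inverse fg_one fg_inv fg_mul;
  fg_mulVr : right_inverse fg_one fg_inv fg_mul;
  fg_freeP : fg_free (group_of fg_mulA fg_mul1l fg_mul1r fg_mulVl fg_mulVr)
}.

Definition fg_group (X : fgFreeGroup) : groupType :=
  group_of (@fg_mulA X) (@fg_mul1l X) (@fg_mul1r X) (@fg_mulVl X) (@fg_mulVr X).

Record fgHom (X Y : fgFreeGroup) := FgHom {
  fg_fun :> X -> Y;
  fg_funM : {morph fg_fun : x y / fg_mul x y}
}.

Lemma fgHomP X Y (f g : fgHom X Y) : f =1 g -> f = g.
Proof.
case: f g => f fM [g gM] /= /funext e; subst g.
by rewrite (Prop_irrelevance fM gM).
Qed.

Definition fg_id X : fgHom X X := @FgHom X X id (fun x y => erefl).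

Definition fg_comp X Y Z (g : fgHom Y Z) (f : fgHom X Y) : fgHom X Z.
Proof. by exists (g \o f) => x y /=; rewrite !fg_funM. Defined.

Program Definition gr : category := @Category fgFreeGroup fgHom fg_id fg_comp _ _ _.
Next Obligation. exact: fgHomP. Qed.
Next Obligation. exact: fgHomP. Qed.
Next Obligation. exact: fgHomP. Qed.

Definition fg_morphism (X Y : fgFreeGroup) (f : fgHom X Y) :
    {multiplicative fg_group X -> fg_group Y} :=
  HB.pack (fg_fun f : fg_group X -> fg_group Y)
    (isMultiplicative.Build (fg_group X) (fg_group Y) (fg_fun f) (fg_funM f)).

Section Abelianization.
Variable G : groupType.
Implicit Types x y : G.

Local Open Scope group_scope.

Inductive derived : G -> Prop :=
| derived1 : derived 1
| derivedR x y : derived [~ x, y]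
| derivedM x y : derived x -> derived y -> derived (x * y)
| derivedV x : derived x -> derived x^-1.

Lemma derivedJ x y : derived x -> derived (x ^ y).
Proof.
by move=> dx; rewrite -[x ^ y](mulVKg x); apply/derivedM/derivedR.
Qed.

Definition abel_equiv x y : bool := `[< derived (x^-1 * y) >].

Fact abel_equiv_class : equiv_class_of abel_equiv.
Proof.
split=> [x|x y|y x z]; first by apply/asboolP; rewrite mulVg; apply: derived1.
  by apply/idP/idP => /asboolP/derivedV d; apply/asboolP; rewrite invgM invgK in d.
move=> /asboolP xy /asboolP yz; apply/asboolP.
by rewrite -[z](mulVKg y) mulgA; apply: derivedM.
Qed.

Canonical abel_equivRel := EquivRelPack abel_equiv_class.
Canonical abel_encModRel := defaultEncModRel abel_equiv.

Definition abel : Type := {eq_quot abel_equiv}%qT.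
HB.instance Definition _ := Choice.on abel.

Definition abel_pi x : abel := (\pi_({eq_quot abel_equiv}%qT) x)%qT.
Definition abel_repr (u : abel) : G := repr (u : {eq_quot abel_equiv}%qT).

Lemma abel_reprK u : abel_pi (abel_repr u) = u.
Proof. exact: reprK. Qed.

Lemma abel_piP x y : abel_pi x = abel_pi y <-> derived (x^-1 * y).
Proof. by split=> [/eqmodP /asboolP | d]; last by apply/eqmodP/asboolP. Qed.

Definition abel_add u v : abel := abel_pi (abel_repr u * abel_repr v).
Definition abel_opp u : abel := abel_pi (abel_repr u)^-1.

Lemma abel_piM x y : abel_pi (x * y) = abel_add (abel_pi x) (abel_pi y).
Proof.
apply/abel_piP.
have /abel_piP dx := esym (abel_reprK (abel_pi x)).
have /abel_piP dy := esym (abel_reprK (abel_pi y)).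
have -> : (x * y)^-1 * (abel_repr (abel_pi x) * abel_repr (abel_pi y)) =
  (x^-1 * abel_repr (abel_pi x)) ^ y * (y^-1 * abel_repr (abel_pi y)).
  by rewrite /conjg invgM !mulgA mulgK.
exact/derivedM/dy/derivedJ.
Qed.

Lemma abel_piV x : abel_pi x^-1 = abel_opp (abel_pi x).
Proof.
apply/abel_piP.
have /abel_piP/derivedV/(@derivedJ _ x^-1) := esym (abel_reprK (abel_pi x)).
by rewrite /conjg invgM !invgK mulgK.
Qed.

Fact abel_addA : associative abel_add.
Proof.
move=> u v w; rewrite -[u]abel_reprK -[v]abel_reprK -[w]abel_reprK.
by rewrite -!abel_piM mulgA.
Qed.

Fact abel_addC : commutative abel_add.
Proof.
move=> u v; rewrite -[u]abel_reprK -[v]abel_reprK -!abel_piM.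
apply/abel_piP; rewrite invgM -mulgA; exact: derivedR.
Qed.

Fact abel_add0 : left_id (abel_pi 1) abel_add.
Proof. by move=> u; rewrite -[u]abel_reprK -abel_piM mul1g. Qed.

Fact abel_addN : left_inverse (abel_pi 1) abel_opp abel_add.
Proof.
by move=> u; rewrite -[u]abel_reprK -abel_piV -abel_piM mulVg.
Qed.

HB.instance Definition _ :=
  GRing.isZmodule.Build abel abel_addA abel_addC abel_add0 abel_addN.

End Abelianization.

Section AbelianizationMap.
Variables (G H : groupType) (f : {multiplicative G -> H}).

Local Open Scope group_scope.

Let f1 : f 1 = 1.
Proof. by apply: (mulgI (f 1)); rewrite -gmulfM !mulg1. Qed.

Let fV x : f x^-1 = (f x)^-1.
Proof. by apply: (mulgI (f x)); rewrite -gmulfM !mulgV f1. Qed.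

Fact derived_map x : derived x -> derived (f x).
Proof.
elim=> [|y z|y z _ dy _ dz|y _ dy]; first by rewrite f1; apply: derived1.
- by rewrite /commg /conjg !gmulfM !fV; apply: derivedR.
- by rewrite gmulfM; apply: derivedM.
- by rewrite fV; apply: derivedV.
Qed.

Definition abel_map_fun (u : abel G) : abel H := abel_pi (f (abel_repr u)).

Fact abel_map_funE x : abel_map_fun (abel_pi x) = abel_pi (f x).
Proof.
apply/abel_piP; rewrite -fV -gmulfM; apply/derived_map/abel_piP.
exact: abel_reprK.
Qed.

Fact abel_map_is_additive : zmod_morphism abel_map_fun.
Proof.
move=> u v; rewrite -[u]abel_reprK -[v]abel_reprK -[(- _)%R]abel_piV.
rewrite -[(_ + _)%R]abel_piM !abel_map_funE -[(- _)%R]abel_piV -[RHS]abel_piM.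
by rewrite gmulfM fV.
Qed.

Definition abel_map : {additive abel G -> abel H} :=
  HB.pack abel_map_fun
    (GRing.isZmodMorphism.Build _ _ abel_map_fun abel_map_is_additive).

Lemma abel_mapE x : abel_map (abel_pi x) = abel_pi (f x).
Proof. exact: abel_map_funE. Qed.

End AbelianizationMap.

Fact ab_id (X : gr) u : abel_map (fg_morphism (idm X)) u = u.
Proof. by rewrite -[u]abel_reprK abel_mapE. Qed.

Fact ab_cmp (X Y Z : gr) (f : hom X Y) (g : hom Y Z) u :
  abel_map (fg_morphism (cmp g f)) u =
  abel_map (fg_morphism g) (abel_map (fg_morphism f) u).
Proof. by rewrite -[u]abel_reprK !abel_mapE. Qed.

Definition ab : functor gr :=
  @Functor gr (fun X => abel (fg_group X)) (fun X Y f => abel_map (fg_morphism f))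
    ab_id ab_cmp.

Record abEndofunctor := AbEndofunctor {
  eobj :> zmodType -> zmodType;
  emap : forall A B : zmodType, {additive A -> B} -> {additive eobj A -> eobj B};
  emap_id : forall (A : zmodType) x, emap (idfun : {additive A -> A}) x = x;
  emap_comp : forall (A B D : zmodType)
    (f : {additive A -> B}) (g : {additive B -> D}) x,
    emap (g \o f) x = emap g (emap f x)
}.
Arguments emap _ {A B} f.

Program Definition fcomp (E : abEndofunctor) (C : category) (F : functor C) :
    functor C :=
  @Functor C (fun X => E (F X)) (fun X Y f => emap E (fmap F f)) _ _.
Next Obligation.
rewrite -[RHS](emap_id (a := E)); congr (emap E _ x).
by apply: additiveP => y; apply: fmap_id.
Qed.
Next Obligation.
rewrite -emap_comp; congr (emap E _ x).
by apply: additiveP => y; apply: fmap_cmp.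
Qed.

Section Tensor.
Variables (n : nat) (A : zmodType).

Definition upd (x : {ffun 'I_n -> A}) (i : 'I_n) (a : A) : {ffun 'I_n -> A} :=
  [ffun j => if j == i then a else x j].

Definition multilinear_rel (z : {freeg {ffun 'I_n -> A}}) : Prop :=
  exists (x : {ffun 'I_n -> A}) (i : 'I_n) (a b : A),
    z = << upd x i (a + b) >> - << upd x i a >> - << upd x i b >>.

Definition tensor : zmodType := zquot multilinear_rel.

Definition pure (x : {ffun 'I_n -> A}) : tensor := zpi multilinear_rel << x >>.

End Tensor.

Lemma tensorP n (A B : zmodType) (f g : {additive tensor n A -> B}) :
  (forall x, f (pure x) = g (pure x)) -> f =1 g.
Proof.
by move=> fg; apply: zquotP; apply: (freeg_additiveP (f := f \o _) (g := g \o _)).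
Qed.

Section TensorMap.
Variables (n : nat) (A B : zmodType) (f : {additive A -> B}).

Definition ffun_map (x : {ffun 'I_n -> A}) : {ffun 'I_n -> B} := [ffun i => f (x i)].

Fact tensor_map_subproof z :
  multilinear_rel z -> multilinear_rel (fgmap ffun_map z).
Proof.
move=> [x [i [a [b ->]]]]; exists (ffun_map x), i, (f a), (f b).
have upd_map c : ffun_map (upd x i c) = upd (ffun_map x) i (f c).
  by apply/ffunP => j; rewrite !ffunE; case: ifP.
by rewrite !raddfB /= !fgmapU !upd_map raddfD.
Qed.

Definition tensor_map : {additive tensor n A -> tensor n B} :=
  zquot_map tensor_map_subproof.

Lemma tensor_mapE x : tensor_map (pure x) = pure (ffun_map x).
Proof. by rewrite /tensor_map zquot_mapE /= fgmapU. Qed.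

End TensorMap.

Section TensorPerm.
Variables (n : nat) (s : 'S_n) (A : zmodType).

Definition ffun_perm (x : {ffun 'I_n -> A}) : {ffun 'I_n -> A} :=
  [ffun i => x ((s^-1)%g i)].

Fact tensor_perm_subproof z :
  multilinear_rel z -> multilinear_rel (fgmap ffun_perm z).
Proof.
move=> [x [i [a [b ->]]]]; exists (ffun_perm x), (s i), a, b.
have upd_perm c : ffun_perm (upd x i c) = upd (ffun_perm x) (s i) c.
  by apply/ffunP => j; rewrite !ffunE (can2_eq (permKV s) (permK s)).
by rewrite !raddfB /= !fgmapU !upd_perm.
Qed.

(* Pulling back along [s^-1] makes this a left action for composition of
   functions, [perm] multiplication being composition in diagram order. *)
Definition tensor_perm : {additive tensor n A -> tensor n A} :=
  zquot_map tensor_perm_subproof.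

Lemma tensor_permE x : tensor_perm (pure x) = pure (ffun_perm x).
Proof. by rewrite /tensor_perm zquot_mapE /= fgmapU. Qed.

End TensorPerm.

Lemma tensor_perm_map n (s : 'S_n) (A B : zmodType) (f : {additive A -> B}) x :
  tensor_perm s B (tensor_map n f x) = tensor_map n f (tensor_perm s A x).
Proof.
apply: (tensorP (f := tensor_perm s B \o tensor_map n f)
                (g := tensor_map n f \o tensor_perm s A)) => y.
rewrite -[LHS]/(tensor_perm s B (tensor_map n f (pure y))).
rewrite -[RHS]/(tensor_map n f (tensor_perm s A (pure y))).
rewrite !(tensor_mapE, tensor_permE); congr pure.
by apply/ffunP => i; rewrite !ffunE.
Qed.

Lemma tensor_map_id n (A : zmodType) x :
  tensor_map n (idfun : {additive A -> A}) x = x.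
Proof.
apply: (tensorP (g := idfun)) => y; rewrite tensor_mapE; congr pure.
by apply/ffunP => i; rewrite ffunE.
Qed.

Lemma tensor_map_comp n (A B D : zmodType)
    (f : {additive A -> B}) (g : {additive B -> D}) x :
  tensor_map n (g \o f) x = tensor_map n g (tensor_map n f x).
Proof.
apply: (tensorP (g := tensor_map n g \o tensor_map n f)) => y.
rewrite -[RHS]/(tensor_map n g (tensor_map n f (pure y))) !tensor_mapE.
congr pure.
by apply/ffunP => i; rewrite !ffunE.
Qed.

Definition Tpow (n : nat) : abEndofunctor :=
  AbEndofunctor (@tensor_map_id n) (@tensor_map_comp n).

Section Exterior.
Variables (n : nat) (A : zmodType).

Definition alternating_rel (z : tensor n A) : Prop :=
  exists (x : {ffun 'I_n -> A}) (i j : 'I_n),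
    [/\ i != j, x i = x j & z = pure x].

Definition exterior : zmodType := zquot alternating_rel.

End Exterior.

Section ExteriorMap.
Variables (n : nat) (A B : zmodType) (f : {additive A -> B}).

Fact exterior_map_subproof (z : tensor n A) :
  alternating_rel z -> alternating_rel (tensor_map n f z).
Proof.
move=> [x [i [j [ij xij ->]]]]; exists (ffun_map f x), i, j.
by rewrite tensor_mapE !ffunE xij.
Qed.

Definition exterior_map : {additive exterior n A -> exterior n B} :=
  zquot_map exterior_map_subproof.

Lemma exterior_mapE x :
  exterior_map (zpi (@alternating_rel n A) x) =
  zpi (@alternating_rel n B) (tensor_map n f x).
Proof. exact: zquot_mapE. Qed.

End ExteriorMap.

Fact exterior_map_id n (A : zmodType) x :
  exterior_map n (idfun : {additive A -> A}) x = x.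
Proof.
apply: (zquotP (g := idfun)) => y.
by rewrite exterior_mapE tensor_map_id.
Qed.

Fact exterior_map_comp n (A B D : zmodType)
    (f : {additive A -> B}) (g : {additive B -> D}) x :
  exterior_map n (g \o f) x = exterior_map n g (exterior_map n f x).
Proof.
apply: (zquotP (g := exterior_map n g \o exterior_map n f)) => y.
rewrite -[RHS]/(exterior_map n g (exterior_map n f (zpi _ y))).
by rewrite !exterior_mapE tensor_map_comp.
Qed.

Definition Lpow (n : nat) : abEndofunctor :=
  AbEndofunctor (@exterior_map_id n) (@exterior_map_comp n).

Section DividedPower.
Variables (n : nat) (A : zmodType).

Definition sym_tensor : {pred tensor n A} :=
  fun x => [forall s : 'S_n, tensor_perm s A x == x].

Fact sym_tensor_zmod_closed : zmod_closed sym_tensor.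
Proof.
split=> [|x y /forallP sx /forallP sy]; apply/forallP => s; first by rewrite raddf0.
by rewrite raddfB (eqP (sx s)) (eqP (sy s)).
Qed.

(* The invariants of the symmetric group in the tensor power, which are the
   divided power when [A] is free abelian, hence on all values of [ab]. *)
Record gamma := Gamma { gammaval :> tensor n A; _ : gammaval \in sym_tensor }.
HB.instance Definition _ := [isSub for gammaval].
HB.instance Definition _ := [Choice of gamma by <:].
HB.instance Definition _ :=
  GRing.SubChoice_isSubZmodule.Build (tensor n A) sym_tensor gamma
    sym_tensor_zmod_closed.

End DividedPower.

Section GammaMap.
Variables (n : nat) (A B : zmodType) (f : {additive A -> B}).

Fact gamma_map_subproof (x : gamma n A) : tensor_map n f (val x) \in @sym_tensor n B.
Proof.
case: x => x /= /forallP sx; apply/forallP => s.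
by rewrite tensor_perm_map (eqP (sx s)).
Qed.

Definition gamma_map_fun (x : gamma n A) : gamma n B := Gamma (gamma_map_subproof x).

Fact gamma_map_is_additive : zmod_morphism gamma_map_fun.
Proof.
move=> x y; apply: val_inj; rewrite raddfB.
by rewrite -[LHS]/(tensor_map n f (val (x - y))) !raddfB.
Qed.

Definition gamma_map : {additive gamma n A -> gamma n B} :=
  HB.pack gamma_map_fun
    (GRing.isZmodMorphism.Build _ _ gamma_map_fun gamma_map_is_additive).

End GammaMap.

Fact gamma_map_id n (A : zmodType) x :
  gamma_map n (idfun : {additive A -> A}) x = x.
Proof. by apply: val_inj; apply: tensor_map_id. Qed.

Fact gamma_map_comp n (A B D : zmodType)
    (f : {additive A -> B}) (g : {additive B -> D}) x :
  gamma_map n (g \o f) x = gamma_map n g (gamma_map n f x).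
Proof. by apply: val_inj; apply: tensor_map_comp. Qed.

Definition Gpow (n : nat) : abEndofunctor :=
  AbEndofunctor (@gamma_map_id n) (@gamma_map_comp n).

Program Definition Tpow_perm n (s : 'S_n) (C : category) (F : functor C) :
    natTrans (fcomp (Tpow n) F) (fcomp (Tpow n) F) :=
  nat_of (fun X => tensor_perm s (F X)) _.
Next Obligation. exact: tensor_perm_map. Qed.

(* Ext is contravariant in its first variable, so [s^-1] yields a left action. *)
Definition ext_act_l i m (s : 'S_m) (G : functor gr) :
    {additive Ext i (fcomp (Tpow m) ab) G -> Ext i (fcomp (Tpow m) ab) G} :=
  ext_map i (Tpow_perm (s^-1)%g ab) (nat_id G).

Definition ext_act i m n (s : 'S_m) (t : 'S_n) :
    {additive Ext i (fcomp (Tpow m) ab) (fcomp (Tpow n) ab) ->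
              Ext i (fcomp (Tpow m) ab) (fcomp (Tpow n) ab)} :=
  ext_map i (Tpow_perm (s^-1)%g ab) (Tpow_perm t ab).

Definition surj_pred n m (f : {ffun 'I_n -> 'I_m}) : bool :=
  [forall j, exists i, f i == j].

Definition Sur n m : Type := {f : {ffun 'I_n -> 'I_m} | surj_pred f}.
HB.instance Definition _ n m := Choice.on (Sur n m).

Fact sur_act_subproof n m (s : 'S_m) (t : 'S_n) (f : Sur n m) :
  surj_pred [ffun i => s (val f ((t^-1)%g i))].
Proof.
apply/forallP => j.
have /forallP/(_ ((s^-1)%g j))/existsP[i /eqP fi] := valP f.
by apply/existsP; exists (t i); rewrite ffunE permK fi permKV.
Qed.

Definition sur_act n m (s : 'S_m) (t : 'S_n) (f : Sur n m) : Sur n m :=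
  exist (fun f => surj_pred f) _ (sur_act_subproof s t f).

Definition sur_twisted_act n m (s : 'S_m) (t : 'S_n) (D : {freeg (Sur n m)}) :
    {freeg (Sur n m)} :=
  (-1) ^+ s * (-1) ^+ t *: fgmap (sur_act s t) D.

Definition composition_pred (n m : nat) (c : {ffun 'I_m -> nat}) : bool :=
  [forall j, 0 < c j]%N && (\sum_j c j == n)%N.

Definition Comp n m : Type := {c : {ffun 'I_m -> nat} | composition_pred n c}.
HB.instance Definition _ n m := Choice.on (Comp n m).

Fact comp_act_subproof n m (s : 'S_m) (c : Comp n m) :
  composition_pred n [ffun j => val c ((s^-1)%g j)].
Proof.
case: c => c /= /andP[/forallP c0 /eqP cn]; apply/andP; split.
  by apply/forallP => j; rewrite ffunE.
apply/eqP; rewrite -cn (reindex_inj (@perm_inj _ s)).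
by apply: eq_bigr => j _; rewrite ffunE permK.
Qed.

(* The action induced by post-composition on the tuples of fibre
   cardinalities of surjections. *)
Definition comp_act n m (s : 'S_m) (c : Comp n m) : Comp n m :=
  exist (fun c => composition_pred n c) _ (comp_act_subproof s c).

Definition comp_twisted_act n m (s : 'S_m) (D : {freeg (Comp n m)}) :
    {freeg (Comp n m)} :=
  (-1) ^+ s *: fgmap (comp_act s) D.

(* Main.v *)
From HB Require Import structures.
Require Import Defs.
From mathcomp Require Import all_boot all_order all_algebra perm.
From mathcomp Require Import boolp freeg zify.

Set Implicit Arguments.
Unset Strict Implicit.
Unset Printing Implicit Defensive.

Import GRing.Theory Num.Theory.
Local Open Scope ring_scope.
Local Notation hom := Defs.hom.
Local Notation fgmap := Defs.fgmap.

(** The reason for the theorem is that [ab] is the first homology of a free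
    group, and that a free group has no homology in higher degrees. Its reduced bar
    complex, which consists of the tensor powers of the augmentation ideal, is
    therefore a resolution of [ab], and the tensor product of [m] such complexes
    is a resolution of [fcomp (Tpow m) ab]; degree [N] of it is spanned by the
    [m]-tuples of nonempty words without the letter 1, of total length [N]
    ([barob], [bar_resolution]). Exactness is checked on each group, with a
    contraction that is given by Fox derivatives ([hbar_homotopy],
    [bardiff_exact]).

    These functors are projective. A tuple of words of total length [N] is the
    image of a generic one, in which each generator of the free group of rank [N]
    occurs once. So a natural transformation to a functor [H] amounts to an
    element of [H (FG N)] for each shape, that is for each composition of [N] with
    [m] components, subject to the condition that killing any generator
    annihilates it ([nat_sym], [yo], [barF_projective]). By comparison of
    resolutions, Ext is the cohomology of the complex of these elements
    ([ext_class_eq0], [ext_iso_coeffs]).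

    For tensor powers, such an element is a combination of tensors of [n]
    generators in which every generator occurs. The position of a factor among the
    generators gives a map [f] from ['I_n] onto ['I_N], and the word in which
    its generator occurs gives a map [g] onto ['I_m] through which the shape is
    recovered: [f] is a refinement, into [N] blocks, of the ordered partition of
    ['I_n] into the fibres of [g] ([coef], [coef_exists], [labelled_valid]). The
    differential preserves [g] and merges consecutive blocks ([coef_barD]). For
    each surjection [g] this is the cellular complex of a product of
    permutohedra. Hence the cohomology is infinite cyclic, lives in degree [N = n],
    and is detected by the sum over all refinements into singletons, with the
    signs of the orders that they define ([sort_cocycle], [exact_low],
    [exact_top]). These signs produce the sign representation of the symmetric
    group of the target ([topc_target]). That of the source acts on the resolution
    by permuting words, with Koszul signs; on singletons these account for the
    permutation of the orders ([topc_source]), and what remains is the sign that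
    makes the action lift the one on [Tpow m] ([bact_chainP]).

    For exterior powers, a wedge of [n] generators in which [N] generators occur
    vanishes unless [N = n], where it is a multiple of the standard one. The complex
    is therefore concentrated in one degree, and has one basis element for each
    shape ([normalized_wedge0], [normalized_top]).

    Divided powers are the invariants in tensor powers, so they correspond to
    invariant functions of [(g, f)]. If a fibre of [g] has at least two elements,
    take the first such fibre: splitting off one element of its first block is a
    contracting homotopy, and by invariance it does not matter which element it is
    ([icontract_homotopy]). So nothing is left unless [m = n], where all the
    bijections form one orbit ([supported_orbit]). *)

(** * Projective resolutions compute Ext *)

Section NatComp.
Variable C : category.

Lemma nat_compA (F G H K : functor C) (c : natTrans H K) (b : natTrans G H)
    (a : natTrans F G) : nat_comp c (nat_comp b a) = nat_comp (nat_comp c b) a.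
Proof. exact: natTransP. Qed.

Lemma nat_comp1l (F G : functor C) (a : natTrans F G) : nat_comp (nat_id G) a = a.
Proof. exact: natTransP. Qed.

Lemma nat_comp1r (F G : functor C) (a : natTrans F G) : nat_comp a (nat_id F) = a.
Proof. exact: natTransP. Qed.

Lemma nat_compDl (F G H : functor C) (b b' : natTrans G H) (a : natTrans F G) :
  nat_comp (b + b') a = nat_comp b a + nat_comp b' a.
Proof. exact: natTransP. Qed.

Lemma nat_compBl (F G H : functor C) (b b' : natTrans G H) (a : natTrans F G) :
  nat_comp (b - b') a = nat_comp b a - nat_comp b' a.
Proof. exact: natTransP. Qed.

Lemma nat_comp0l (F G H : functor C) (a : natTrans F G) :
  nat_comp (0 : natTrans G H) a = 0.
Proof. exact: natTransP. Qed.

Lemma nat_compDr (F G H : functor C) (b : natTrans G H) (a a' : natTrans F G) :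
  nat_comp b (a + a') = nat_comp b a + nat_comp b a'.
Proof. by apply: natTransP => X x /=; rewrite raddfD. Qed.

Lemma nat_compNr (F G H : functor C) (b : natTrans G H) (a : natTrans F G) :
  nat_comp b (- a) = - nat_comp b a.
Proof. by apply: natTransP => X x /=; rewrite raddfN. Qed.

Lemma nat_compBr (F G H : functor C) (b : natTrans G H) (a a' : natTrans F G) :
  nat_comp b (a - a') = nat_comp b a - nat_comp b a'.
Proof. by rewrite nat_compDr nat_compNr. Qed.

Lemma nat_comp0r (F G H : functor C) (b : natTrans G H) :
  nat_comp b (0 : natTrans F G) = 0.
Proof. by apply: natTransP => X x /=; rewrite raddf0. Qed.

End NatComp.

Section Complexes.
Variable C : category.

Definition projective (P : functor C) : Prop :=
  forall (G H : functor C) (p : natTrans G H) (a : natTrans P H),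
    (forall X y, exists x, p X x = y) -> exists b, nat_comp p b = a.

(** An augmented complex of projectives [... -> P 1 -> P 0 -> F -> 0], exact at
    every place, is stored with its augmentation module at index [0], so that
    the augmentation is one more differential. *)
Record augmented_resolution := AugRes {
  ar_ob :> nat -> functor C;
  ar_d : forall i, natTrans (ar_ob i.+1) (ar_ob i);
  ar_proj : forall i, projective (ar_ob i.+1);
  ar_dd : forall i, nat_comp (ar_d i) (ar_d i.+1) = 0;
  ar_surj : forall X y, exists x, ar_d 0 X x = y;
  ar_exact : forall i X y, ar_d i X y = 0 -> exists x, ar_d i.+1 X x = y
}.

(** A projective lifts along surjections only, so [u] is first restricted to the
    kernel of [e], onto which [d] is surjective. *)
Lemma projective_factor (Q A B D : functor C) (d : natTrans A B)
    (e : natTrans B D) (u : natTrans Q B) : projective Q ->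
  (forall X y, e X y = 0 -> exists x, d X x = y) -> nat_comp e d = 0 ->
  nat_comp e u = 0 -> exists v, nat_comp d v = u.
Proof.
move=> Qproj exact ed eu.
have eu0 X x : e X (u X x) = 0 by rewrite -[LHS]/(nat_comp e u X x) eu.
have ed0 X x : e X (d X x) = 0 by rewrite -[LHS]/(nat_comp e d X x) ed.
pose kfun (G : functor C) (w : natTrans G B) (w0 : forall X x, e X (w X x) = 0)
    X (x : G X) : nat_ker e X := Ker (introT eqP (w0 X x)).
have kadd G w w0 X : zmod_morphism (kfun G w w0 X).
  by move=> x y; apply: val_inj; rewrite /= raddfB.
have knat G w w0 X Y (h : hom X Y) x :
    kfun G w w0 Y (fmap G h x) = fmap (nat_ker e) h (kfun G w w0 X x).
  by apply: val_inj; rewrite /= napp_nat.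
pose knt G w w0 := NatTrans (kadd G w w0) (knat G w w0).
have [X y|v vP] := Qproj _ _ (knt A d ed0) (knt Q u eu0).
  have [x dx] := exact X (val y) (kerP y).
  by exists x; apply: val_inj.
exists v; apply: natTransP => X x.
have e1 : (nat_comp (knt A d ed0) v) X x = knt Q u eu0 X x by rewrite vP.
exact: (congr1 val e1).
Qed.

Lemma ar_factor (R : augmented_resolution) (Q : functor C) i
    (u : natTrans Q (R i.+1)) : projective Q ->
  nat_comp (ar_d R i) u = 0 -> exists v, nat_comp (ar_d R i.+1) v = u.
Proof.
by move=> Qproj; apply: projective_factor => //; [apply: ar_exact | apply: ar_dd].
Qed.

Section Comparison.
Variables (Q R : augmented_resolution).

Definition chain_map (f : forall i, natTrans (Q i) (R i)) : Prop :=
  forall i, nat_comp (ar_d R i) (f i.+1) = nat_comp (f i) (ar_d Q i).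

Lemma chain_map_lift (a : natTrans (Q 0) (R 0)) :
  exists f : forall i, natTrans (Q i) (R i), f 0 = a /\ chain_map f.
Proof.
have [a1 a1P] : exists a1, nat_comp (ar_d R 0) a1 = nat_comp a (ar_d Q 0).
  by apply: ar_proj; apply: ar_surj.
pose S i := {p : natTrans (Q i) (R i) * natTrans (Q i.+1) (R i.+1) |
  nat_comp (ar_d R i) p.2 = nat_comp p.1 (ar_d Q i)}.
have step i (p : S i) : {q : S i.+1 | (sval q).1 = (sval p).2}.
  apply: cid; case: p => [[b c] /= bc].
  have [|v vP] := @ar_factor R _ i (nat_comp c (ar_d Q i.+1)) (@ar_proj Q _).
    by rewrite nat_compA bc -nat_compA ar_dd nat_comp0r.
  by exists (exist _ (c, v) vP).
pose s := nat_rect S (exist _ (a, a1) a1P) (fun i p => sval (step i p)).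
exists (fun i => (sval (s i)).1); split=> // i.
have <- : (sval (s i)).2 = (sval (s i.+1)).1 by rewrite /= (svalP (step i (s i))).
exact: (svalP (s i)).
Qed.

(** The homotopy [h i] goes up one degree, and the vanishing of [f 0] on the
    augmentation modules is what starts its construction. *)
Lemma null_homotopy (f : forall i, natTrans (Q i) (R i)) :
  chain_map f -> f 0 = 0 ->
  exists h : forall i, natTrans (Q i) (R i.+1), h 0 = 0 /\
    forall i, f i.+1 = nat_comp (ar_d R i.+1) (h i.+1) + nat_comp (h i) (ar_d Q i).
Proof.
move=> fP f0.
pose S i := {p : natTrans (Q i) (R i.+1) * natTrans (Q i.+1) (R i.+2) |
  f i.+1 = nat_comp (ar_d R i.+1) p.2 + nat_comp p.1 (ar_d Q i)}.
have [h1 h1P] : exists h1, nat_comp (ar_d R 1) h1 = f 1.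
  by apply: ar_factor; [apply: ar_proj | rewrite fP f0 nat_comp0l].
have e0 : f 1 = nat_comp (ar_d R 1) h1 + nat_comp (0 : natTrans (Q 0) (R 1)) (ar_d Q 0).
  by rewrite nat_comp0l addr0.
have step i (p : S i) : {q : S i.+1 | (sval q).1 = (sval p).2}.
  apply: cid; case: p => [[b c] /= bc].
  have [|v vP] := @ar_factor R _ i.+1 (f i.+2 - nat_comp c (ar_d Q i.+1)) (@ar_proj Q _).
    rewrite nat_compBr fP bc nat_compDl -!nat_compA ar_dd nat_comp0r addr0.
    by rewrite subrr.
  have vP' : f i.+2 = nat_comp (ar_d R i.+2) v + nat_comp c (ar_d Q i.+1).
    by rewrite vP subrK.
  by exists (exist _ (c, v) vP').
pose s := nat_rect S (exist _ (0, h1) e0) (fun i p => sval (step i p)).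
exists (fun i => (sval (s i)).1); split=> // i.
have <- : (sval (s i)).2 = (sval (s i.+1)).1 by rewrite /= (svalP (step i (s i))).
exact: (svalP (s i)).
Qed.

Lemma chain_map_homotopic (f g : forall i, natTrans (Q i) (R i)) :
  chain_map f -> chain_map g -> f 0 = g 0 ->
  exists h : forall i, natTrans (Q i) (R i.+1), h 0 = 0 /\
    forall i, f i.+1 - g i.+1 =
      nat_comp (ar_d R i.+1) (h i.+1) + nat_comp (h i) (ar_d Q i).
Proof.
move=> fP gP fg0; apply: (@null_homotopy (fun i => f i - g i)).
  by move=> i; rewrite nat_compBr fP gP nat_compBl.
by rewrite fg0 subrr.
Qed.

End Comparison.

Lemma chain_map_comp (Q R S : augmented_resolution)
    (f : forall i, natTrans (Q i) (R i)) (g : forall i, natTrans (R i) (S i)) :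
  chain_map f -> chain_map g -> chain_map (fun i => nat_comp (g i) (f i)).
Proof. by move=> fP gP i; rewrite nat_compA gP -nat_compA fP nat_compA. Qed.

Lemma chain_map_id (Q : augmented_resolution) :
  @chain_map Q Q (fun i => nat_id (Q i)).
Proof. by move=> i; rewrite nat_comp1l nat_comp1r. Qed.

Section Standard.
Variable F : functor C.

Definition std_ob (i : nat) : functor C := if i is j.+1 then res F j else F.

Definition std_d (i : nat) : natTrans (std_ob i.+1) (std_ob i) :=
  if i is j.+1 return natTrans (std_ob i.+1) (std_ob i)
  then res_diff F j else res_aug F.

Fact std_dd i : nat_comp (std_d i) (std_d i.+1) = 0.
Proof.
case: i => [|j] /=; last exact: res_diff_diff.
by apply: natTransP => X x; apply: (kerP (cover_eps (syzygy F 1) X x)).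
Qed.

Fact std_exact i X y : std_d i X y = 0 -> exists x, std_d i.+1 X x = y.
Proof.
move=> dy.
have e : cover_eps (syzygy F i) X y = 0.
  by case: i y dy => [|j] y //= dy; apply: val_inj.
have [x xP] := cover_eps_surj (F := syzygy F i.+1) (Ker (introT eqP e)).
by exists x; apply: (congr1 val xP).
Qed.

Definition standard_resolution : augmented_resolution :=
  @AugRes std_ob std_d (fun i => @cover_projective C (syzygy F i)) std_dd
    (@cover_eps_surj C F) std_exact.

End Standard.

(** This identifies the functoriality of Ext in its first variable with the one
    that any lift of [a] to a resolution induces. *)
Lemma standard_chain_map (F : functor C) (a : natTrans F F) :
  @chain_map (standard_resolution F) (standard_resolution F)
    (fun i => if i is j.+1 return natTrans (std_ob F i) (std_ob F i)
              then res_map a j else a).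
Proof.
case=> [|j] /=; last by rewrite -res_map_diff.
apply: natTransP => X x; exact: (cover_map_eps a).
Qed.

(** ** Ext from an arbitrary resolution *)

Section ExtOfResolution.
Variable R : augmented_resolution.
Notation F := (R 0).

Definition to_res (i : nat) : natTrans (std_ob F i) (R i) :=
  sval (cid (@chain_map_lift (standard_resolution F) R (nat_id F))) i.

Lemma to_res0 : to_res 0 = nat_id F.
Proof. by rewrite /to_res; case: (cid _) => ? []. Qed.

Lemma to_resP : @chain_map (standard_resolution F) R to_res.
Proof. by rewrite /to_res; case: (cid _) => ? []. Qed.

Variable G : functor C.

Definition is_cocycle i (z : natTrans (R i.+1) G) : Prop :=
  nat_comp z (ar_d R i.+1) = 0.

Definition is_coboundary i : natTrans (R i.+1) G -> Prop :=
  match i with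
  | 0 => fun z => z = 0
  | j.+1 => fun z => exists y, z = nat_comp y (ar_d R j.+1)
  end.

Fact ext_class_subproof i (z : natTrans (R i.+1) G) : is_cocycle z ->
  nat_whisker (res_diff F i) (nat_id G) (nat_comp z (to_res i.+1)) = 0.
Proof.
move=> zP; rewrite /nat_whisker nat_comp1l -nat_compA.
by rewrite -(to_resP i.+1) nat_compA zP nat_comp0l.
Qed.

Definition ext_class i (z : natTrans (R i.+1) G) (zP : is_cocycle z) : Ext i F G :=
  zpi (@coboundary C F G i) (Ker (introT eqP (ext_class_subproof zP))).

Lemma coboundaryB i (y z : cocycle F G i) :
  coboundary y -> coboundary z -> coboundary (y - z).
Proof.
case: i y z => [|j] y z /=; first by move=> -> ->; rewrite subr0.
move=> [y' yP] [z' zP]; exists (y' - z').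
by rewrite nat_compBl -yP -zP.
Qed.

Lemma gen_coboundary i (z : cocycle F G i) : gen (@coboundary C F G i) z -> coboundary z.
Proof.
elim=> [|//|x y _ xP _ yP]; last exact: coboundaryB.
case: i {z} => [//|j]; exists 0; by rewrite nat_comp0l.
Qed.

(** The cocycle kills the term of the homotopy formula that begins with the
    differential of [R], and the other term is a coboundary. *)
Lemma homotopic_cocycle (Q : augmented_resolution)
    (f g : forall i, natTrans (Q i) (R i)) i (z : natTrans (R i.+1) G) :
  chain_map f -> chain_map g -> f 0 = g 0 -> is_cocycle z ->
  match i return natTrans (Q i.+1) G -> Prop with
  | 0 => fun w => w = 0
  | j.+1 => fun w => exists y, w = nat_comp y (ar_d Q j.+1)
  end (nat_comp z (f i.+1) - nat_comp z (g i.+1)).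
Proof.
move=> fP gP fg zP; have [h [h0 hP]] := chain_map_homotopic fP gP fg.
rewrite -nat_compBr hP nat_compDr nat_compA zP nat_comp0l add0r.
case: i z zP => [|j] z zP; first by rewrite h0 nat_comp0l nat_comp0r.
by exists (nat_comp z (h j.+1)); rewrite nat_compA.
Qed.

End ExtOfResolution.

Section ExtIso.
Variables (R : augmented_resolution) (G : functor C).
Notation F := (R 0).

Lemma ext_class_surj i (x : Ext i F G) :
  exists z : natTrans (R i.+1) G, exists zP : is_cocycle z, x = ext_class zP.
Proof.
have [b [b0 bP]] := @chain_map_lift R (standard_resolution F) (nat_id F).
pose y := zrepr x.
have yP : nat_comp (val y) (res_diff F i) = 0.
  by apply: etrans (kerP y); apply: natTransP.
have zP : @is_cocycle R G i (nat_comp (val y) (b i.+1)).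
  by rewrite /is_cocycle -nat_compA -(bP i.+1) nat_compA yP nat_comp0l.
exists (nat_comp (val y) (b i.+1)), zP.
rewrite -[x]zreprK /ext_class -/y; apply/eqP; rewrite -subr_eq0 -raddfB.
apply/eqP/zpi_eq0/gen_in.
have := @homotopic_cocycle (standard_resolution F) G (standard_resolution F)
  (fun i => nat_id (std_ob F i)) (fun i => nat_comp (b i) (to_res R i)) i (val y)
  (@chain_map_id _) (chain_map_comp (@to_resP R) bP).
rewrite b0 to_res0 nat_comp1l => /(_ erefl yP).
have -> : nat_comp (val y) (nat_id (std_ob F i.+1)) = val y by apply: natTransP.
rewrite nat_compA.
move: (ext_class_subproof zP) => /= s; clearbody y.
case: i y {yP zP x} s => [|j] y s /=; last by [].
by move=> e; apply: val_inj.
Qed.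

(** Comparing the two resolutions in both directions, the composites are
    homotopic to the identity. *)
Lemma ext_class_eq0 i (z : natTrans (R i.+1) G) (zP : is_cocycle z) :
  ext_class zP = 0 <-> is_coboundary z.
Proof.
have [b [b0 bP]] := @chain_map_lift R (standard_resolution F) (nat_id F).
split=> [/zpi_eq0 /gen_coboundary cz | cz].
  have := @homotopic_cocycle R G R (fun i => nat_id (R i))
    (fun i => nat_comp (to_res R i) (b i)) i z (@chain_map_id _)
    (chain_map_comp bP (@to_resP R)).
  rewrite b0 to_res0 nat_comp1l => /(_ erefl zP).
  have -> : nat_comp z (nat_id (R i.+1)) = z by apply: natTransP.
  rewrite nat_compA.
  case: i z zP cz => [|j] z zP /=.
    by move=> /(congr1 val) /= ->; rewrite nat_comp0l subr0.
  move=> [y ->] [y' /eqP]; rewrite subr_eq => /eqP ->.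
  rewrite -nat_compA; have /= -> := bP j.+1; rewrite nat_compA -nat_compDl.
  by exists (y' + nat_comp y (b j.+1)).
apply/zpi_eq0/gen_in; case: i z zP cz => [|j] z zP /= => [e|[y e]].
  by apply: val_inj; rewrite /= e nat_comp0l.
exists (nat_comp y (to_res R j.+1)).
by rewrite /= e -!nat_compA; congr nat_comp; apply: (to_resP R j.+1).
Qed.

Lemma is_cocycleB i (z z' : natTrans (R i.+1) G) :
  is_cocycle z -> is_cocycle z' -> is_cocycle (z - z').
Proof. by move=> zP zP'; rewrite /is_cocycle nat_compBl zP zP' subr0. Qed.

Lemma ext_classB i (z z' : natTrans (R i.+1) G) (zP : is_cocycle z)
    (zP' : is_cocycle z') :
  ext_class (is_cocycleB zP zP') = ext_class zP - ext_class zP'.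
Proof.
by rewrite /ext_class -raddfB; congr (zpi _ _); apply: val_inj; rewrite /= nat_compBl.
Qed.

Lemma ext_vanish i : (forall z : natTrans (R i.+1) G, is_cocycle z -> is_coboundary z) ->
  forall x : Ext i F G, x = 0.
Proof.
by move=> van x; have [z [zP ->]] := ext_class_surj x; apply/ext_class_eq0/van.
Qed.

(** Ext is read off from any additive invariant of cochains with these two
    properties, whatever the resolution. *)
Lemma ext_iso i (M : zmodType) (Phi : {additive natTrans (R i.+1) G -> M}) :
  (forall z, is_cocycle z -> Phi z = 0 <-> is_coboundary z) ->
  (forall y, exists z, is_cocycle z /\ Phi z = y) ->
  exists phi : {additive Ext i F G -> M}, bijective phi /\
    forall z (zP : is_cocycle z), phi (ext_class zP) = Phi z.
Proof.
move=> ker_Phi surj_Phi.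
pose rep x := cid (ext_class_surj (i := i) x).
pose f (x : Ext i F G) : M := Phi (sval (rep x)).
have fE z (zP : is_cocycle z) : f (ext_class zP) = Phi z.
  rewrite /f; case: (rep _) => z' /= [zP' e]; apply/eqP; rewrite -subr_eq0 -raddfB.
  apply/eqP/ker_Phi; first exact: is_cocycleB.
  by apply/(ext_class_eq0 (is_cocycleB zP' zP)); rewrite ext_classB e subrr.
have fB : zmod_morphism f.
  move=> x y; have [z [zP ->]] := ext_class_surj x.
  have [z' [zP' ->]] := ext_class_surj y.
  by rewrite -ext_classB !fE raddfB.
pose phi : {additive Ext i F G -> M} := HB.pack f (GRing.isZmodMorphism.Build _ _ f fB).
have phiE z (zP : is_cocycle z) : phi (ext_class zP) = Phi z by exact: fE.
exists phi; split=> //.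
pose g y := let s := cid (surj_Phi y) in ext_class (proj1 (svalP s)).
exists g => [x|y]; last by rewrite /g phiE; case: (cid _) => ? [].
have [z [zP ->]] := ext_class_surj x.
rewrite /g phiE; case: (cid _) => z' /= [zP' e]; apply/eqP.
rewrite -subr_eq0 -ext_classB; apply/eqP/ext_class_eq0/ker_Phi.
  exact: is_cocycleB.
by rewrite raddfB e subrr.
Qed.

Variables (G' : functor C) (a : natTrans F F) (b : natTrans G G').

(** On the standard resolution the action is defined by one particular lift of
    [a]; any other lift [f], on any resolution, gives a homotopic chain map. *)
Lemma ext_map_class (f : forall i, natTrans (R i) (R i)) i
    (z : natTrans (R i.+1) G) (zP : is_cocycle z)
    (zP' : is_cocycle (nat_comp b (nat_comp z (f i.+1)))) :
  chain_map f -> f 0 = a -> ext_map i a b (ext_class zP) = ext_class zP'.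
Proof.
move=> fP f0; rewrite /ext_map /ext_class zquot_mapE; apply/eqP.
rewrite -subr_eq0 -raddfB; apply/eqP/zpi_eq0/gen_in.
have := @homotopic_cocycle R G (standard_resolution F) _ _ i z
  (chain_map_comp (standard_chain_map a) (@to_resP R))
  (chain_map_comp (@to_resP R) fP).
rewrite to_res0 f0 nat_comp1l nat_comp1r => /(_ erefl zP).
case: i z zP zP' => [|j] z zP zP' /= => [e|[y e]].
  apply: val_inj; rewrite /= /nat_whisker -2!nat_compA -nat_compBr.
  by rewrite -[RHS](nat_comp0r _ b) -e !nat_compA.
exists (nat_comp b y); rewrite -[RHS]nat_compA -e /= /nat_whisker nat_compBr.
by rewrite !nat_compA.
Qed.

End ExtIso.
End Complexes.

(** * Free groups of finite rank *)

Definition is_basis (G : groupType) (n : nat) (e : 'I_n -> G) : Prop :=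
  forall (H : groupType) (f : 'I_n -> H),
    exists! g : {multiplicative G -> H}, forall i, g (e i) = f i.

Lemma mult1 (G H : groupType) (f : {multiplicative G -> H}) : f 1%g = 1%g.
Proof. by apply: (mulgI (f 1%g)); rewrite -gmulfM !mulg1. Qed.

Lemma multV (G H : groupType) (f : {multiplicative G -> H}) x : f (x^-1)%g = ((f x)^-1)%g.
Proof. by apply: (mulgI (f x)); rewrite -gmulfM !mulgV mult1. Qed.

Section ReducedWords.

Definition flip_letter (l : nat * bool) := (l.1, ~~ l.2).

Definition reduced := sorted (fun x y : nat * bool => y != flip_letter x).

Definition push (l : nat * bool) (u : seq (nat * bool)) :=
  if u is h :: t then if h == flip_letter l then t else l :: u else [:: l].

Definition wmul u v := foldr push v u.

Definition winv u := rev (map flip_letter u).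

Lemma flip_letterK : involutive flip_letter.
Proof. by case=> a b; rewrite /flip_letter /= negbK. Qed.

Lemma push_reduced l u : reduced u -> reduced (push l u).
Proof.
case: u => [|h t] //= ht; case: eqVneq => [_|hl]; first exact: path_sorted ht.
by rewrite /= hl.
Qed.

Lemma wmul_reduced u v : reduced v -> reduced (wmul u v).
Proof. by move=> rv; elim: u => //= l u; apply: push_reduced. Qed.

Lemma pushK l u : reduced u -> push l (push (flip_letter l) u) = u.
Proof.
case: u => [|h t] /=; first by rewrite eqxx.
rewrite flip_letterK; case: (eqVneq h l) => [->|hl] /= ht; last by rewrite eqxx.
by case: t ht => [|k t] //= /andP[/negPf ->].
Qed.

Lemma push_reduced_cons l u : reduced (l :: u) -> push l u = l :: u.
Proof. by case: u => [|h t] //= /andP[/negPf ->]. Qed.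

(** Pushing a letter and then multiplying agrees with multiplying and then
    pushing, even if the letter cancels; associativity of the product of reduced
    words follows by induction. *)
Lemma wmul_push l x w : reduced x -> reduced w ->
  wmul (push l x) w = push l (wmul x w).
Proof.
case: x => [|h t] //= rx rw; case: (eqVneq h (flip_letter l)) => [->|//].
by rewrite pushK //; apply: wmul_reduced.
Qed.

Lemma wmulA u v w : reduced v -> reduced w ->
  wmul u (wmul v w) = wmul (wmul u v) w.
Proof.
move=> rv rw; elim: u => //= l u ->.
by rewrite wmul_push //; apply: wmul_reduced.
Qed.

Lemma wmul1 u : reduced u -> wmul u [::] = u.
Proof.
elim: u => //= l u IH ru; rewrite IH; last exact: path_sorted ru.
exact: push_reduced_cons.
Qed.

Lemma winvK : involutive winv.
Proof. by move=> u; rewrite /winv map_rev revK mapK //; apply: flip_letterK. Qed.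

Lemma winv_reduced u : reduced u -> reduced (winv u).
Proof.
rewrite /reduced /winv rev_sorted sorted_map; apply: sub_sorted => x y /=.
by apply: contra => /eqP e; rewrite -(inj_eq (can_inj flip_letterK)) e !flip_letterK.
Qed.

Lemma wmulV u : wmul (winv u) u = [::].
Proof.
elim: u => //= l u IH; rewrite /winv /= rev_cons /wmul foldr_rcons /=.
by rewrite flip_letterK eqxx.
Qed.

Lemma wmulVr u : wmul u (winv u) = [::].
Proof. by rewrite -{1}[u]winvK wmulV. Qed.

End ReducedWords.

Section FreeGroup.
Variable K : nat.

Definition fword_pred (w : seq (nat * bool)) :=
  reduced w && all (fun l => l.1 < K)%N w.

Record fword : Set := FWord { fword_seq :> seq (nat * bool); _ : fword_pred fword_seq }.

Lemma fword_inj (u v : fword) : fword_seq u = fword_seq v -> u = v.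
Proof. by case: u v => u pu [v pv] /= e; subst v; rewrite (bool_irrelevance pu pv). Qed.

Lemma fword_reduced (u : fword) : reduced u.
Proof. by case: u => u /= /andP[]. Qed.

Fact fone_subproof : fword_pred [::]. Proof. by []. Qed.
Definition fone := FWord fone_subproof.

Fact finv_subproof (u : fword) : fword_pred (winv u).
Proof.
case: u => u /= /andP[ru bu]; rewrite /fword_pred winv_reduced //=.
by rewrite /winv all_rev all_map.
Qed.
Definition finvw u := FWord (finv_subproof u).

Lemma push_bound l u : (l.1 < K)%N -> all (fun l => l.1 < K)%N u ->
  all (fun l => l.1 < K)%N (push l u).
Proof.
case: u => [|h t] lK //=; first by rewrite lK.
by case: eqP => _ /=; [case/andP | rewrite lK].
Qed.

Fact fmul_subproof (u v : fword) : fword_pred (wmul u v).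
Proof.
case: u v => u /= /andP[ru bu] [v /= /andP[rv bv]]; rewrite /fword_pred wmul_reduced //=.
by elim: u bu {ru} => //= l u IH /andP[lK /IH]; apply: push_bound.
Qed.
Definition fmulw u v := FWord (fmul_subproof u v).

Fact fmulA : associative fmulw.
Proof. by move=> u v w; apply/fword_inj/wmulA; apply: fword_reduced. Qed.
Fact fmul1 : left_id fone fmulw. Proof. by move=> u; apply: fword_inj. Qed.
Fact fmul1r : right_id fone fmulw.
Proof. by move=> u; apply/fword_inj/wmul1/fword_reduced. Qed.
Fact fmulV : left_inverse fone finvw fmulw.
Proof. by move=> u; apply/fword_inj/wmulV. Qed.
Fact fmulVr : right_inverse fone finvw fmulw.
Proof. by move=> u; apply/fword_inj/wmulVr. Qed.

Definition fword_group := group_of fmulA fmul1 fmul1r fmulV fmulVr.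

Fact letter_subproof (i : 'I_K) b : fword_pred [:: (val i, b)].
Proof. by rewrite /fword_pred /= ltn_ord. Qed.
Definition fletter (i : 'I_K) b : fword_group := FWord (letter_subproof i b).

Section Eval.
Local Open Scope group_scope.
Variables (H : groupType) (f : 'I_K -> H).

Definition eval_letter (l : nat * bool) : H :=
  if insub l.1 is Some i then if l.2 then f i else (f i)^-1 else 1.

Definition eval_word (u : seq (nat * bool)) : H :=
  foldr (fun l h => eval_letter l * h) 1 u.

Lemma eval_flip l : eval_letter l * eval_letter (flip_letter l) = 1.
Proof.
rewrite /eval_letter /=; case: insubP => [i _ _|_]; last by rewrite mulg1.
by case: l.2; rewrite /= ?mulgV ?mulVg.
Qed.

Lemma eval_push l u : eval_word (push l u) = eval_letter l * eval_word u.
Proof.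
case: u => [|h t] //=; case: eqP => [->|//].
by rewrite mulgA eval_flip mul1g.
Qed.

Lemma eval_wmul u v : eval_word (wmul u v) = eval_word u * eval_word v.
Proof. by elim: u => [|l u IH] /=; rewrite ?mul1g // eval_push IH mulgA. Qed.

Definition feval (u : fword_group) : H := eval_word (u : fword).

Fact fevalM : {morph feval : u v / u * v}.
Proof. by move=> u v; apply: eval_wmul. Qed.

Definition feval_mult : {multiplicative fword_group -> H} :=
  HB.pack feval (isMultiplicative.Build fword_group H feval fevalM).

End Eval.

Lemma feval_letter (H : groupType) (f : 'I_K -> H) i : feval f (fletter i true) = f i.
Proof.
rewrite /feval /= mulg1 /eval_letter /=.
by case: insubP => [j _ ij|]; [congr f; apply: val_inj | rewrite ltn_ord].
Qed.

Lemma multiplicativeP (G H : groupType) (f g : {multiplicative G -> H}) : f =1 g -> f = g.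
Proof.
case: f => f [[pf]]; case: g => g [[pg]] /= /funext e; subst g.
by rewrite (Prop_irrelevance pf pg).
Qed.

(** A reduced word is the product of its letters, so a morphism is determined by
    its values on them; conversely cancellation is respected by evaluation. *)
Lemma fletter_basis : is_basis (fun i => fletter i true).
Proof.
move=> H f; exists (feval_mult f); split; first exact: feval_letter.
move=> g gP; apply: multiplicativeP => -[u pu].
elim: u pu => [|l u IH] pu.
  have -> : FWord pu = 1%g :> fword_group by apply: fword_inj.
  by rewrite !mult1.
have pu' : fword_pred u.
  by move: pu => /andP[/path_sorted ru /andP[_ bu]]; rewrite /fword_pred /reduced ru.
have lK : (l.1 < K)%N by case/andP: pu => _ /andP[].
have -> : FWord pu = (fletter (Ordinal lK) l.2 * (FWord pu' : fword_group))%g.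
  apply: fword_inj; rewrite /= -surjective_pairing push_reduced_cons //.
  by case/andP: pu.
rewrite !gmulfM IH; congr (_ * _)%g.
have gen b : (fletter (Ordinal lK) b) =
    (if b then fletter (Ordinal lK) true else (fletter (Ordinal lK) true)^-1)%g.
  by case: b => //; apply: fword_inj.
have e i : feval_mult f (fletter i true) = f i by exact: feval_letter.
by rewrite gen; case: (l.2); rewrite ?multV e gP.
Qed.

(** The carrier is a type of reduced words in [Set], as the category asks for. *)
Definition FG : gr :=
  @FgFreeGroup fword fone finvw fmulw fmulA fmul1 fmul1r fmulV fmulVr
    (ex_intro _ K (ex_intro _ _ fletter_basis)).

Definition fgen (i : 'I_K) : fg_group FG := fletter i true.

Lemma fgen_basis : is_basis fgen.
Proof. exact: fletter_basis. Qed.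

Section Maps.
Variable X : gr.

Definition fhom (f : 'I_K -> fg_group X) : hom FG X :=
  @FgHom FG X (feval f) (fevalM f).

Lemma fhom_gen f i : fhom f (fgen i) = f i :> fg_group X.
Proof. exact: feval_letter. Qed.

Lemma fhomP (h h' : hom FG X) : (forall i, h (fgen i) = h' (fgen i)) -> h = h'.
Proof.
move=> hh; apply: fgHomP => x.
have [g [_ gP]] := fgen_basis (fun i => h (fgen i) : fg_group X).
have e : fg_morphism h = fg_morphism h' by rewrite -(gP (fg_morphism h)) // -(gP (fg_morphism h')).
by rewrite -[LHS]/(fg_morphism h x) e.
Qed.

End Maps.
End FreeGroup.

Section ZmodGroup.
Variable M : zmodType.

(** A module as a multiplicatively written group, so that basis properties of
    groups apply to maps into it. *)
Definition zgroup : groupType :=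
  @group_of M 0 -%R +%R (@addrA M) (@add0r M) (@addr0 M) (@addNr M) (@addrN M).

Lemma abel_lift_subproof (G : groupType) (f : {multiplicative G -> zgroup}) (x : G) :
  derived x -> f x = (0 : M).
Proof.
elim=> [|y z|y z _ dy _ dz|y _ dy]; first exact: mult1.
- rewrite /commg /conjg !gmulfM !multV.
  rewrite -[LHS]/(- (f y : M) + (- (f z : M) + ((f y : M) + (f z : M)))).
  by rewrite (addrC (f y : M)) addKr addNr.
- by rewrite gmulfM -[LHS]/((f y : M) + f z) dy dz addr0.
- by rewrite multV -[LHS]/(- (f y : M)) dy oppr0.
Qed.

Definition abel_lift_fun (G : groupType) (f : {multiplicative G -> zgroup})
  (u : abel G) : M := f (abel_repr u).

Lemma abel_lift_funE (G : groupType) (f : {multiplicative G -> zgroup}) x :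
  abel_lift_fun f (abel_pi x) = f x.
Proof.
have /abel_piP/(abel_lift_subproof f) := abel_reprK (abel_pi x).
rewrite gmulfM multV => e; apply/eqP; rewrite eq_sym -subr_eq0 addrC.
exact/eqP.
Qed.

Fact abel_lift_is_additive (G : groupType) (f : {multiplicative G -> zgroup}) :
  zmod_morphism (abel_lift_fun f).
Proof.
move=> u v; rewrite -[u]abel_reprK -[v]abel_reprK -[(- _)%R]abel_piV.
rewrite -[(_ + _)%R]abel_piM !abel_lift_funE gmulfM multV.
by [].
Qed.

Definition abel_lift (G : groupType) (f : {multiplicative G -> zgroup}) :
    {additive abel G -> M} :=
  HB.pack (abel_lift_fun f)
    (GRing.isZmodMorphism.Build _ _ (abel_lift_fun f) (abel_lift_is_additive f)).

End ZmodGroup.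

Section FreeAbelianization.
Variable K : nat.
Notation F := (FG K).

Definition abgen (i : 'I_K) : ab F := abel_pi (fgen i).

Definition coord (i : 'I_K) : {additive ab F -> int} :=
  abel_lift (feval_mult (fun j => ((j == i)%:R : int) : zgroup int)).

Lemma coord_pi i (x : fg_group F) : coord i (abel_pi x) =
  feval_mult (fun j => ((j == i)%:R : int) : zgroup int) x.
Proof. exact: abel_lift_funE. Qed.

Lemma coord_gen i j : coord i (abgen j) = (j == i)%:R.
Proof. by rewrite coord_pi; apply: (@feval_letter K (zgroup int)). Qed.

(** Additive maps out of [ab F] are group morphisms out of [F] into an abelian
    group, which are determined on a basis. *)
Lemma ab_free_additiveP (M : zmodType) (f g : {additive ab F -> M}) :
  (forall i, f (abgen i) = g (abgen i)) -> f =1 g.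
Proof.
move=> fg u; rewrite -[u]abel_reprK.
have mP (h : {additive ab F -> M}) :
    {morph (fun x => h (abel_pi x) : zgroup M) : x y / (x * y)%g}.
  by move=> x y; rewrite abel_piM; apply: raddfD.
pose m (h : {additive ab F -> M}) : {multiplicative fg_group F -> zgroup M} :=
  HB.pack (fun x : fg_group F => h (abel_pi x) : zgroup M)
    (isMultiplicative.Build (fg_group F) (zgroup M)
      (fun x : fg_group F => h (abel_pi x) : zgroup M) (mP h)).
have [k [_ kP]] := @fgen_basis K (zgroup M) (fun i => f (abgen i)).
have e : m f = m g by rewrite -(kP (m f)) // -(kP (m g)).
exact: (congr1 (fun q : {multiplicative _ -> _} => q (abel_repr u)) e).
Qed.

End FreeAbelianization.

(** * Free abelian groups of words *)

(** ** Identities in abelian groups *)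

Inductive zexpr := ZAtom of nat | ZZero | ZAdd of zexpr & zexpr | ZOpp of zexpr.

Section ZExpr.
Variable M : zmodType.

Fixpoint zeval (e : seq M) (x : zexpr) : M :=
  match x with
  | ZAtom i => nth 0 e i
  | ZZero => 0
  | ZAdd x y => zeval e x + zeval e y
  | ZOpp x => - zeval e x
  end.

Fixpoint zcoef (i : nat) (x : zexpr) : int :=
  match x with
  | ZAtom j => (j == i)%:Z
  | ZZero => 0
  | ZAdd x y => zcoef i x + zcoef i y
  | ZOpp x => - zcoef i x
  end.

Lemma zevalE e x : zeval e x = \sum_(i < size e) nth 0 e i *~ zcoef i x.
Proof.
elim: x => [j||x IHx y IHy|x IHx] /=.
- case: (ltnP j (size e)) => je.
    rewrite (bigD1 (Ordinal je)) //= eqxx mulr1z big1 => [|i /negPf ij].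
      by rewrite addr0.
    by rewrite eq_sym (_ : (i == j :> nat) = false) ?mulr0z.
  rewrite nth_default // big1 // => i _; case: eqP => [e0|_]; last exact: mulr0z.
  by have := ltn_ord i; rewrite -e0 ltnNge je.
- by rewrite big1 // => i _; rewrite mulr0z.
- by rewrite IHx IHy -big_split /=; apply: eq_bigr => i _; rewrite mulrzDr.
- by rewrite IHx -sumrN; apply: eq_bigr => i _; rewrite mulrNz.
Qed.

Lemma zeval_eq e x y :
  all (fun i => zcoef i x == zcoef i y) (iota 0 (size e)) -> zeval e x = zeval e y.
Proof.
move=> /allP xy; rewrite !zevalE; apply: eq_bigr => i _.
by rewrite (eqP (xy i _)) // mem_iota ltn_ord.
Qed.

End ZExpr.

Ltac zindex x e :=
  lazymatch e with
  | nil => fail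
  | cons ?y ?t =>
    match constr:(Set) with
    | _ => let _ := constr:(erefl x : x = y) in constr:(O)
    | _ => let n := zindex x t in constr:(S n)
    end
  end.

Ltac zatoms x e :=
  lazymatch x with
  | (?a + ?b)%R => let e1 := zatoms a e in zatoms b e1
  | (- ?a)%R => zatoms a e
  | 0%R => e
  | _ => match constr:(Set) with
         | _ => let n := zindex x e in e
         | _ => constr:(cons x e)
         end
  end.

Ltac zreify x e :=
  lazymatch x with
  | (?a + ?b)%R => let u := zreify a e in let v := zreify b e in constr:(ZAdd u v)
  | (- ?a)%R => let u := zreify a e in constr:(ZOpp u)
  | 0%R => constr:(ZZero)
  | _ => let n := zindex x e in constr:(ZAtom n)
  end.

(** Compares the integer coefficients of the atoms of the two sides. *)
Ltac zmodule :=
  lazymatch goal with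
  | |- @eq ?T ?x ?y =>
    let e0 := zatoms x (@nil T) in
    let e := zatoms y e0 in
    let u := zreify x e in
    let v := zreify y e in
    apply: (@zeval_eq _ e u v); vm_compute; reflexivity
  end.


(** ** Supports *)

Section Spans.

Lemma freeg_ind (K : choiceType) (P : {freeg K} -> Prop) :
  P 0 -> (forall x y, P x -> P y -> P (x - y)) -> (forall k, P << k >>) ->
  forall x, P x.
Proof.
move=> P0 PB PU x.
have PN y : P y -> P (- y) by move=> Py; rewrite -[- y]add0r; apply: PB.
have PD y z : P y -> P z -> P (y + z).
  by move=> Py Pz; rewrite -[z]opprK; apply/PB/PN.
have PM y n : P y -> P (y *+ n).
  by move=> Py; elim: n => [|n IH]; rewrite ?mulr0n // mulrS; apply: PD.
rewrite -(freeg_sumE x); elim/big_ind: _ => // k _.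
rewrite -(intz (coeff k x)) -freegU_mulz.
by case: (coeff k x) => n; [apply: PM | apply/PN/PM].
Qed.

Lemma eq_zlift (K : choiceType) (M : zmodType) (f g : K -> M) :
  f =1 g -> zlift f =1 zlift g.
Proof. by move=> fg; apply: (freeg_additiveP (f := zlift f) (g := zlift g)) => k; rewrite /= !zliftU. Qed.

Lemma zliftB (K : choiceType) (M : zmodType) (f g : K -> M) x :
  zlift (fun k => f k - g k) x = zlift f x - zlift g x.
Proof.
apply: (freeg_additiveP (f := zlift _) (g := zlift f \- zlift g)) => k.
by rewrite /= !zliftU.
Qed.

Lemma zlift0 (K : choiceType) (M : zmodType) x : zlift (fun _ : K => 0 : M) x = 0.
Proof.
apply: (freeg_additiveP (f := zlift _) (g := \0)) => k.
by rewrite /= zliftU.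
Qed.

Lemma zliftN (K : choiceType) (M : zmodType) (f : K -> M) x :
  zlift (fun k => - f k) x = - zlift f x.
Proof.
by rewrite -[RHS]add0r -(@zlift0 K M x) -zliftB; apply: eq_zlift => k; rewrite add0r.
Qed.

Lemma zliftD (K : choiceType) (M : zmodType) (f g : K -> M) x :
  zlift (fun k => f k + g k) x = zlift f x + zlift g x.
Proof.
by rewrite -[zlift g x]opprK -zliftN -zliftB; apply: eq_zlift => k; rewrite opprK.
Qed.

Lemma zliftMz (K : choiceType) (M : zmodType) (f : K -> M) (c : int) x :
  zlift (fun k => f k *~ c) x = zlift f x *~ c.
Proof.
elim/freeg_ind: x => [|x y xP yP|k]; rewrite ?raddf0 ?mul0rz ?zliftU //.
by rewrite !raddfB /= xP yP mulrzBl.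
Qed.

Lemma zlift_comp (K K' : choiceType) (M : zmodType) (f : K' -> M)
    (g : K -> {freeg K'}) x :
  zlift f (zlift g x) = zlift (fun k => zlift f (g k)) x.
Proof.
by apply: (freeg_additiveP (f := zlift f \o zlift g)) => k; rewrite /= !zliftU.
Qed.

Lemma zlift_fgmap (K K' : choiceType) (M : zmodType) (f : K' -> M) (g : K -> K') x :
  zlift f (fgmap g x) = zlift (fun k => f (g k)) x.
Proof. by rewrite zlift_comp; apply: eq_zlift => k; rewrite zliftU. Qed.

Lemma raddf_zlift (K : choiceType) (M N : zmodType) (h : {additive M -> N})
    (f : K -> M) x : h (zlift f x) = zlift (fun k => h (f k)) x.
Proof. by apply: (freeg_additiveP (f := h \o zlift f)) => k; rewrite /= !zliftU. Qed.

Lemma zlift_exchange (K K' : choiceType) (M : zmodType) (f : K -> K' -> M) x y :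
  zlift (fun k => zlift (f k) y) x = zlift (fun k' => zlift (f^~ k') x) y.
Proof.
elim/freeg_ind: x => [|x x' xP x'P|k].
- by rewrite raddf0 -[LHS](@zlift0 K' M y); apply: eq_zlift => k; rewrite raddf0.
- by rewrite raddfB /= xP x'P -zliftB; apply: eq_zlift => k; rewrite raddfB.
- by rewrite zliftU; apply: eq_zlift => k'; rewrite zliftU.
Qed.

Lemma zliftU_id (K : choiceType) (x : {freeg K}) : zlift (fun k => << k >>) x = x.
Proof. by apply: (freeg_additiveP (g := idfun)) => k; rewrite /= zliftU. Qed.

(** Supports are described by membership in a subgroup rather than by coefficients,
    so that they can be followed through maps that are defined on generators. *)
Definition spanned (K : choiceType) (P : K -> Prop) : {freeg K} -> Prop :=
  gen (fun z => exists2 k, P k & z = << k >>).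

Variable K : choiceType.
Implicit Types (P : K -> Prop) (x y : {freeg K}).

Lemma spanned0 P : spanned P 0. Proof. exact: gen0. Qed.

Lemma spannedU P k : P k -> spanned P << k >>.
Proof. by move=> Pk; apply: gen_in; exists k. Qed.

Lemma spannedB P x y : spanned P x -> spanned P y -> spanned P (x - y).
Proof. exact: genB. Qed.

Lemma spannedN P x : spanned P x -> spanned P (- x).
Proof. by rewrite -[- x]add0r; apply/spannedB/spanned0. Qed.

Lemma spannedD P x y : spanned P x -> spanned P y -> spanned P (x + y).
Proof. by move=> Px Py; rewrite -[y]opprK; apply/spannedB/spannedN. Qed.

Lemma spannedMz P x c : spanned P x -> spanned P (x *~ c).
Proof.
move=> Px; have PM n : spanned P (x *+ n).
  by elim: n => [|n IH]; [apply: spanned0 | rewrite mulrS; apply: spannedD].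
by case: c => n; [apply: PM | apply/spannedN/PM].
Qed.

Lemma spanned_sum P (I : finType) (F : I -> {freeg K}) :
  (forall i, spanned P (F i)) -> spanned P (\sum_i F i).
Proof.
by move=> FP; elim/big_ind: _ => //; [apply: spanned0 | apply: spannedD].
Qed.

Lemma spanned_ind P (Q : {freeg K} -> Prop) :
  Q 0 -> (forall x y, Q x -> Q y -> Q (x - y)) -> (forall k, P k -> Q << k >>) ->
  forall x, spanned P x -> Q x.
Proof. by move=> Q0 QB QU x; elim=> [//|y [k Pk ->]|y z _ Qy _]; auto. Qed.

End Spans.

Section SpanMaps.
Variable K : choiceType.
Implicit Types (P : K -> Prop) (x y : {freeg K}).

Lemma spanned_zlift (K' : choiceType) P (Q : K' -> Prop) (f : K -> {freeg K'}) x :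
  (forall k, P k -> spanned Q (f k)) -> spanned P x -> spanned Q (zlift f x).
Proof.
move=> PQ; apply: (@spanned_ind K P (fun x => spanned Q (zlift f x))) => [|y z Qy Qz|k Pk].
- by rewrite raddf0; apply: spanned0.
- by rewrite raddfB; apply: spannedB.
- by rewrite zliftU; apply: PQ.
Qed.

Lemma spanned_fgmap (K' : choiceType) P (Q : K' -> Prop) (f : K -> K') x :
  (forall k, P k -> Q (f k)) -> spanned P x -> spanned Q (fgmap f x).
Proof. by move=> PQ; apply: spanned_zlift => k Pk; apply/spannedU/PQ. Qed.

Lemma spanned_eq_zlift (M : zmodType) P (f g : K -> M) x :
  (forall k, P k -> f k = g k) -> spanned P x -> zlift f x = zlift g x.
Proof.
move=> fg; apply: (@spanned_ind K P (fun x => zlift f x = zlift g x)) => [|y z yP zP|k Pk].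
- by rewrite !raddf0.
- by rewrite !raddfB /= yP zP.
- by rewrite !zliftU fg.
Qed.

Lemma spanned_true x : spanned (fun _ => True) x.
Proof.
elim/freeg_ind: x => [|x y xP yP|k]; first exact: spanned0.
  exact: spannedB.
exact: spannedU.
Qed.

Lemma spannedS P (Q : K -> Prop) x :
  (forall k, P k -> Q k) -> spanned P x -> spanned Q x.
Proof.
move=> PQ; apply: spanned_ind => [|y z|k Pk]; first exact: spanned0.
  exact: spannedB.
exact/spannedU/PQ.
Qed.

End SpanMaps.

(** ** Crossed homomorphisms out of a free group *)

Section Crossed.
Local Open Scope group_scope.
Variables (G : groupType) (M : zmodType) (r : G -> {additive M -> M}).
Hypotheses (r1 : forall u, r 1 u = u) (rM : forall g h u, r (g * h) u = r h (r g u)).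

Definition semi_one : M * G := (0%R, 1).
Definition semi_mul (x y : M * G) : M * G := ((r y.2 x.1 + y.1)%R, x.2 * y.2).
Definition semi_inv (x : M * G) : M * G := ((- r x.2^-1 x.1)%R, x.2^-1).

Fact semi_mulA : associative semi_mul.
Proof.
move=> [u g] [v h] [w k]; rewrite /semi_mul /= mulgA; congr pair.
by rewrite rM raddfD /= addrA.
Qed.
Fact semi_mul1 : left_id semi_one semi_mul.
Proof. by move=> [u g]; rewrite /semi_mul /= raddf0 add0r mul1g. Qed.
Fact semi_mul1r : right_id semi_one semi_mul.
Proof. by move=> [u g]; rewrite /semi_mul /= r1 addr0 mulg1. Qed.
Fact semi_mulV : left_inverse semi_one semi_inv semi_mul.
Proof.
move=> [u g]; rewrite /semi_mul /= mulVg raddfN /= -rM mulVg r1.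
by rewrite [(- u + u)%R]addNr.
Qed.
Fact semi_mulVr : right_inverse semi_one semi_inv semi_mul.
Proof. by move=> [u g]; rewrite /semi_mul /= mulgV addrN. Qed.

Definition semi_group := group_of semi_mulA semi_mul1 semi_mul1r semi_mulV semi_mulVr.

Definition crossed (D : G -> M) : Prop :=
  forall g h, D (g * h) = (r h (D g) + D h)%R.

Variables (n : nat) (e : 'I_n -> G).
Hypothesis eP : is_basis e.

Fact crossed_multM (D : G -> M) (DP : crossed D) :
  {morph (fun g => (D g, g) : semi_group) : g h / g * h}.
Proof. by move=> g h; rewrite DP. Qed.

Definition crossed_mult (D : G -> M) (DP : crossed D) : {multiplicative G -> semi_group} :=
  HB.pack (fun g : G => (D g, g) : semi_group)
    (isMultiplicative.Build G semi_group (fun g : G => (D g, g) : semi_group)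
      (crossed_multM DP)).

Lemma crossed_unique D D' : crossed D -> crossed D' ->
  (forall i, D (e i) = D' (e i)) -> D =1 D'.
Proof.
move=> DP DP' ee g.
have [k [_ kP]] := eP (fun i => (D (e i), e i) : semi_group).
have e1 := kP (crossed_mult DP) (fun i => erefl).
have e2 : k = crossed_mult DP' by apply: kP => i; rewrite /= ee.
have : crossed_mult DP g = crossed_mult DP' g by rewrite -e1 -e2.
by case.
Qed.

(** A crossed homomorphism is a section of the semidirect product, and sections
    can be prescribed on a basis. *)
Lemma crossed_exists (c : 'I_n -> M) :
  exists D, crossed D /\ forall i, D (e i) = c i.
Proof.
have [k [ke _]] := eP (fun i => (c i, e i) : semi_group).
have sndM : {morph (fun g => (k g : M * G).2) : g h / g * h}.
  by move=> g h; rewrite gmulfM.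
pose s : {multiplicative G -> G} := HB.pack (fun g => (k g : M * G).2)
  (isMultiplicative.Build G G (fun g => (k g : M * G).2) sndM).
have [j [_ jP]] := eP e.
have s_id : s = idfun :> (G -> G).
  rewrite -(jP s) ?(jP (idfun : {multiplicative G -> G})) // => i.
  by rewrite /= ke.
exists (fun g => (k g : M * G).1); split=> [g h|i]; last by rewrite ke.
by rewrite gmulfM /=; congr (r _ _ + _)%R; apply: (congr1 (fun f => f h) s_id).
Qed.

End Crossed.

(** * The bar complex of a free group *)

Section Bar.
Variable G : groupType.
Implicit Types (g h : G) (s t : seq G) (v : {freeg (seq G)}).

Definition mulhead_word g s : {freeg (seq G)} :=
  if s is h :: t then << (g * h)%g :: t >> - << g :: t >> - << h :: t >> else 0.

Definition mulhead g := zlift (mulhead_word g).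
HB.instance Definition _ g := GRing.Additive.on (mulhead g).

Definition consw g := fgmap (cons g).
HB.instance Definition _ g := GRing.Additive.on (consw g).

(** The bar differential in the symbols [[g]] = [g] - 1 of the augmentation ideal,
    where the product of two symbols is [[gh]] - [[g]] - [[h]]; there are no
    terms at the two ends of the word. *)
Fixpoint bar s : {freeg (seq G)} :=
  if s is g :: t then mulhead_word g t - consw g (bar t) else 0.

Definition barl := zlift bar.
HB.instance Definition _ := GRing.Additive.on barl.

Lemma barl_cons g v : barl (consw g v) = mulhead g v - consw g (barl v).
Proof.
apply: (freeg_additiveP (f := barl \o consw g) (g := mulhead g \- (consw g \o barl))).
by move=> s; rewrite /= /consw fgmapU /barl /mulhead !zliftU.
Qed.

Lemma mulhead_cons g h v :
  mulhead g (consw h v) = consw (g * h)%g v - consw g v - consw h v.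
Proof.
apply: (freeg_additiveP (f := mulhead g \o consw h)
  (g := (consw (g * h)%g \- consw g) \- consw h)).
by move=> s; rewrite /= /consw !fgmapU /mulhead zliftU.
Qed.

Lemma mulheadU g s : mulhead g << s >> = mulhead_word g s.
Proof. exact: zliftU. Qed.

Lemma conswU g s : consw g << s >> = << g :: s >>.
Proof. exact: fgmapU. Qed.

Lemma mulheadM g h v : mulhead g (mulhead h v) =
  mulhead (g * h)%g v - mulhead g v - mulhead h v.
Proof.
apply: (freeg_additiveP (f := mulhead g \o mulhead h)
  (g := (mulhead (g * h)%g \- mulhead g) \- mulhead h)) => -[|k t].
  by rewrite /= !mulheadU /= raddf0 !subr0.
rewrite /= !mulheadU /= !raddfB /= !mulheadU /= !mulgA; zmodule.
Qed.

Lemma barl_mulhead g v : barl (mulhead g v) = mulhead g (barl v).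
Proof.
apply: (freeg_additiveP (f := barl \o mulhead g) (g := mulhead g \o barl)) => -[|h t].
  by rewrite /= mulheadU /barl zliftU /= !raddf0.
rewrite /= mulheadU /barl zliftU /= !raddfB /= !zliftU /=.
rewrite -!mulheadU mulhead_cons mulheadM; zmodule.
Qed.

Lemma barl_barl v : barl (barl v) = 0.
Proof.
apply: (freeg_additiveP (f := barl \o barl) (g := \0)) => s /=.
rewrite /barl zliftU -/barl; elim: s => [|g t IH] /=; first exact: raddf0.
rewrite -mulheadU raddfB /= barl_mulhead barl_cons {}IH raddf0 subr0.
by rewrite /barl zliftU subrr.
Qed.

Lemma bar_size s : spanned (fun t => (size t).+1 = size s) (bar s).
Proof.
elim: s => [|g t IH] /=; first exact: spanned0.
apply: spannedB; last first.
  by apply: spanned_fgmap IH => u /= <-.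
case: t {IH} => [|h t] /=; first exact: spanned0.
by do !apply: spannedB; apply: spannedU.
Qed.

(** The symbol of 1 is zero in the augmentation ideal, and the terms in which such a
    letter is multiplied with a neighbour cancel. *)
Lemma bar_one s : 1%g \in s -> spanned (fun t => 1%g \in t) (bar s).
Proof.
have one t : 1%g \in t -> spanned (fun t => 1%g \in t) (<< t >> : {freeg (seq G)}).
  by move=> t1; apply: spannedU.
elim: s => [//|g t IH]; rewrite inE => /orP[/eqP <-|t1] /=.
  apply: spannedB; last first.
    apply: (@spanned_fgmap _ _ (fun=> True)) => [u _|]; last exact: spanned_true.
    by rewrite inE eqxx.
  case: t {IH} => [|h t] /=; first exact: spanned0.
  rewrite mul1g; set u := << _ >>; set v := << 1%g :: t >>.
  have -> : u - v - u = - v by zmodule.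
  by apply/spannedN/one; rewrite inE eqxx.
apply: spannedB; last first.
  by apply: spanned_fgmap (IH t1) => u u1; rewrite inE u1 orbT.
case: t t1 {IH} => [|h t] //=; rewrite inE => /orP[/eqP <-|t1].
  rewrite mulg1; set u := << g :: t >>; set v := << 1%g :: t >>.
  have -> : u - u - v = - v by zmodule.
  by apply/spannedN/one; rewrite inE eqxx.
by do !apply: spannedB; apply: one; rewrite inE t1 orbT.
Qed.

End Bar.

Lemma bar_map (G H : groupType) (f : {multiplicative G -> H}) s :
  bar (map f s) = fgmap (map f) (bar s).
Proof.
elim: s => [|g t IH] /=; first by rewrite raddf0.
rewrite IH raddfB /=; congr (_ - _).
  case: t {IH} => [|h t] /=; first by rewrite raddf0.
  by rewrite !raddfB /= !fgmapU /= gmulfM.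
by rewrite /consw /fgmap !zlift_comp; apply: eq_zlift => u; rewrite !zliftU.
Qed.

(** ** Contraction by right Fox derivatives *)

Section Contraction.
Variables (G : groupType) (n : nat) (e : 'I_n -> G).
Hypothesis eP : is_basis e.
Implicit Types (g h : G) (s t : seq G) (z : {freeg (G * G)%type}).

Definition rmul h : {freeg (G * G)%type} -> {freeg (G * G)%type} :=
  fgmap (fun p => (p.1, (p.2 * h)%g)).
HB.instance Definition _ h := GRing.Additive.on (rmul h).

Definition rmul1 h : {freeg G} -> {freeg G} := fgmap (fun g => (g * h)%g).
HB.instance Definition _ h := GRing.Additive.on (rmul1 h).

Lemma fox_exists : exists D : G -> {freeg (G * G)%type},
  crossed rmul D /\ forall i, D (e i) = << (e i, 1%g) >>.
Proof.
apply: (crossed_exists (r := rmul)) => //.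
  move=> u; apply: (freeg_additiveP (f := rmul _) (g := idfun)) => -[x a].
  by rewrite /= /rmul fgmapU /= mulg1.
move=> g h u; apply: (freeg_additiveP (f := rmul _) (g := rmul _ \o rmul _)) => -[x a].
by rewrite /= /rmul !fgmapU /= mulgA.
Qed.

(** A pair [(x, a)] stands for the symbol of [x] times [a], so that the fundamental
    formula of Fox calculus writes [g - 1] as the sum of the pairs in [fox g]. *)
Definition fox : G -> {freeg (G * G)%type} := sval (cid fox_exists).

Lemma foxM g h : fox (g * h)%g = rmul h (fox g) + fox h.
Proof. by rewrite /fox; case: (cid _) => D /= [DP _]; apply: DP. Qed.

Lemma fox_gen i : fox (e i) = << (e i, 1%g) >>.
Proof. by rewrite /fox; case: (cid _) => D /= [_]. Qed.

Lemma fox1 : fox 1%g = 0.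
Proof.
have := foxM 1%g 1%g; rewrite mulg1.
have -> : rmul 1%g (fox 1%g) = fox 1%g.
  apply: (freeg_additiveP (f := rmul _) (g := idfun)) => -[x a].
  by rewrite /= /rmul fgmapU /= mulg1.
by move=> /eqP; rewrite -[X in X == _]addr0 (inj_eq (addrI _)) => /eqP <-.
Qed.

Definition fox_tele : {freeg (G * G)%type} -> {freeg G} :=
  zlift (fun p => << (p.1 * p.2)%g >> - << p.2 >>).
HB.instance Definition _ := GRing.Additive.on fox_tele.

(** Both sides are crossed homomorphisms for right multiplication, so it is enough
    to compare them on the basis. *)
Lemma fox_teleE g : fox_tele (fox g) = << g >> - << 1%g >>.
Proof.
apply: (@crossed_unique _ _ rmul1 _ _ _ e eP (fun g => fox_tele (fox g))
  (fun g => << g >> - << 1%g >>)) => //.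
- move=> u; apply: (freeg_additiveP (f := rmul1 _) (g := idfun)) => x.
  by rewrite /= /rmul1 fgmapU /= mulg1.
- move=> a b u; apply: (freeg_additiveP (f := rmul1 _) (g := rmul1 _ \o rmul1 _)) => x.
  by rewrite /= /rmul1 !fgmapU /= mulgA.
- move=> a b; rewrite foxM raddfD /=; congr (_ + _).
  apply: (freeg_additiveP (f := fox_tele \o rmul b) (g := rmul1 b \o fox_tele)).
  move=> [x c]; rewrite /= /rmul fgmapU /fox_tele !zliftU /= raddfB /=.
  by rewrite /rmul1 !fgmapU mulgA.
- move=> a b; rewrite raddfB /= /rmul1 !fgmapU mul1g; zmodule.
- by move=> i; rewrite fox_gen /fox_tele zliftU /= mulg1.
Qed.

Definition prefix_pairs t : {freeg (G * G)%type} -> {freeg (seq G)} :=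
  fgmap (fun p => [:: p.1, p.2 & t]).
HB.instance Definition _ t := GRing.Additive.on (prefix_pairs t).

Definition prefix_letter t : {freeg G} -> {freeg (seq G)} := fgmap (fun g => g :: t).
HB.instance Definition _ t := GRing.Additive.on (prefix_letter t).

(** The augmentation ideal of a free group is a free right module on the symbols of
    the basis. Writing the first letter in this basis, and putting the
    coefficients into a new letter, contracts the complex of words of length at
    least two. *)
Definition hbar s : {freeg (seq G)} :=
  if s is g :: t then prefix_pairs t (fox g) else 0.

Definition bproj s : {freeg (seq G)} :=
  if s is [:: g] then prefix_letter [::] (fgmap fst (fox g)) else 0.

Definition bdeg s : {freeg (seq G)} :=
  if s is g :: t then << 1%g :: t >> else << [::] >>.

Lemma barl_prefix_pairs t z : barl (prefix_pairs t z) =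
  prefix_letter t (fox_tele z) -
  (if t is h :: t' then prefix_pairs t' (rmul h z) - prefix_pairs t' z
   else prefix_letter [::] (fgmap fst z)) +
  zlift (fun u => prefix_pairs u z) (bar t).
Proof.
elim/freeg_ind: z => [|x y xP yP|[a b]].
- rewrite !raddf0 (@eq_zlift _ _ _ (fun=> 0)) ?zlift0; last by move=> u; rewrite raddf0.
  by case: t => [|h t]; rewrite ?raddf0; zmodule.
- have -> : barl (prefix_pairs t (x - y)) =
    barl (prefix_pairs t x) - barl (prefix_pairs t y) by rewrite !raddfB.
  rewrite xP yP.
  rewrite (@eq_zlift _ _ (fun u => prefix_pairs u (x - y))
    (fun u => prefix_pairs u x - prefix_pairs u y)); last by move=> u; rewrite raddfB.
  rewrite zliftB 2!raddfB /=.
  by case: t {xP yP} => [|h t]; rewrite !raddfB /=; zmodule.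
rewrite /prefix_pairs /fox_tele !fgmapU zliftU /= raddfB /= /prefix_letter.
rewrite (@eq_zlift _ _ _ (fun u => << [:: a, b & u] >>)); last by move=> u; rewrite fgmapU.
rewrite /barl zliftU /= raddfB /=.
have -> : consw a (consw b (bar t)) = zlift (fun u => << [:: a, b & u] >>) (bar t).
  by rewrite /consw /fgmap zlift_comp; apply: eq_zlift => u; rewrite zliftU.
rewrite !fgmapU; case: t => [|h t] /=; rewrite ?fgmapU /=.
  by rewrite [consw a 0]raddf0 raddf0; zmodule.
by rewrite !raddfB /= !conswU /rmul !fgmapU; zmodule.
Qed.

(** The homotopy is exact up to [bproj], which is concentrated on words of
    length one, and up to [bdeg], which vanishes after normalization. *)
Lemma hbar_homotopy s :
  barl (hbar s) + zlift hbar (bar s) = << s >> - bproj s - bdeg s.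
Proof.
case: s => [|g t] /=; first by rewrite !raddf0; zmodule.
rewrite barl_prefix_pairs fox_teleE raddfB /= /prefix_letter !fgmapU raddfB /=.
have -> : zlift hbar (consw g (bar t)) = zlift (fun u => prefix_pairs u (fox g)) (bar t).
  by rewrite zlift_fgmap.
case: t => [|h t] /=; first by rewrite !raddf0; zmodule.
rewrite !raddfB /= !zliftU /= foxM raddfD /=; zmodule.
Qed.

Lemma hbar_size s : spanned (fun t => size t = (size s).+1) (hbar s).
Proof.
case: s => [|g t]; first exact: spanned0.
by apply: (@spanned_fgmap _ _ (fun=> True)) => //; apply: spanned_true.
Qed.

Lemma hbar_one s : 1%g \in s -> spanned (fun t => 1%g \in t) (hbar s).
Proof.
case: s => [//|g t]; rewrite inE => /orP[/eqP <-|t1] /=.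
  by rewrite fox1 raddf0; apply: spanned0.
apply: (@spanned_fgmap _ _ (fun=> True)) => [u _|]; last exact: spanned_true.
by rewrite !inE t1 !orbT.
Qed.

Lemma bproj_size s : spanned (fun t => size t = 1) (bproj s).
Proof.
case: s => [|g [|h t]]; [exact: spanned0 | | exact: spanned0].
by apply: (@spanned_fgmap _ _ (fun=> True)) => //; apply: spanned_true.
Qed.

Lemma bdeg_bad s : spanned (fun t => (t == [::]) || (1%g \in t)) (bdeg s).
Proof. by case: s => [|g t]; apply: spannedU; rewrite //= inE eqxx. Qed.

End Contraction.

(** * Tuples of words *)

Section Slots.
Variables (m : nat) (G : groupType).
Notation tup := {ffun 'I_m -> seq G}.
Implicit Types (w : tup) (j l : 'I_m) (s t : seq G) (f g : seq G -> {freeg (seq G)}).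
Implicit Types x : {freeg tup}.

Definition setw w j s : tup := [ffun l => if l == j then s else w l].

Lemma setwE w j s : setw w j s j = s. Proof. by rewrite ffunE eqxx. Qed.

Lemma setw_neq w j s l : l != j -> setw w j s l = w l.
Proof. by rewrite ffunE => /negPf ->. Qed.

Lemma setw_id w j : setw w j (w j) = w.
Proof. by apply/ffunP => l; rewrite ffunE; case: eqP => [->|]. Qed.

Lemma setw_setw w j s t : setw (setw w j s) j t = setw w j t.
Proof. by apply/ffunP => l; rewrite !ffunE; case: eqP. Qed.

Lemma setwC w j l s t : j != l -> setw (setw w j s) l t = setw (setw w l t) j s.
Proof.
move=> jl; apply/ffunP => k; rewrite !ffunE; case: (eqVneq k l) => // ->.
by rewrite eq_sym (negPf jl).
Qed.

Definition pre w j : nat := (\sum_(l < m | l < j) size (w l))%N.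

Definition wsize w : nat := (\sum_l size (w l))%N.

Lemma pre_setw_le w j l s : (l <= j)%N -> pre (setw w j s) l = pre w l.
Proof.
move=> lj; apply: eq_bigr => k kl; rewrite setw_neq //.
by apply: contraTneq kl => ->; rewrite -leqNgt.
Qed.

Lemma pre_setw_lt w j l s : (j < l)%N ->
  (pre (setw w j s) l + size (w j) = pre w l + size s)%N.
Proof.
move=> jl; rewrite /pre (bigD1 j) //= (bigD1 (P := fun k : 'I_m => (k < l)%N) j) //=.
rewrite setwE addnC (addnC (size s)) addnA; congr (_ + _ + _)%N.
by apply: eq_bigr => k /andP[_ kj]; rewrite setw_neq.
Qed.

Lemma wsize_setw w j s : (wsize (setw w j s) + size (w j) = wsize w + size s)%N.
Proof.
rewrite /wsize (bigD1 j) //= [in RHS](bigD1 j) //=.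
rewrite setwE addnC (addnC (size s)) addnA; congr (_ + _ + _)%N.
by apply: eq_bigr => k kj; rewrite setw_neq.
Qed.

Definition sgn_pre w j : int := (-1) ^+ pre w j.

Lemma sgn_pre2 w j : sgn_pre w j * sgn_pre w j = 1.
Proof. by rewrite -expr2 sqrr_sign. Qed.

Definition slot j f := zlift (fun w => fgmap (setw w j) (f (w j))).
HB.instance Definition _ j f := GRing.Additive.on (slot j f).

(** Slots of different indices commute; weighting by the parity of the letters
    to the left makes odd operators anticommute instead. *)
Definition sslot j f := zlift (fun w => fgmap (setw w j) (f (w j)) *~ sgn_pre w j).
HB.instance Definition _ j f := GRing.Additive.on (sslot j f).

Definition odd_op f := forall s, spanned (fun t => odd (size t) = ~~ odd (size s)) (f s).

Lemma slotU j f w : slot j f << w >> = fgmap (setw w j) (f (w j)).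
Proof. exact: zliftU. Qed.

Lemma sslotU j f w : sslot j f << w >> = fgmap (setw w j) (f (w j)) *~ sgn_pre w j.
Proof. exact: zliftU. Qed.

Lemma sslot_same j f g x :
  sslot j f (sslot j g x) = slot j (fun s => zlift f (g s)) x.
Proof.
apply: (freeg_additiveP (f := sslot j f \o sslot j g) (g := slot j _)) => w.
rewrite /= slotU sslotU raddfMz /= /sslot !zlift_fgmap.
rewrite (@eq_zlift _ _ _ (fun s => fgmap (setw w j) (f s) *~ sgn_pre w j)); last first.
  move=> s; rewrite /sgn_pre setwE pre_setw_le //; congr (_ *~ _).
  by rewrite /fgmap; apply: eq_zlift => t; rewrite setw_setw.
by rewrite zliftMz -mulrzA sgn_pre2 mulr1z raddf_zlift.
Qed.

Lemma sslot_lt j l f g x : (j < l)%N -> odd_op g ->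
  sslot l f (sslot j g x) = - sslot j g (sslot l f x).
Proof.
move=> jl godd; have jl' : j != l by apply: contraTneq jl => ->; rewrite ltnn.
apply: (freeg_additiveP (f := sslot l f \o sslot j g) (g := \- (sslot j g \o sslot l f))).
move=> w; rewrite /= !sslotU !raddfMz /= /sslot !zlift_fgmap.
rewrite (@spanned_eq_zlift _ _ _ _
  (fun s => zlift (fun t => << setw (setw w j s) l t >>) (f (w l)) *~ - sgn_pre w l)
  _ _ (godd (w j))); last first.
  move=> s sodd; rewrite setw_neq 1?eq_sym //; congr (_ *~ _).
  have := congr1 odd (pre_setw_lt w s jl); rewrite !oddD sodd => e.
  rewrite /sgn_pre -signr_odd -[in RHS]signr_odd -signrN; congr (_ ^+ nat_of_bool _).
  by move: e; do 3!case: odd.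
rewrite zliftMz mulrNz !mulNrz; congr (- _); rewrite -!mulrzA mulrC mulrzA.
congr (_ *~ _).
have sw t : sgn_pre (setw w l t) j = sgn_pre w j.
  by rewrite /sgn_pre pre_setw_le // ltnW.
rewrite (@eq_zlift _ _ (fun t => _ *~ _) (fun t =>
   zlift (fun s => << setw (setw w j s) l t >>) (g (w j)) *~ sgn_pre w j)); last first.
  move=> t; rewrite sw.
  have -> : setw w l t j = w j by apply: setw_neq.
  have -> : fgmap (setw (setw w l t) j) (g (w j)) =
      zlift (fun s => << setw (setw w j s) l t >>) (g (w j)).
    by rewrite /fgmap; apply: eq_zlift => s; rewrite (setwC _ _ _ jl').
  by [].
by rewrite zliftMz zlift_exchange.
Qed.

Lemma sslot_neq j l f g x : j != l -> odd_op f -> odd_op g ->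
  sslot l f (sslot j g x) = - sslot j g (sslot l f x).
Proof.
move=> jl fodd godd; case: (ltngtP j l) => jl'; first exact: sslot_lt.
  by rewrite (sslot_lt _ _ jl' fodd) opprK.
by rewrite (val_inj jl') eqxx in jl.
Qed.

Lemma spanned_sslot j f w (P : seq G -> Prop) (Q : tup -> Prop) :
  spanned P (f (w j)) -> (forall s, P s -> Q (setw w j s)) ->
  spanned Q (sslot j f << w >>).
Proof. by move=> Pf PQ; rewrite sslotU; apply/spannedMz/(spanned_fgmap PQ). Qed.

Lemma spanned_slot j f w (P : seq G -> Prop) (Q : tup -> Prop) :
  spanned P (f (w j)) -> (forall s, P s -> Q (setw w j s)) ->
  spanned Q (slot j f << w >>).
Proof. by move=> Pf PQ; rewrite slotU; apply: spanned_fgmap PQ Pf. Qed.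

Lemma odd_bar : odd_op (@bar G).
Proof. by move=> s; apply: spannedS (bar_size s) => t /= <-; rewrite /= negbK. Qed.

Definition dtot x := \sum_j sslot j (@bar G) x.

Fact dtot_is_additive : zmod_morphism dtot.
Proof. by move=> x y; rewrite /dtot -sumrB; apply: eq_bigr => j _; rewrite raddfB. Qed.
HB.instance Definition _ := GRing.isZmodMorphism.Build _ _ dtot dtot_is_additive.

Lemma slot0 j x : slot j (fun=> 0) x = 0.
Proof.
apply: (freeg_additiveP (f := slot j _) (g := \0)) => w.
by rewrite /= slotU raddf0.
Qed.

Lemma eq_slot j f g x : f =1 g -> slot j f x = slot j g x.
Proof. by move=> fg; apply: eq_zlift => w; rewrite fg. Qed.

Lemma slotD j f g x : slot j (fun s => f s + g s) x = slot j f x + slot j g x.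
Proof. by rewrite -zliftD; apply: eq_zlift => w; rewrite raddfD. Qed.

Lemma slotB j f g x : slot j (fun s => f s - g s) x = slot j f x - slot j g x.
Proof. by rewrite -zliftB; apply: eq_zlift => w; rewrite raddfB. Qed.

Lemma slot_id j x : slot j (fun s => << s >>) x = x.
Proof.
rewrite -[RHS]zliftU_id; apply: eq_zlift => w.
by rewrite fgmapU setw_id.
Qed.

(** Off the diagonal everything anticommutes, so that only the one-word
    identities remain. *)
Lemma dtot_sslot j h x : odd_op h ->
  dtot (sslot j h x) + sslot j h (dtot x) =
  slot j (fun s => barl (h s) + zlift h (bar s)) x.
Proof.
move=> hodd; rewrite /dtot raddf_sum /= -big_split /= (bigD1 j) //= big1.
  by rewrite addr0 !sslot_same -slotD.
move=> l lj; rewrite sslot_neq 1?eq_sym //; last exact: odd_bar.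
by rewrite addNr.
Qed.

Lemma dtot_dtot x : dtot (dtot x) = 0.
Proof.
have e : dtot (dtot x) + dtot (dtot x) = 0.
  have e1 : dtot (dtot x) = \sum_j dtot (sslot j (@bar G) x) by rewrite -raddf_sum.
  have e2 : dtot (dtot x) = \sum_j sslot j (@bar G) (dtot x) by [].
  rewrite {1}e1 e2 -big_split /= big1 // => j _.
  rewrite dtot_sslot; last exact: odd_bar.
  rewrite (@eq_slot j _ (fun=> 0)) ?slot0 // => s.
  have b0 : bar s = barl << s >> by rewrite /barl zliftU.
  have b : barl (bar s) = 0 by rewrite b0 barl_barl.
  by rewrite b; apply: etrans (add0r _) b.
apply/eqP/freeg_eqP => k; rewrite coeff0.
have := congr1 (coeff k) e; rewrite coeffD coeff0 => /eqP.
by rewrite -mulr2n Num.Theory.mulrn_eq0 => /eqP.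
Qed.

End Slots.

(** * The normalized multiple bar complex as a complex of functors *)

Section Normalized.
Variables (m : nat) (G : groupType).
Notation tup := {ffun 'I_m -> seq G}.
Implicit Types (w : tup) (z : {freeg tup}).

Definition good N w := (wsize w == N) && [forall j, (w j != [::]) && (1%g \notin w j)].

Definition badrel N z := exists2 w, ~~ good N w & z = << w >>.

Definition barob N := zquot (badrel N).

Definition sym N w : barob N := zpi (badrel N) << w >>.

Lemma sym_bad N w : ~~ good N w -> sym N w = 0.
Proof. by move=> bw; apply/zpi_eq0/gen_in; exists w. Qed.

Lemma zpi_bad N z : spanned (fun w => ~~ good N w) z -> zpi (badrel N) z = 0.
Proof. by move=> bz; apply/zpi_eq0. Qed.

Lemma zpi_eq_bad N z : zpi (badrel N) z = 0 -> spanned (fun w => ~~ good N w) z.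
Proof. by move/zpi_eq0. Qed.

Lemma not_goodP N w : ~~ good N w -> wsize w <> N \/ exists l, w l = [::] \/ 1%g \in w l.
Proof.
rewrite negb_and => /orP[/eqP|]; first by left.
rewrite negb_forall => /existsP[l]; rewrite negb_and !negbK => /orP bl.
by right; exists l; case: bl => [/eqP|]; [left | right].
Qed.

Lemma bad_size N w : wsize w <> N -> ~~ good N w.
Proof. by move/eqP/negPf => e; rewrite /good e. Qed.

Lemma bad_word N w l : w l = [::] \/ 1%g \in w l -> ~~ good N w.
Proof.
move=> bl; rewrite negb_and negb_forall; apply/orP; right; apply/existsP; exists l.
by case: bl => [->|->] //; rewrite andbF.
Qed.

(** An operator on words that changes lengths by a constant, kills the empty
    word and preserves the presence of the letter 1 is compatible with the
    normalization. *)
Lemma bad_sslot N N' j (f : seq G -> {freeg (seq G)}) w :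
  (forall s : seq G, spanned (fun t : seq G => (size t + N' = size s + N)%N) (f s)) ->
  f [::] = 0 -> (forall s : seq G, 1%g \in s -> spanned (fun t : seq G => 1%g \in t) (f s)) ->
  ~~ good N' w -> spanned (fun w => ~~ good N w) (sslot j f << w >>).
Proof.
move=> fsize f0 f1 /not_goodP[bw|[l bl]].
  apply: spanned_sslot (fsize _) _ => s es; apply: bad_size => en; apply: bw.
  apply/eqP; rewrite -(eqn_add2r (size s)) -(wsize_setw w j) en.
  by rewrite [X in _ == X]addnC es addnC.
case: (eqVneq l j) bl => [->|lj] bl.
  case: bl => [e|o]; first by rewrite sslotU e f0 raddf0 mul0rz; apply: spanned0.
  apply: spanned_sslot (f1 _ o) _ => s s1; apply: (@bad_word _ _ j).
  by right; rewrite setwE.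
apply: (@spanned_sslot _ _ _ _ _ (fun=> True)); first exact: spanned_true.
by move=> s _; apply: (@bad_word _ _ l); rewrite setw_neq.
Qed.

Lemma bad_dtot N w : ~~ good N.+1 w -> spanned (fun w => ~~ good N w) (dtot << w >>).
Proof.
move=> bw; rewrite /dtot; apply: spanned_sum => j.
apply: (@bad_sslot N N.+1) bw => // [s|s].
  by apply: spannedS (bar_size s) => t <-; rewrite addnS addSn.
exact: bar_one.
Qed.

Fact bardiff_subproof N z : badrel N.+1 z -> (zpi (badrel N) \o @dtot m G) z = 0.
Proof. by move=> [w bw ->]; apply/zpi_bad/bad_dtot. Qed.

Definition bardiff N : {additive barob N.+1 -> barob N} :=
  zquot_lift (@bardiff_subproof N).

Lemma bardiffE N z : bardiff N (zpi _ z) = zpi _ (dtot z).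
Proof. exact: zquot_liftE. Qed.

Lemma bardiff_bardiff N y : bardiff N (bardiff N.+1 y) = 0.
Proof. by rewrite -[y]zreprK !bardiffE dtot_dtot raddf0. Qed.

Section Exactness.
Variables (n : nat) (e : 'I_n -> G).
Hypothesis eP : is_basis e.
Local Notation hb := (hbar eP).

Lemma odd_hbar : odd_op hb.
Proof. by move=> s; apply: spannedS (hbar_size eP s) => t ->. Qed.

Lemma bad_hbar N j z : spanned (fun w => ~~ good N w) z ->
  spanned (fun w => ~~ good N.+1 w) (sslot j hb z).
Proof.
elim/spanned_ind => [|x y bx by'|w bw].
- by rewrite raddf0; apply: spanned0.
- by rewrite raddfB; apply: spannedB.
apply: (@bad_sslot N.+1 N) bw => // [s|s]; last exact: hbar_one.
by apply: spannedS (hbar_size eP s) => t ->; rewrite addSn addnS.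
Qed.

(** In the slot [j] the contraction replaces a cycle by a homologous one whose
    [j]-th word has length one. *)
Lemma contract_slot N j z : zpi (badrel N) (dtot z) = 0 ->
  zpi (badrel N.+1) z =
  bardiff N.+1 (zpi _ (sslot j hb z)) + zpi _ (slot j (bproj eP) z).
Proof.
move=> dz; rewrite bardiffE -raddfD; apply/eqP; rewrite -subr_eq0 -raddfB.
apply/eqP/zpi_bad.
have ez := dtot_sslot j z odd_hbar.
rewrite (eq_slot _ _ (hbar_homotopy eP)) !slotB slot_id in ez.
have -> : z - (dtot (sslot j hb z) + slot j (bproj eP) z) =
    sslot j hb (dtot z) + slot j (@bdeg G) z.
  by rewrite -[dtot _](addrK (sslot j hb (dtot z))) ez; zmodule.
apply: spannedD; first exact/bad_hbar/zpi_eq_bad.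
have := spanned_true z; elim/spanned_ind => [|x y bx by'|w _].
- by rewrite raddf0; apply: spanned0.
- by rewrite raddfB; apply: spannedB.
apply: spanned_slot (bdeg_bad _) _ => s bs; apply: (@bad_word _ _ j).
by rewrite setwE; case/orP: bs => [/eqP|]; [left | right].
Qed.

(** Contracting the slots one after the other, every cycle is homologous to one in
    which all the words have length one; there is none unless the degree is [m]. *)
Lemma bardiff_exact N y : N.+1 != m -> bardiff N y = 0 -> exists x, bardiff N.+1 x = y.
Proof.
move=> Nm dy.
(* The cycle [y] is homologous to the class of [z], whose first [k] words have
   length one. *)
have claim k : (k <= m)%N -> exists x z, [/\ y = bardiff N.+1 x + zpi _ z,
    zpi (badrel N) (dtot z) = 0 &
    spanned (fun w => forall j : 'I_m, (j < k)%N -> size (w j) = 1) z].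
  elim: k => [_|k IH km].
    exists 0, (zrepr y); rewrite raddf0 add0r zreprK; split=> //.
    by apply: spannedS (spanned_true _).
  have [x [z [yE dz zk]]] := IH (ltnW km).
  exists (x + zpi _ (sslot (Ordinal km) hb z)), (slot (Ordinal km) (bproj eP) z).
  have zE := contract_slot (Ordinal km) dz; split.
  - by rewrite raddfD yE zE addrA.
  - rewrite -(bardiffE N (slot (Ordinal km) (bproj eP) z)).
    have -> : zpi (badrel N.+1) (slot (Ordinal km) (bproj eP) z) =
        zpi _ z - bardiff N.+1 (zpi _ (sslot (Ordinal km) hb z)).
      by rewrite zE addrC addKr.
    by rewrite raddfB bardiff_bardiff subr0 bardiffE dz.
  - move: zk; elim/spanned_ind => [|u v bu bv|w wk].
    + by rewrite raddf0; apply: spanned0.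
    + by rewrite raddfB; apply: spannedB.
    apply: spanned_slot (bproj_size eP _) _ => s s1 j.
    rewrite ltnS leq_eqVlt => /orP[/eqP jk|jk].
      by rewrite (_ : j = Ordinal km) ?setwE //; apply: val_inj.
    by rewrite setw_neq ?wk // -val_eqE /= neq_ltn jk.
have [x [z [-> dz zk]]] := claim m (leqnn m).
exists x; rewrite [X in _ + X]zpi_bad ?addr0 //.
apply: spannedS zk => w w1; apply: bad_size; apply/eqP.
rewrite /wsize (eq_bigr (fun=> 1%N)); last by move=> j _; apply: w1.
by rewrite sum1_card card_ord eq_sym.
Qed.

End Exactness.

(** ** Augmentation *)

Lemma good_size1 w : good m w -> forall j, size (w j) = 1.
Proof.
case/andP => /eqP wm /forallP wg j.
have w0 l : (0 < size (w l))%N by case/andP: (wg l); case: (w l).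
have : \sum_l (size (w l)).-1 == 0%N.
  rewrite -(eqn_add2l m) addn0 -[X in (X + _)%N == _](card_ord m) -sum1_card.
  rewrite -big_split /= -[X in _ == X]wm; apply/eqP; apply: eq_bigr => l _.
  by rewrite add1n prednK.
rewrite sum_nat_eq0 => /forallP/(_ j)/eqP.
by move: (w0 j); case: (size _) => [|[]].
Qed.

(** In lowest degree all the words have one letter, and a letter goes to its class in
    the abelianization. *)
Definition aug_word w : tensor m (abel G) :=
  if [forall j, size (w j) == 1%N] then pure [ffun j => abel_pi (head 1%g (w j))] else 0.

End Normalized.

Lemma pureD n (A : zmodType) (x : {ffun 'I_n -> A}) i a b :
  pure (upd x i (a + b)) = pure (upd x i a) + pure (upd x i b).
Proof.
apply/eqP; rewrite -subr_eq0 opprD addrA -!raddfB; apply/eqP/zpi_eq0/gen_in.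
by exists x, i, a, b.
Qed.

Lemma upd_id n (A : zmodType) (x : {ffun 'I_n -> A}) i : upd x i (x i) = x.
Proof. by apply/ffunP => j; rewrite ffunE; case: eqP => [->|]. Qed.

Lemma pure0 n (A : zmodType) (x : {ffun 'I_n -> A}) i : x i = 0 -> pure x = 0.
Proof.
move=> xi; have := pureD x i 0 0; rewrite addr0 -xi upd_id => /eqP.
by rewrite -[X in X == _]addr0 (inj_eq (addrI _)) => /eqP <-.
Qed.

Section Augmentation.
Variables (m : nat) (G : groupType).
Notation tup := {ffun 'I_m -> seq G}.
Implicit Types (w : tup) (u : {ffun 'I_m -> G}).

Lemma aug_word_bad w : ~~ good m w -> aug_word w = 0.
Proof.
rewrite /aug_word; case: forallP => // w1 /not_goodP[bw|[l]].
  case: bw; rewrite /wsize (eq_bigr (fun=> 1%N)); last by move=> j _; apply/eqP/w1.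
  by rewrite sum1_card card_ord.
have := w1 l; case wl: (w l) => [|g [|]] // _ [//|].
by rewrite inE => /eqP g1; apply: (@pure0 _ _ _ l); rewrite ffunE wl /= -g1.
Qed.

Fact aug_subproof (z : {freeg tup}) : badrel m z -> zlift (@aug_word m G) z = 0.
Proof. by move=> [w bw ->]; rewrite zliftU aug_word_bad. Qed.

Definition baraug : {additive barob m G m -> tensor m (abel G)} :=
  zquot_lift aug_subproof.

Lemma baraugE z : baraug (zpi _ z) = zlift (@aug_word m G) z.
Proof. exact: zquot_liftE. Qed.

Definition single u : tup := [ffun j => [:: u j]].

Definition setu u j g : {ffun 'I_m -> G} := [ffun l => if l == j then g else u l].

Lemma setw_single u j g : setw (single u) j [:: g] = single (setu u j g).
Proof. by apply/ffunP => l; rewrite !ffunE; case: eqP. Qed.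

Lemma aug_word_single u : aug_word (single u) = pure [ffun j => abel_pi (u j)].
Proof.
rewrite /aug_word; have -> : [forall j, size (single u j) == 1%N].
  by apply/forallP => j; rewrite ffunE.
by congr pure; apply/ffunP => j; rewrite !ffunE.
Qed.

Lemma single_head w : (forall j, size (w j) = 1) -> w = single [ffun j => head 1%g (w j)].
Proof.
move=> w1; apply/ffunP => j; rewrite !ffunE.
by have := w1 j; case: (w j) => [|g []].
Qed.

Lemma aug_word_setuM u j g h : aug_word (single (setu u j (g * h)%g)) =
  aug_word (single (setu u j g)) + aug_word (single (setu u j h)).
Proof.
rewrite !aug_word_single.
have su k : [ffun l => abel_pi (setu u j k l)] = upd [ffun l => abel_pi (u l)] j (abel_pi k).
  by apply/ffunP => l; rewrite !ffunE; case: eqP.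
by rewrite !su abel_piM pureD.
Qed.

Lemma baraug_bardiff y : baraug (bardiff m G m y) = 0.
Proof.
rewrite -[y]zreprK bardiffE baraugE; move: (zrepr y) => z.
apply: (freeg_additiveP (f := zlift (@aug_word m G) \o @dtot m G) (g := \0)) => w.
rewrite /= /dtot raddf_sum big1 // => j _; rewrite sslotU raddfMz /= zlift_fgmap.
have [w1|] := boolP [forall l, (l != j) ==> (size (w l) == 1%N)]; last first.
  rewrite negb_forall => /existsP[l]; rewrite negb_imply => /andP[lj l1].
  rewrite (@eq_zlift _ _ _ (fun=> 0)) ?zlift0 ?mul0rz // => s.
  rewrite /aug_word ifN // negb_forall; apply/existsP; exists l.
  by rewrite setw_neq.
pose u := [ffun l => head 1%g (w l)].
have ws g : setw w j [:: g] = single (setu u j g).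
  apply/ffunP => l; rewrite !ffunE; case: eqP => // /eqP lj.
  by have := forallP w1 l; rewrite lj /=; case: (w l) => [|? []].
rewrite [X in X *~ _](_ : _ = 0) ?mul0rz //.
have := bar_size (w j); case: (w j) => [|g [|h [|k t]]] bs.
- exact: raddf0.
- by rewrite /= [consw _ _]raddf0 subr0 raddf0.
- rewrite /= [consw h _]raddf0 subr0 [consw g _]raddf0 subr0 !raddfB /= !zliftU.
  by rewrite !ws aug_word_setuM; zmodule.
rewrite (@spanned_eq_zlift _ _ _ _ (fun=> 0) _ _ bs) ?zlift0 // => s ss.
rewrite /aug_word ifN // negb_forall; apply/existsP; exists j; rewrite setwE.
by move: ss; case: (size s) => [|[]].
Qed.

Lemma aug_exists (t : tensor m (abel G)) : exists y, baraug y = t.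
Proof.
rewrite -[t]zreprK; move: (zrepr t) => z.
exists (zpi _ (fgmap (fun x : {ffun 'I_m -> abel G} => single [ffun j => abel_repr (x j)]) z)).
rewrite baraugE zlift_fgmap.
apply: (freeg_additiveP (f := zlift _) (g := zpi _)) => x.
rewrite /= zliftU aug_word_single; congr pure.
by apply/ffunP => j; rewrite !ffunE abel_reprK.
Qed.

Lemma eq_by_slots (T M : Type) (R : T -> T -> Prop) (f : {ffun 'I_m -> T} -> M)
    (u v : {ffun 'I_m -> T}) :
  (forall (u : {ffun 'I_m -> T}) j g, R (u j) g ->
     f [ffun l => if l == j then g else u l] = f u) ->
  (forall j, R (u j) (v j)) -> f u = f v.
Proof.
move=> fR uv.
have claim (s : seq 'I_m) : f [ffun l => if l \in s then v l else u l] = f u.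
  elim: s => [|j s IH]; first by congr f; apply/ffunP => l; rewrite ffunE.
  rewrite -IH; case: (boolP (j \in s)) => js.
    by congr f; apply/ffunP => l; rewrite !ffunE inE; case: eqP => // ->; rewrite js.
  rewrite -[RHS](fR _ j (v j)); last by rewrite ffunE (negPf js).
  by congr f; apply/ffunP => l; rewrite !ffunE inE; case: eqP => // ->.
rewrite -(claim (enum 'I_m)); congr f.
by apply/ffunP => l; rewrite ffunE mem_enum.
Qed.

(** Modulo boundaries the tuples of letters are multiplicative in each slot, because
    of the boundary of a word of length two. Hence they factor through the
    abelianization, and this inverts the augmentation. *)
Lemma baraug_exact y : baraug y = 0 -> exists x, bardiff m G m x = y.
Proof.
pose im (z : barob m G m) := exists x, z = bardiff m G m x.
have gen_im z : gen im z -> im z.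
  elim=> [|//|a b _ [x ->] _ [x' ->]]; first by exists 0; rewrite raddf0.
  by exists (x - x'); rewrite raddfB.
pose C u := zpi im (sym m (single u)).
have CM u j g h : C (setu u j (g * h)%g) = C (setu u j g) + C (setu u j h).
  apply/eqP; rewrite -subr_eq0 opprD addrA -!raddfB; apply/eqP/zpi_eq0/gen_in.
  exists (zpi _ (<< setw (single u) j [:: g; h] >> *~ sgn_pre (single u) j)).
  rewrite bardiffE raddfMz /= /dtot (bigD1 j) //= big1 => [|l lj]; last first.
    rewrite sslotU setw_neq // ffunE /= [consw _ _]raddf0 subr0 raddf0 mul0rz.
    by [].
  rewrite sslotU setwE addr0 /sgn_pre pre_setw_le // -mulrzA sgn_pre2 mulr1z.
  rewrite /= [consw h _]raddf0 subr0 [consw g _]raddf0 subr0 !raddfB /= !fgmapU.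
  by rewrite !setw_setw !setw_single.
have Cab u j g g' : abel_pi g = abel_pi g' -> C (setu u j g) = C (setu u j g').
  pose f : {multiplicative G -> zgroup (zquot im)} :=
    HB.pack (fun g => C (setu u j g) : zgroup (zquot im))
      (isMultiplicative.Build G (zgroup (zquot im))
        (fun g => C (setu u j g) : zgroup (zquot im)) (CM u j)).
  by move=> gg; rewrite -[LHS](abel_lift_funE f) -[RHS](abel_lift_funE f) gg.
have Call u (v : {ffun 'I_m -> G}) : (forall j, abel_pi (u j) = abel_pi (v j)) -> C u = C v.
  move=> uv; apply: (eq_by_slots (R := fun g h => abel_pi g = abel_pi h)) uv => {}u j g ug.
  rewrite -[LHS]/(C (setu u j g)) (Cab u j g (u j)) //; congr C.
  by apply/ffunP => l; rewrite ffunE; case: eqP => [->|].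
pose reps (x : {ffun 'I_m -> abel G}) := [ffun j => abel_repr (x j)].
have kS z : multilinear_rel z -> zlift (fun x => C (reps x)) z = 0.
  move=> [x [i [a [b ->]]]]; rewrite !raddfB /= !zliftU.
  have re c : reps (upd x i c) = setu (reps x) i (abel_repr c).
    by apply/ffunP => l; rewrite !ffunE; case: eqP.
  rewrite !re (Cab _ _ _ (abel_repr a * abel_repr b)%g); first by rewrite CM; zmodule.
  by rewrite abel_piM !abel_reprK.
pose kappa := zquot_lift kS.
have kE : forall y, kappa (baraug y) = zpi im y.
  apply: (zquotP (f := kappa \o baraug)).
  apply: (freeg_additiveP (f := (kappa \o baraug) \o zpi _) (g := zpi im \o zpi _)) => w.
  rewrite -[LHS]/(kappa (baraug (zpi (badrel m) << w >>))) baraugE zliftU.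
  rewrite -[RHS]/(zpi im (sym m w)); have [gw|bw] := boolP (good m w); last first.
    by rewrite aug_word_bad // sym_bad // !raddf0.
  rewrite (single_head (good_size1 gw)) aug_word_single.
  apply: etrans (zquot_liftE kS _) _; apply: etrans (zliftU _ _) _.
  by apply: Call => j; rewrite !ffunE abel_reprK.
move=> ay; have := kE y; rewrite ay raddf0 => /esym/zpi_eq0/gen_im[x ->].
by exists x.
Qed.

End Augmentation.

Section BarFunctor.
Variables (m N : nat).

Definition wmap (G H : Type) (f : G -> H) (w : {ffun 'I_m -> seq G}) :
  {ffun 'I_m -> seq H} := [ffun j => map f (w j)].

Lemma wsize_wmap (G H : groupType) (f : G -> H) (w : {ffun 'I_m -> seq G}) :
  wsize (wmap f w) = wsize w.
Proof. by apply: eq_bigr => j _; rewrite ffunE size_map. Qed.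

Lemma bad_wmap (G H : groupType) (f : {multiplicative G -> H}) w :
  ~~ good N w -> ~~ good N (wmap f w).
Proof.
case/not_goodP => [bw|[l bl]]; first by apply: bad_size; rewrite wsize_wmap.
apply: (@bad_word _ _ _ _ l); rewrite ffunE; case: bl => [->|o]; [by left | right].
by rewrite -(mult1 f) map_f.
Qed.

Section Map.
Variables (X Y : gr) (h : hom X Y).

Fact barmap_subproof z : badrel (m := m) N z ->
  badrel (m := m) N (fgmap (wmap (fg_morphism h)) z).
Proof. by move=> [w bw ->]; exists (wmap (fg_morphism h) w); rewrite ?fgmapU ?bad_wmap. Qed.

Definition barmap : {additive barob m (fg_group X) N -> barob m (fg_group Y) N} :=
  zquot_map barmap_subproof.

Lemma barmapE z : barmap (zpi _ z) = zpi _ (fgmap (wmap (fg_morphism h)) z).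
Proof. exact: zquot_mapE. Qed.

Lemma barmap_sym w : barmap (sym N w) = sym N (wmap (fg_morphism h) w).
Proof. by rewrite barmapE fgmapU. Qed.

End Map.

Lemma barobP (G : groupType) (M : zmodType) (f g : {additive barob m G N -> M}) :
  (forall w, good N w -> f (sym N w) = g (sym N w)) -> f =1 g.
Proof.
move=> fg; apply: zquotP.
apply: (freeg_additiveP (f := f \o zpi _) (g := g \o zpi _)) => w.
have [gw|bw] := boolP (good N w); first exact: fg.
by rewrite -[LHS]/(f (sym N w)) -[RHS]/(g (sym N w)) sym_bad // !raddf0.
Qed.

Fact barmap_id (X : gr) x : barmap (idm X) x = x.
Proof.
apply: (barobP (f := barmap _) (g := idfun)) => w _; rewrite barmap_sym.
by congr sym; apply/ffunP => j; rewrite ffunE map_id.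
Qed.

Fact barmap_cmp (X Y Z : gr) (f : hom X Y) (g : hom Y Z) x :
  barmap (cmp g f) x = barmap g (barmap f x).
Proof.
apply: (barobP (f := barmap _) (g := barmap g \o barmap f)) => w _.
rewrite -[RHS]/(barmap g (barmap f (sym N w))) !barmap_sym.
by congr sym; apply/ffunP => j; rewrite !ffunE -map_comp.
Qed.

Definition barF : functor gr :=
  @Functor gr (fun X => barob m (fg_group X) N) barmap barmap_id barmap_cmp.

End BarFunctor.

Lemma dtot_wmap m (G H : groupType) (f : {multiplicative G -> H})
    (z : {freeg {ffun 'I_m -> seq G}}) :
  dtot (fgmap (wmap f) z) = fgmap (wmap f) (dtot z).
Proof.
apply: (freeg_additiveP (f := @dtot m H \o fgmap (wmap f)) (g := fgmap (wmap f) \o @dtot m G)).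
move=> w; rewrite /= fgmapU /dtot raddf_sum; apply: eq_bigr => j _.
rewrite !sslotU raddfMz /= ffunE bar_map; congr (_ *~ _).
  rewrite /fgmap !zlift_comp; apply: eq_zlift => s; rewrite !zliftU.
  by congr << _ >>; apply/ffunP => l; rewrite !ffunE; case: eqP.
by rewrite /sgn_pre; congr (_ ^+ _); apply: eq_bigr => l _; rewrite ffunE size_map.
Qed.

Fact barD_subproof m N (X Y : gr) (h : hom X Y) (x : barF m N.+1 X) :
  bardiff m (fg_group Y) N (fmap (barF m N.+1) h x) =
  fmap (barF m N) h (bardiff m (fg_group X) N x).
Proof.
rewrite -[x]zreprK -[LHS]/(bardiff _ _ _ (barmap _ _ h _)) -[RHS]/(barmap _ _ h _).
by rewrite barmapE !bardiffE barmapE dtot_wmap.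
Qed.

Definition barD m N : natTrans (barF m N.+1) (barF m N) :=
  nat_of (fun X => bardiff m (fg_group X) N) (@barD_subproof m N).

Fact barA_subproof m (X Y : gr) (h : hom X Y) (x : barF m m X) :
  baraug m (fg_group Y) (fmap (barF m m) h x) = fmap (fcomp (Tpow m) ab) h (baraug m (fg_group X) x).
Proof.
apply: (barobP (f := @baraug m (fg_group Y) \o barmap _ _ h)
  (g := tensor_map m (fmap ab h) \o @baraug m (fg_group X))) => w gw.
rewrite -[LHS]/(baraug _ _ (barmap _ _ h (sym m w))).
rewrite -[RHS]/(tensor_map m (fmap ab h) (baraug _ _ (sym m w))).
rewrite barmap_sym !baraugE !zliftU (single_head (good_size1 gw)).
set u := [ffun j => _]; have -> : wmap (fg_morphism h) (single u) =
    single [ffun j => fg_morphism h (u j)] by apply/ffunP => j; rewrite !ffunE.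
rewrite !aug_word_single tensor_mapE; congr pure.
by apply/ffunP => j; rewrite !ffunE; apply/esym/abel_mapE.
Qed.

Definition barA m : natTrans (barF m m) (fcomp (Tpow m) ab) :=
  nat_of (fun X => @baraug m (fg_group X)) (@barA_subproof m).

(** ** Generic words *)

Section Generic.
Variables (m N : nat).
Implicit Types (c : {ffun 'I_m -> nat}).

Definition flatw (G : Type) (w : {ffun 'I_m -> seq G}) : seq G := flatten (codom w).

Definition wshape (G : Type) (w : {ffun 'I_m -> seq G}) : {ffun 'I_m -> nat} :=
  [ffun j => size (w j)].

Lemma nth_codom_ord (T : Type) (x0 : T) (f : 'I_m -> T) (j : 'I_m) :
  nth x0 (codom f) j = f j.
Proof. by rewrite codomE (nth_map j) ?nth_ord_enum // size_enum_ord. Qed.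

Lemma codom_inj (T : Type) (x0 : T) (f g : {ffun 'I_m -> T}) : codom f = codom g -> f = g.
Proof.
by move=> fg; apply/ffunP => j; rewrite -(nth_codom_ord x0 f) fg nth_codom_ord.
Qed.

Lemma codom_wmap (G H : Type) (f : G -> H) (w : {ffun 'I_m -> seq G}) :
  codom (wmap f w) = map (map f) (codom w).
Proof.
apply: (@eq_from_nth _ [::]); rewrite !(size_map, size_codom) // card_ord.
move=> i im; rewrite (nth_codom_ord [::] (wmap f w) (Ordinal im)).
rewrite (nth_map [::]) ?size_codom ?card_ord // ffunE.
by rewrite (nth_codom_ord [::] w (Ordinal im)).
Qed.

Lemma codom_wshape (G : Type) (w : {ffun 'I_m -> seq G}) :
  codom (wshape w) = shape (codom w).
Proof. by rewrite !codomE /shape -map_comp; apply: eq_map => j; rewrite ffunE. Qed.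

Lemma sumn_codom c : sumn (codom c) = (\sum_j c j)%N.
Proof. by rewrite codomE sumnE big_map big_enum. Qed.

Lemma size_flatw (G : groupType) (w : {ffun 'I_m -> seq G}) : size (flatw w) = wsize w.
Proof.
rewrite size_flatten -codom_wshape sumn_codom.
by apply: eq_bigr => j _; rewrite ffunE.
Qed.

Definition letters : seq (fg_group (FG N)) := [seq @fgen N i | i <- enum 'I_N].

Lemma size_letters : size letters = N.
Proof. by rewrite size_map size_enum_ord. Qed.

Lemma nth_letters x0 (P : 'I_N) : nth x0 letters P = fgen P.
Proof. by rewrite (nth_map P) ?nth_ord_enum // size_enum_ord. Qed.

(** Every word of shape [c] is the image of this one under a single morphism of
    groups, so that natural transformations are determined by their values at
    generic words. *)
Definition genw c : {ffun 'I_m -> seq (fg_group (FG N))} :=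
  [ffun j : 'I_m => nth [::] (reshape (codom c) letters) j].

Lemma codom_genw c : codom (genw c) = reshape (codom c) letters.
Proof.
apply: (@eq_from_nth _ [::]); rewrite size_codom card_ord.
  by rewrite size_reshape size_codom card_ord.
by move=> i im; rewrite (nth_codom_ord [::] (genw c) (Ordinal im)) ffunE.
Qed.

Definition goodshape c := (\sum_j c j == N)%N && [forall j, 0 < c j]%N.

Lemma flatw_genw c : (\sum_j c j = N)%N -> flatw (genw c) = letters.
Proof.
by move=> cN; rewrite /flatw codom_genw reshapeKr // sumn_codom cN size_letters.
Qed.

Lemma wshape_genw c : (\sum_j c j = N)%N -> wshape (genw c) = c.
Proof.
move=> cN; apply: (codom_inj 0%N).
by rewrite codom_wshape codom_genw reshapeKl // sumn_codom cN size_letters.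
Qed.

Lemma wsize_wshape (G : groupType) (w : {ffun 'I_m -> seq G}) :
  (\sum_j wshape w j)%N = wsize w.
Proof. by apply: eq_bigr => j _; rewrite ffunE. Qed.

Lemma goodshapeW (G : groupType) (w : {ffun 'I_m -> seq G}) :
  good N w -> goodshape (wshape w).
Proof.
case/andP => wN /forallP wg; rewrite /goodshape wsize_wshape wN /=.
by apply/forallP => j; rewrite ffunE; case/andP: (wg j); case: (w j).
Qed.

Definition theta (X : gr) (w : {ffun 'I_m -> seq (fg_group X)}) : hom (FG N) X :=
  fhom (fun P : 'I_N => nth 1%g (flatw w) P).

Lemma theta_gen (X : gr) (w : {ffun 'I_m -> seq (fg_group X)}) (P : 'I_N) :
  fg_morphism (theta w) (fgen P) = nth 1%g (flatw w) P.
Proof. exact: fhom_gen. Qed.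

Lemma map_theta_letters (X : gr) (w : {ffun 'I_m -> seq (fg_group X)}) :
  wsize w = N -> map (fg_morphism (theta w)) letters = flatw w.
Proof.
move=> wN; rewrite -map_comp.
apply: (@eq_from_nth _ 1%g); rewrite size_map size_enum_ord ?size_flatw //.
move=> i iN; rewrite (nth_map (Ordinal iN)) ?size_enum_ord //.
have -> : nth (Ordinal iN) (enum 'I_N) i = Ordinal iN.
  exact: (nth_ord_enum (Ordinal iN) (Ordinal iN)).
exact: (theta_gen w (Ordinal iN)).
Qed.

Lemma theta_genw (X : gr) (w : {ffun 'I_m -> seq (fg_group X)}) :
  wsize w = N -> wmap (fg_morphism (theta w)) (genw (wshape w)) = w.
Proof.
move=> wN; apply: (codom_inj [::]).
by rewrite codom_wmap codom_genw map_reshape map_theta_letters // codom_wshape flattenK.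
Qed.

Lemma flatw_wmap (G H : Type) (f : G -> H) (w : {ffun 'I_m -> seq G}) :
  flatw (wmap f w) = map f (flatw w).
Proof.
by rewrite /flatw codom_wmap map_flatten.
Qed.

Lemma wshape_wmap (G H : Type) (f : G -> H) (w : {ffun 'I_m -> seq G}) :
  wshape (wmap f w) = wshape w.
Proof. by apply/ffunP => j; rewrite !ffunE size_map. Qed.

Lemma theta_wmap (X Y : gr) (f : hom X Y) (w : {ffun 'I_m -> seq (fg_group X)}) :
  theta (wmap (fg_morphism f) w) = cmp f (theta w).
Proof.
apply: fhomP => P; rewrite -[RHS]/(fg_morphism f (fg_morphism (theta w) (fgen P))).
rewrite -[LHS]/(fg_morphism (theta _) (fgen P)) !theta_gen flatw_wmap.
have [Pw|Pw] := ltnP P (size (flatw w)); first by rewrite (nth_map 1%g).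
by rewrite !nth_default ?size_map // mult1.
Qed.

Definition kill (P : 'I_N) : hom (FG N) (FG N) :=
  fhom (fun Q : 'I_N => if Q == P then 1%g else fgen Q).

Lemma kill_gen P Q : fg_morphism (kill P) (fgen Q) = if Q == P then 1%g else fgen Q.
Proof. exact: fhom_gen. Qed.

Lemma killC P Q : cmp (kill P) (kill Q) = cmp (kill Q) (kill P).
Proof.
apply: fhomP => R.
rewrite -[LHS]/(fg_morphism (kill P) (fg_morphism (kill Q) (fgen R))).
rewrite -[RHS]/(fg_morphism (kill Q) (fg_morphism (kill P) (fgen R))) !kill_gen.
by case: (eqVneq R Q) => RQ; case: (eqVneq R P) => RP;
  rewrite ?mult1 ?kill_gen ?RP ?RQ ?eqxx ?(negPf RP) ?(negPf RQ).
Qed.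

Lemma killK P : cmp (kill P) (kill P) = kill P.
Proof.
apply: fhomP => R; rewrite -[LHS]/(fg_morphism (kill P) (fg_morphism (kill P) (fgen R))).
rewrite -[RHS]/(fg_morphism (kill P) (fgen R)) !kill_gen.
by case: (eqVneq R P) => RP; rewrite ?mult1 // kill_gen (negPf RP).
Qed.

Lemma mem_flatw (G : groupType) (w : {ffun 'I_m -> seq G}) g :
  g \in flatw w -> exists j, g \in w j.
Proof.
case/flattenP => s /codomP[j ->] gs; by exists j.
Qed.

Lemma mem_flatw_slot (G : groupType) (w : {ffun 'I_m -> seq G}) j g :
  g \in w j -> g \in flatw w.
Proof. by move=> gw; apply/flattenP; exists (w j) => //; apply: codom_f. Qed.

Section Yoneda.
Variables (H : functor gr).

(** These are the possible values at a generic word: the image of the word under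
    [kill P] has a letter 1, hence vanishes. *)
Definition normalized (y : H (FG N)) := forall P, fmap H (kill P) y = 0.

(** The Yoneda lemma for the summand of the words of a given shape. *)
Lemma nat_sym (z : natTrans (barF m N) H) (X : gr)
    (w : {ffun 'I_m -> seq (fg_group X)}) : wsize w = N ->
  z X (sym N w) = fmap H (theta w) (z (FG N) (sym N (genw (wshape w)))).
Proof.
move=> wN; rewrite -napp_nat -[fmap _ _ _]/(barmap _ _ _ _) barmap_sym.
by rewrite theta_genw.
Qed.

Lemma nat_normalized (z : natTrans (barF m N) H) c : goodshape c ->
  normalized (z (FG N) (sym N (genw c))).
Proof.
case/andP => /eqP cN _ P; rewrite -napp_nat -[fmap (barF m N) _ _]/(barmap _ _ _ _) barmap_sym.
rewrite sym_bad ?raddf0 //.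
have [|j o] := @mem_flatw _ (wmap (fg_morphism (kill P)) (genw c)) 1%g.
  rewrite flatw_wmap flatw_genw //.
  apply/mapP; exists (fgen P); last by rewrite kill_gen eqxx.
  by apply/mapP; exists P => //; rewrite mem_enum.
by apply: (@bad_word _ _ _ _ j); right.
Qed.

Lemma nat_genP (z z' : natTrans (barF m N) H) :
  (forall c, goodshape c -> z (FG N) (sym N (genw c)) = z' (FG N) (sym N (genw c))) ->
  z = z'.
Proof.
move=> zz; apply: natTransP => X.
apply: (@barobP m N (fg_group X) (H X) (z X : {additive barF m N X -> H X})
  (z' X : {additive barF m N X -> H X})) => w gw.
have wN : wsize w = N by case/andP: gw => /eqP.
rewrite -[LHS]/(z X (sym N w)) -[RHS]/(z' X (sym N w)).
by rewrite (nat_sym z wN) (nat_sym z' wN) zz // goodshapeW.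
Qed.

Section FromValues.
Variable y : {ffun 'I_m -> nat} -> H (FG N).
Hypothesis yP : forall c, goodshape c -> normalized (y c).

Definition yo_word (X : gr) (w : {ffun 'I_m -> seq (fg_group X)}) : H X :=
  if goodshape (wshape w) then fmap H (theta w) (y (wshape w)) else 0.

Fact yo_subproof (X : gr) z : badrel N z -> zlift (@yo_word X) z = 0.
Proof.
move=> [w bw ->]; rewrite zliftU /yo_word; case: ifP => // gs.
have cN : wsize w = N by rewrite -wsize_wshape; case/andP: gs => /eqP.
have [j oj] : exists j, 1%g \in w j.
  case/not_goodP: bw => [//|[l [wl|o]]]; last by exists l.
  by move: gs => /andP[_ /forallP/(_ l)]; rewrite ffunE wl.
have /(nthP 1%g)[i iw i1] := mem_flatw_slot oj.
have iN : (i < N)%N by rewrite -cN -size_flatw.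
have -> : theta w = cmp (theta w) (kill (Ordinal iN)).
  apply: fhomP => Q; rewrite -[RHS]/(fg_morphism (theta w) (fg_morphism (kill _) (fgen Q))).
  rewrite -[LHS]/(fg_morphism (theta w) (fgen Q)) kill_gen; case: eqP => // ->.
  by rewrite mult1 theta_gen.
by rewrite fmap_cmp yP // raddf0.
Qed.

Lemma yo_liftE (X : gr) w : zquot_lift (@yo_subproof X) (sym N w) = yo_word w.
Proof. by apply: etrans (zquot_liftE _ _) _; apply: zliftU. Qed.

Fact yo_nat_subproof (X Y : gr) (h : hom X Y) (x : barF m N X) :
  zquot_lift (@yo_subproof Y) (fmap (barF m N) h x) =
  fmap H h (zquot_lift (@yo_subproof X) x).
Proof.
apply: (barobP (f := zquot_lift (@yo_subproof Y) \o barmap _ _ h)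
  (g := fmap H h \o zquot_lift (@yo_subproof X))) => w gw.
rewrite -[LHS]/(zquot_lift (@yo_subproof Y) (barmap _ _ h (sym N w))) barmap_sym.
rewrite -[RHS]/(fmap H h (zquot_lift (@yo_subproof X) (sym N w))) !yo_liftE.
rewrite /yo_word wshape_wmap theta_wmap; case: ifP => _; last by rewrite raddf0.
by rewrite fmap_cmp.
Qed.

(** Conversely, normalized values extend to a natural transformation. *)
Definition yo : natTrans (barF m N) H :=
  nat_of (fun X => zquot_lift (@yo_subproof X)) yo_nat_subproof.

Lemma yo_sym (X : gr) (w : {ffun 'I_m -> seq (fg_group X)}) :
  goodshape (wshape w) -> yo X (sym N w) = fmap H (theta w) (y (wshape w)).
Proof.
by move=> gw; apply: etrans (yo_liftE w) _; rewrite /yo_word gw.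
Qed.

Lemma yo_genw c : goodshape c -> yo (FG N) (sym N (genw c)) = y c.
Proof.
move=> gc; have cN : (\sum_j c j = N)%N by case/andP: gc => /eqP.
rewrite yo_sym wshape_genw //.
have -> : theta (genw c) = idm (FG N) :> hom (FG N) (FG N).
  apply: fhomP => P; rewrite -[LHS]/(fg_morphism (theta _) (fgen P)) theta_gen.
  by rewrite flatw_genw // nth_letters.
exact: fmap_id.
Qed.

End FromValues.
End Yoneda.

(** A natural transformation amounts to normalized values at the generic words. A
    lift of such a value along a surjection becomes normalized, without changing
    its image, by applying the commuting projectors [1 - kill P]. *)
Lemma barF_projective : projective (barF m N).
Proof.
move=> A B p a p_surj.
have norm_lift c : exists v : A (FG N), goodshape c ->
    normalized v /\ p (FG N) v = a (FG N) (sym N (genw c)).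
  have [gc|_] := boolP (goodshape c); last by exists 0.
  (* Normalize with respect to the generators in [s] only. *)
  have claim (s : seq 'I_N) : exists v : A (FG N), p (FG N) v = a (FG N) (sym N (genw c)) /\
      forall P, P \in s -> fmap A (kill P) v = 0.
    elim: s => [|P s [v [vp vs]]]; first by have [v vp] := p_surj _ (a (FG N) (sym N (genw c))); exists v.
    exists (v - fmap A (kill P) v); split.
      by rewrite raddfB /= napp_nat vp (nat_normalized a gc) subr0.
    move=> Q; rewrite inE raddfB /= -fmap_cmp => /orP[/eqP ->|Qs].
      by rewrite killK subrr.
    by rewrite killC fmap_cmp vs // raddf0 subr0.
  have [v [vp vs]] := claim (enum 'I_N); exists v => _; split=> // P.
  by apply: vs; rewrite mem_enum.
pose y c := sval (cid (norm_lift c)).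
have yP c : goodshape c -> normalized (y c) by move=> gc; case: (svalP (cid (norm_lift c)) gc).
have yp c : goodshape c -> p (FG N) (y c) = a (FG N) (sym N (genw c)).
  by move=> gc; case: (svalP (cid (norm_lift c)) gc).
exists (yo yP); apply: nat_genP => c gc.
by rewrite -[LHS]/(p (FG N) (yo yP (FG N) _)) yo_genw // yp.
Qed.

End Generic.

(** ** The projective resolution of a tensor power of the abelianization *)

Section Resolution.
Variable m : nat.

Definition bres_ob (i : nat) : functor gr :=
  if i is j.+1 then barF m (j + m) else fcomp (Tpow m) ab.

Definition bres_d (i : nat) : natTrans (bres_ob i.+1) (bres_ob i) :=
  if i is j.+1 return natTrans (bres_ob i.+1) (bres_ob i)
  then barD m (j + m) else barA m.

Fact bres_dd i : nat_comp (bres_d i) (bres_d i.+1) = 0.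
Proof.
case: i => [|j]; apply: natTransP => X x; first exact: baraug_bardiff.
exact: bardiff_bardiff.
Qed.

Fact bres_exact i X y : bres_d i X y = 0 -> exists x, bres_d i.+1 X x = y.
Proof.
case: i y => [|j] y; first exact: baraug_exact.
have [n [e eP]] := fg_freeP X.
apply: (bardiff_exact (eP : @is_basis (fg_group X) n e)).
by rewrite -addSn -[X in _ != X]add0n eqn_add2r.
Qed.

Definition bar_resolution : augmented_resolution gr :=
  @AugRes gr bres_ob bres_d (fun i => @barF_projective m (i + m)) bres_dd
    (fun X => @aug_exists m (fg_group X)) bres_exact.

End Resolution.

(** * Signs and the action of the symmetric group *)

Section Signs.

(** The sign of the permutation that sorts the values [x i], or 0 if two of them
    coincide. *)
Definition sgf n (x : 'I_n -> int) : int :=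
  \prod_(i < n) \prod_(j < n | (i < j)%N) Num.sg (x j - x i).

(** By the Vandermonde formula, which reduces the behaviour of [sgf] under permutations
    to that of determinants. *)
Lemma sgf_det n (x : 'I_n -> int) :
  sgf x = Num.sg (\det (Vandermonde n (\row_i x i))).
Proof.
rewrite det_Vandermonde (big_morph Num.sg (@Num.Theory.sgrM _) (@Num.Theory.sgr1 _)).
apply: eq_bigr => i _.
rewrite (big_morph Num.sg (@Num.Theory.sgrM _) (@Num.Theory.sgr1 _)).
by apply: eq_bigr => j _; rewrite !mxE.
Qed.

Lemma sgf_perm n (s : 'S_n) (x : 'I_n -> int) :
  sgf (fun i => x (s i)) = (-1) ^+ s * sgf x.
Proof.
rewrite !sgf_det.
have -> : Vandermonde n (\row_i x (s i)) = col_perm s (Vandermonde n (\row_i x i)).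
  by apply/matrixP => i j; rewrite !mxE.
rewrite col_permE det_mulmx det_perm odd_permV mulrC Num.Theory.sgrM.
by congr (_ * _); case: (odd_perm s); rewrite ?expr0 ?expr1 ?Num.Theory.sgrN Num.Theory.sgr1.
Qed.

Lemma sg_natB (a b : nat) : a != b -> Num.sg (a%:Z - b%:Z) = (-1) ^+ (a < b)%N.
Proof.
case: (ltngtP a b) => // ab _.
  by rewrite Num.Theory.ltr0_sg // Num.Theory.subr_lt0 ltz_nat.
by rewrite Num.Theory.gtr0_sg // Num.Theory.subr_gt0 ltz_nat.
Qed.

Lemma sgf_id n : sgf (fun i : 'I_n => (i : nat)%:Z) = 1.
Proof.
rewrite /sgf big1 // => i _; rewrite big1 // => j ij.
by rewrite Num.Theory.gtr0_sg // Num.Theory.subr_gt0 ltz_nat.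
Qed.

Variable m : nat.
Implicit Types (s : 'S_m) (a : 'I_m -> nat).

(** The sign that records if [s] reverses the order of [k] and [l]. *)
Definition flip s (k l : 'I_m) : int := (-1) ^+ ((k < l)%N (+) (s k < s l)%N).

Lemma flipC s k l : flip s k l = flip s l k.
Proof.
rewrite /flip; case: (eqVneq k l) => [-> //|kl].
have skl : s k != s l by rewrite (inj_eq perm_inj).
have nlt (x y : 'I_m) : x != y -> (x < y)%N = ~~ (y < x)%N.
  by case: (ltngtP x y) => // /val_inj ->; rewrite eqxx.
by rewrite (nlt k l) // (nlt (s k) (s l)) // addNb addbN negbK.
Qed.

Lemma flip_sign s : \prod_(k < m) \prod_(l < m | (k < l)%N) flip s k l = (-1) ^+ s.
Proof.
have := sgf_perm s (fun i : 'I_m => (i : nat)%:Z); rewrite sgf_id mulr1 => <-.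
apply: eq_bigr => k _.
apply: eq_bigr => l kl; rewrite sg_natB; last first.
  by apply: contraTneq kl => /val_inj/perm_inj ->; rewrite ltnn.
rewrite /flip kl; case: (ltngtP (s k) (s l)) => //= e.
by have := perm_inj (val_inj e); move: kl => /[swap] ->; rewrite ltnn.
Qed.

(** Letters are odd, so reversing two words of lengths [p] and [q] costs the sign
    [(-1)^(p q)]. *)
Definition koszul s a : int :=
  \prod_(k < m) \prod_(l < m | (k < l)%N) flip s k l ^+ (a k * a l).

Lemma prod_pairs (F : 'I_m -> 'I_m -> int) l : (forall j k, F j k = F k j) ->
  \prod_(j < m) \prod_(k < m | (j < k)%N) F j k =
  (\prod_(j < m | j != l) \prod_(k < m | (j < k)%N && (k != l)) F j k) *
  \prod_(k | k != l) F l k.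
Proof.
move=> FC; rewrite (bigD1 l) //=.
have -> : \prod_(j < m | j != l) \prod_(k < m | (j < k)%N) F j k =
    (\prod_(j < m | j != l) if (j < l)%N then F j l else 1) *
    \prod_(j < m | j != l) \prod_(k < m | (j < k)%N && (k != l)) F j k.
  rewrite -big_split; apply: eq_bigr => j jl /=; case: ifP => jlt.
    by rewrite (bigD1 l).
  rewrite mul1r; apply: eq_bigl => k; case: eqP => [->|_]; last by rewrite andbT.
  by rewrite jlt.
rewrite mulrA mulrC; congr (_ * _).
rewrite [X in X * _]big_mkcond [X in _ * X]big_mkcond [RHS]big_mkcond -big_split.
apply: eq_bigr => k _ /=; rewrite (FC k l).
case: (eqVneq k l) => [->|kl] /=; first by rewrite ltnn mulr1.
by case: (ltngtP l k) kl => [||/val_inj ->]; rewrite ?mulr1 ?mul1r ?eqxx.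
Qed.

Lemma koszul_step s a a' l : (forall k, k != l -> a k = a' k) -> a l = (a' l).+1 ->
  koszul s a = koszul s a' * \prod_(k | k != l) flip s l k ^+ a k.
Proof.
move=> aa al; rewrite /koszul.
rewrite (prod_pairs (F := fun j k => flip s j k ^+ (a j * a k)) l); last first.
  by move=> j k; rewrite flipC mulnC.
rewrite (prod_pairs (F := fun j k => flip s j k ^+ (a' j * a' k)) l); last first.
  by move=> j k; rewrite flipC mulnC.
rewrite -mulrA; congr (_ * _).
  apply: eq_bigr => j jl; apply: eq_bigr => k /andP[_ kl].
  by rewrite !aa.
rewrite -big_split; apply: eq_bigr => k kl /=.
by rewrite al aa // mulSn addnC exprD.
Qed.

Lemma signs_left s a l :
  (\prod_(k | (s k < s l)%N) (-1) ^+ a k) * (\prod_(k < m | (k < l)%N) (-1) ^+ a k) =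
  \prod_(k | k != l) flip s l k ^+ a k :> int.
Proof.
rewrite big_mkcond [X in _ * X]big_mkcond [RHS]big_mkcond -big_split.
apply: eq_bigr => k _ /=; case: (eqVneq k l) => [->|kl] /=; first by rewrite !ltnn mulr1.
rewrite flipC /flip; case: (k < l)%N; case: (s k < s l)%N;
  by rewrite /= ?expr0 ?expr1 ?mulr1 ?mul1r ?expr1n // -expr2 sqrr_sign.
Qed.

End Signs.

Section BarAction.
Variables (m : nat) (s : 'S_m).

Section Group.
Variable G : groupType.
Implicit Types w : {ffun 'I_m -> seq G}.

Definition permw w : {ffun 'I_m -> seq G} := [ffun l => w (s l)].

Definition ksign w : int := koszul s (fun k => size (w (s k))).

Definition bactz :=
  zlift (fun w => (<< permw w >> : {freeg {ffun 'I_m -> seq G}}) *~ ksign w).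
HB.instance Definition _ := GRing.Additive.on bactz.

Lemma bactzU w : bactz << w >> = << permw w >> *~ ksign w.
Proof. exact: zliftU. Qed.

Lemma wsize_permw w : wsize (permw w) = wsize w.
Proof.
rewrite /wsize [RHS](reindex_inj (@perm_inj _ s)) /=.
by apply: eq_bigr => j _; rewrite ffunE.
Qed.

Lemma bad_permw N w : ~~ good N w -> ~~ good N (permw w).
Proof.
case/not_goodP => [bw|[l bl]]; first by apply: bad_size; rewrite wsize_permw.
by apply: (@bad_word _ _ _ _ ((s^-1)%g l)); rewrite ffunE permKV.
Qed.

Lemma permw_setw w l t : permw (setw w (s l) t) = setw (permw w) l t.
Proof. by apply/ffunP => k; rewrite !ffunE (inj_eq perm_inj). Qed.

Lemma sgn_pre_perm w l :
  sgn_pre w (s l) = \prod_(k | (s k < s l)%N) (-1) ^+ size (w (s k)).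
Proof.
rewrite /sgn_pre /pre (reindex_inj (@perm_inj _ s)) /=.
by rewrite (big_morph (fun k => (-1) ^+ k : int) (exprD _) (expr0 _)).
Qed.

Lemma sgn_pre_permw w l :
  sgn_pre (permw w) l = \prod_(k < m | (k < l)%N) (-1) ^+ size (w (s k)).
Proof.
rewrite /sgn_pre /pre (big_morph (fun k => (-1) ^+ k : int) (exprD _) (expr0 _)).
by apply: eq_bigr => k _; rewrite ffunE.
Qed.

(** The Koszul sign compensates exactly for the letters that move across the
    word in which the bar differential acts. *)
Lemma ksign_bar w l t : (size t).+1 = size (w (s l)) ->
  ksign (setw w (s l) t) * sgn_pre w (s l) = sgn_pre (permw w) l * ksign w.
Proof.
move=> tl; have := @koszul_step m s (fun k => size (w (s k)))
  (fun k => size (setw w (s l) t (s k))) l.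
rewrite -/(ksign w) -/(ksign (setw w (s l) t)) => -> /=; first last.
- by rewrite setwE tl.
- by move=> k kl; rewrite setw_neq // (inj_eq perm_inj).
rewrite -(signs_left s (fun k => size (w (s k)))) -sgn_pre_perm -sgn_pre_permw.
by rewrite [RHS]mulrCA (mulrCA (sgn_pre (permw w) l)) sgn_pre2 mulr1.
Qed.

Lemma dtot_bactz z : dtot (bactz z) = bactz (dtot z).
Proof.
apply: (freeg_additiveP (f := @dtot m G \o bactz) (g := bactz \o @dtot m G)) => w.
rewrite /= bactzU raddfMz /= /dtot raddf_sum /= [RHS](reindex_inj (@perm_inj _ s)) /=.
rewrite mulrz_suml; apply: eq_bigr => l _; rewrite !sslotU raddfMz /= ffunE.
have -> : bactz (fgmap (setw w (s l)) (bar (w (s l)))) =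
    fgmap (setw (permw w) l) (bar (w (s l))) *~
      (sgn_pre (permw w) l * ksign w * sgn_pre w (s l)).
  rewrite /bactz zlift_fgmap -zliftMz.
  apply: spanned_eq_zlift (bar_size (w (s l))) => t tl.
  by rewrite permw_setw -(ksign_bar tl) -mulrA sgn_pre2 mulr1.
by rewrite -!mulrzA -(mulrA (_ * _)) sgn_pre2 mulr1.
Qed.

Fact bact_subproof N z : badrel N z -> (zpi (badrel (m := m) N) \o bactz) z = 0.
Proof.
move=> [w bw ->]; apply: zpi_bad; rewrite bactzU.
exact/spannedMz/spannedU/bad_permw.
Qed.

Definition bact N : {additive barob m G N -> barob m G N} :=
  zquot_lift (@bact_subproof N).

Lemma bactE N z : bact N (zpi _ z) = zpi _ (bactz z).
Proof. exact: zquot_liftE. Qed.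

Lemma bact_sym N w : bact N (sym N w) = sym N (permw w) *~ ksign w.
Proof. by rewrite bactE bactzU raddfMz. Qed.

Lemma bact_bardiff N x : bardiff m G N (bact N.+1 x) = bact N (bardiff m G N x).
Proof. by rewrite -[x]zreprK bactE !bardiffE bactE dtot_bactz. Qed.

Lemma baraug_bact x :
  baraug m G (bact m x) = tensor_perm (s^-1)%g (abel G) (baraug m G x) *~ (-1) ^+ s.
Proof.
pose f : {additive barob m G m -> tensor m (abel G)} :=
  HB.pack (fun x => tensor_perm (s^-1)%g (abel G) (baraug m G x) *~ (-1) ^+ s)
    (GRing.isZmodMorphism.Build _ _
      (fun x => tensor_perm (s^-1)%g (abel G) (baraug m G x) *~ (-1) ^+ s)
      (fun x y => etrans (congr1 (fun z => z *~ _) (raddfB (tensor_perm _ _ \o baraug m G) x y))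
        (mulrzBl _ _ _))).
apply: (barobP (f := baraug m G \o bact m) (g := f)) => w gw.
rewrite -[LHS]/(baraug m G (bact m (sym m w))).
rewrite -[RHS]/(tensor_perm (s^-1)%g (abel G) (baraug m G (sym m w)) *~ (-1) ^+ s).
rewrite bact_sym raddfMz !baraugE !zliftU (single_head (good_size1 gw)).
set u := [ffun j => _].
have -> : permw (single u) = single [ffun j => u (s j)].
  by apply/ffunP => j; rewrite !ffunE.
rewrite !aug_word_single tensor_permE; congr (_ *~ _).
  by congr pure; apply/ffunP => j; rewrite !ffunE invgK.
rewrite -flip_sign; apply: eq_bigr => k _; apply: eq_bigr => l _.
by rewrite !ffunE /= expr1.
Qed.

End Group.

Lemma permw_wmap (G H : groupType) (f : G -> H) (w : {ffun 'I_m -> seq G}) :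
  permw (wmap f w) = wmap f (permw w).
Proof. by apply/ffunP => j; rewrite !ffunE. Qed.

Lemma ksign_wmap (G H : groupType) (f : G -> H) (w : {ffun 'I_m -> seq G}) :
  ksign (wmap f w) = ksign w.
Proof.
by apply: eq_bigr => k _; apply: eq_bigr => l _; rewrite !ffunE !size_map.
Qed.

Fact bactF_subproof N (X Y : gr) (h : hom X Y) (x : barF m N X) :
  bact (fg_group Y) N (fmap (barF m N) h x) = fmap (barF m N) h (bact (fg_group X) N x).
Proof.
apply: (barobP (f := bact (fg_group Y) N \o barmap _ _ h)
  (g := barmap _ _ h \o bact (fg_group X) N)) => w gw.
rewrite -[LHS]/(bact (fg_group Y) N (barmap _ _ h (sym N w))).
rewrite -[RHS]/(barmap _ _ h (bact (fg_group X) N (sym N w))).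
by rewrite barmap_sym !bact_sym raddfMz barmap_sym permw_wmap ksign_wmap.
Qed.

Definition bactF N : natTrans (barF m N) (barF m N) :=
  nat_of (fun X => bact (fg_group X) N) (@bactF_subproof N).

(** On words of length one the Koszul sign is the sign of [s], which has to be
    undone in order to lift the permutation of tensor factors. *)
Definition bact_chain (i : nat) : natTrans (bres_ob m i) (bres_ob m i) :=
  if i is j.+1 return natTrans (bres_ob m i) (bres_ob m i)
  then bactF (j + m) *~ (-1) ^+ s else Tpow_perm (s^-1)%g ab.

Lemma natMzE (C : category) (F G : functor C) (a : natTrans F G) (c : int) X x :
  (a *~ c) X x = a X x *~ c.
Proof.
have n k : (a *+ k) X x = a X x *+ k.
  by elim: k => [|k IH] //; rewrite !mulrS -IH.
by case: c => k; rewrite /intmul // -n.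
Qed.

Lemma bact_chainP : @chain_map gr (bar_resolution m) (bar_resolution m) bact_chain.
Proof.
case=> [|j]; apply: natTransP => X x.
  rewrite /= natMzE; apply: etrans (raddfMz (baraug m (fg_group X)) _ _) _.
  rewrite baraug_bact -mulrzA -expr2 sqrr_sign mulr1z.
  by [].
rewrite /= !natMzE; apply: etrans (raddfMz (bardiff m (fg_group X) (j + m)) _ _) _.
by rewrite bact_bardiff.
Qed.

End BarAction.

(** * Ordered set partitions *)

Section Fuse.
Variable n : nat.
Implicit Types f : 'I_n -> nat.

(** Identifies [P] and [P.+1], and renumbers. *)
Definition mu (P q : nat) : nat := (q - (P < q))%N.

Definition fuse P f : 'I_n -> nat := fun i => mu P (f i).

(** Takes [l] out of its block and puts it, alone, just before it. *)
Definition split_off l f : 'I_n -> nat :=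
  fun i => if i == l then f l else (f i + (f l <= f i))%N.

(** An ordered partition of ['I_n] into [N] blocks, given by the number of the
    block of each element. *)
Definition onto N f :=
  [forall P : 'I_N, exists i, f i == P] && [forall i, f i < N]%N.

Lemma ontoP N f : reflect
  ((forall P, P < N -> exists i, f i = P) /\ (forall i, f i < N))%N (onto N f).
Proof.
apply: (iffP andP) => -[]; last first.
  move=> oP bP; split; last exact/forallP.
  by apply/forallP => P; have [i <-] := oP P (ltn_ord P); apply/existsP; exists i.
move=> /forallP oP /forallP bP; split=> // P PN.
by have /existsP[i /eqP] := oP (Ordinal PN); exists i.
Qed.

Lemma muE P q : mu P q = if (P < q)%N then q.-1 else q.
Proof. by rewrite /mu; case: ifP => _; rewrite ?subn1 ?subn0. Qed.

Lemma mu_comm P Q q : (P <= Q)%N -> mu Q (mu P q) = mu P (mu Q.+1 q).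
Proof.
by move=> PQ; rewrite !muE; do !case: ifP; lia.
Qed.

Lemma onto_fuse M P f : (P < M)%N -> onto M.+1 f -> onto M (fuse P f).
Proof.
move=> PM /ontoP[oP bP]; apply/ontoP; split=> [Q QM|i]; last first.
  by have := bP i; rewrite /fuse muE; case: ifP; lia.
have [QP|PQ] := leqP Q P.
  have [|i fi] := oP Q; first lia.
  by exists i; rewrite /fuse muE fi; case: ifP; lia.
have [|i fi] := oP Q.+1; first lia.
by exists i; rewrite /fuse muE fi; case: ifP; lia.
Qed.

Lemma fuse_split_off l f : fuse (f l) (split_off l f) = f.
Proof.
apply/funext => i; rewrite /fuse /split_off muE.
by case: (eqVneq i l) => [->|_]; [case: ifP | case: (leqP (f l) (f i)); case: ifP]; lia.
Qed.

Lemma fuse_split_off_gt l f P : (f l <= P)%N ->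
  fuse P.+1 (split_off l f) = split_off l (fuse P f).
Proof.
move=> lP; apply/funext => i; rewrite /fuse /split_off !muE.
case: (eqVneq i l) => [_|_]; first by do !case: ifP; lia.
by case: (leqP (f l) (f i)); do !case: ifP; lia.
Qed.

Lemma split_off_fuse l f : (forall i, f i = f l -> i = l) ->
  split_off l (fuse (f l) f) = f.
Proof.
move=> single; apply/funext => i; rewrite /fuse /split_off !muE ltnn.
case: (eqVneq i l) => [->//|il].
have fil : f i <> f l by move=> e; rewrite (single i e) eqxx in il.
by case: ifP; case: leqP; lia.
Qed.

Lemma onto_split_off N l f : (exists2 i, i != l & f i = f l) -> onto N f ->
  onto N.+1 (split_off l f).
Proof.
move=> [i0 i0l fi0] /ontoP[oP bP]; apply/ontoP; split=> [Q QN|i]; last first.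
  rewrite /split_off; case: eqP => _; first by have := bP l; lia.
  by have := bP i; case: leqP; lia.
case: (ltngtP Q (f l)) => Ql; last by exists l; rewrite /split_off eqxx.
  have [|i fi] := oP Q; first by have := bP l; lia.
  exists i; rewrite /split_off; case: eqP => [il|_]; first by move: fi; rewrite il; lia.
  by rewrite fi; case: leqP; lia.
have [|i fi] := oP Q.-1; first by lia.
case: (eqVneq i l) => [il|il].
  exists i0; rewrite /split_off (negPf i0l) fi0 leqnn; move: fi; rewrite il; lia.
by exists i; rewrite /split_off (negPf il) fi; case: leqP; lia.
Qed.

(** Ordered partitions are the faces of the permutohedron, and a face lies in the
    boundary of those that are obtained by merging two consecutive blocks. So
    this is the cellular boundary map, up to the signs of orientations. *)
Definition delta M (psi : ('I_n -> nat) -> int) f : int :=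
  \sum_(P < M) (-1) ^+ P * psi (fuse P f).

Lemma deltaB M psi psi' f :
  delta M (fun f => psi f - psi' f) f = delta M psi f - delta M psi' f.
Proof. by rewrite /delta -sumrB; apply: eq_bigr => P _; rewrite mulrBr. Qed.

Lemma deltaD M psi psi' f :
  delta M (fun f => psi f + psi' f) f = delta M psi f + delta M psi' f.
Proof. by rewrite /delta -big_split; apply: eq_bigr => P _; rewrite mulrDr. Qed.

Lemma delta_delta M psi f : delta M.+1 (delta M psi) f = 0.
Proof.
pose a (P Q : nat) : int := (-1) ^+ P * ((-1) ^+ Q * psi (fuse Q (fuse P f))).
have -> : delta M.+1 (delta M psi) f = \sum_(P < M.+1) \sum_(Q < M) a P Q.
  by apply: eq_bigr => P _; rewrite mulr_sumr.
have -> : \sum_(P < M.+1) \sum_(Q < M) a P Q =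
    \sum_(P < M.+1) \sum_(Q < M | (P <= Q)%N) a P Q +
    \sum_(P < M.+1) \sum_(Q < M | ~~ (P <= Q)%N) a P Q.
  rewrite -big_split; apply: eq_bigr => P _.
  exact: (bigID (fun Q : 'I_M => (P <= Q)%N)).
have -> : \sum_(P < M.+1) \sum_(Q < M | ~~ (P <= Q)%N) a P Q =
    \sum_(P < M) \sum_(Q < M | (P <= Q)%N) a Q.+1 P.
  rewrite (exchange_big_dep predT) //=; apply: eq_bigr => P _.
  rewrite big_mkcond big_ord_recl /= add0r [RHS]big_mkcond.
  by apply: eq_bigr => Q _; rewrite /= -ltnNge /bump leq0n add1n ltnS.
rewrite big_ord_recr /= [X in _ + X + _]big_pred0 => [|Q]; last first.
  by apply/negbTE; rewrite -ltnNge.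
rewrite addr0 -big_split big1 //= => P _; rewrite -big_split big1 //= => Q PQ.
rewrite /a exprS mulN1r mulNr mulrCA.
rewrite (_ : fuse P (fuse Q.+1 f) = fuse Q (fuse P f)) ?addrN //.
by apply/funext => i; rewrite /fuse -(mu_comm _ PQ).
Qed.

End Fuse.

Section Sorting.
Variables (m n : nat) (g : 'I_n -> 'I_m).
Implicit Types (f : 'I_n -> nat) (phi psi : ('I_n -> nat) -> int).

Definition compat f := [forall i, forall j, (f i <= f j)%N ==> (g i <= g j)%N].

(** A refinement of the ordered partition of ['I_n] into the fibres of [g] into
    [N] consecutive nonempty blocks. *)
Definition valid N f := onto N f && compat f.

Lemma compatP f : reflect (forall i j, f i <= f j -> g i <= g j)%N (compat f).
Proof. by apply: (iffP forallP) => [h i j|h i]; [move/forallP: (h i) => /(_ j)/implyP | apply/forallP => j; apply/implyP/h]. Qed.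

Lemma compat_eq f i j : compat f -> f i = f j -> g i = g j.
Proof.
move=> /compatP c e; apply/val_inj/eqP; rewrite /= eqn_leq.
by apply/andP; split; apply: c; rewrite e.
Qed.

Lemma compat_fuse P f : compat (fuse P f) -> compat f.
Proof.
move=> /compatP c; apply/compatP => i j ij; apply: c.
by rewrite /fuse !muE; do !case: ifP; lia.
Qed.

Lemma compat_split_off l f : compat f -> compat (split_off l f).
Proof.
move=> /compatP c; apply/compatP => i j; rewrite /split_off.
case: (eqVneq i l) => [->|il]; case: (eqVneq j l) => [->|jl] // h; apply: c.
- by move: h; case: leqP; lia.
- by move: h; case: leqP; lia.
- by move: h; do 2 case: leqP; lia.
Qed.

Lemma compat_of_split l (i0 : 'I_n) f : i0 != l -> f i0 = f l -> g i0 = g l ->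
  compat (split_off l f) -> compat f.
Proof.
move=> i0l fi0 gi0 cF; set F := split_off l f; have /compatP c := cF.
have FE i : i != l -> F i = (f i + (f l <= f i))%N by move=> il; rewrite /F /split_off (negPf il).
have Fl : F l = f l by rewrite /F /split_off eqxx.
apply/compatP => i j fij; case: (eqVneq j l) fij => [->|jl] fij; last first.
  apply: c; rewrite -/F [X in (_ <= X)%N]FE //.
  case: (eqVneq i l) fij => [->|il] fij; first by rewrite Fl; case: leqP; lia.
  by rewrite FE //; case: (leqP (f l) (f i)); case: (leqP (f l) (f j)); lia.
case: (eqVneq i l) => [->//|il]; case: (ltngtP (f i) (f l)) fij => // fil _.
  by apply: c; rewrite -/F Fl FE //; case: leqP; lia.
by rewrite -gi0 (compat_eq cF (i := i) (j := i0)) // -/F !FE // fil fi0.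
Qed.

Definition sorted_from (k : nat) f := [forall e : 'I_n, forall i : 'I_n,
  [&& k <= e, i != e, g i == g e & f e <= f i] ==> (e < i)]%N.

Lemma sorted_fromP (k : nat) f : reflect (forall e i : 'I_n, (k <= e)%N -> i != e ->
  g i = g e -> (f e <= f i)%N -> (e < i)%N) (sorted_from k f).
Proof.
apply: (iffP forallP) => [h e i ke ie gie fei|h e].
  move/forallP: (h e) => /(_ i)/implyP; apply.
  by rewrite ke ie gie eqxx fei.
apply/forallP => i; apply/implyP => /and4P[ke ie /eqP gie fei].
exact: h.
Qed.

Definition top_of_block (l : 'I_n) f := [exists i, (i != l) && (f i == f l)] &&
  [forall i, (i != l) && (f i == f l) ==> (i < l)%N].

(** The homotopy at the stage [l] of the sorting procedure. The elements above [l]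
    are already in increasing order within their fibres, so [l] can only share
    a block with smaller elements. *)
Definition extract M (l : 'I_n) phi f : int :=
  if valid M f && top_of_block l f then (-1) ^+ f l * phi (split_off l f) else 0.

Section Step.
Variables (M k : nat) (l : 'I_n) (phi : ('I_n -> nat) -> int).
Hypothesis phi_cocycle : forall f, valid M.+2 f -> delta M.+1 phi f = 0.
Hypothesis phi_valid : forall f, phi f <> 0 -> valid M.+1 f.
Hypothesis phi_supp : forall f, phi f <> 0 ->
  sorted_from l.+1 f /\ (sorted_from l f \/ (k <= f l)%N).

(** In the support, what fails to be sorted at [l] has [l] in the block [k] or
    later: the homotopies for the earlier positions have been applied. *)
Lemma supp_left f (i : 'I_n) : (i < l)%N -> g i = g l -> (f l <= f i)%N -> (f l < k)%N -> phi f = 0.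
Proof.
move=> il gil fli flk; case: (eqVneq (phi f) 0) => // /eqP/phi_supp [_ [|]]; last by lia.
move=> /sorted_fromP/(_ l i (leqnn l) _ gil fli); rewrite -val_eqE neq_ltn il.
by move=> /(_ isT); lia.
Qed.

Lemma split_off_supp h (i0 : 'I_n) : onto M h -> (i0 < l)%N -> h i0 = h l -> g i0 = g l ->
  phi (split_off l h) <> 0 -> valid M h && top_of_block l h.
Proof.
move=> oh i0l hi0 gi0 Fn0; set F := split_off l h.
have i0l' : i0 != l by apply: contraTneq i0l => ->; rewrite ltnn.
have FE i : i != l -> F i = (h i + (h l <= h i))%N by move=> il; rewrite /F /split_off (negPf il).
have Fl : F l = h l by rewrite /F /split_off eqxx.
have /andP[_ cF] := phi_valid Fn0; have [sF _] := phi_supp Fn0.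
have same i : i != l -> h i = h l -> g i = g i0.
  by move=> il hil; apply: compat_eq cF _; rewrite -/F !FE // hil hi0.
have ch : compat h := compat_of_split i0l' hi0 gi0 cF.
rewrite /valid oh ch /=; apply/andP; split.
  by apply/existsP; exists i0; rewrite i0l' hi0 eqxx.
apply/forallP => i; apply/implyP => /andP[il /eqP hil].
case: (ltngtP i l) => // [li|/val_inj e]; last by rewrite e eqxx in il.
have := sorted_fromP _ _ sF i i0 li.
rewrite -val_eqE neq_ltn (ltn_trans i0l li) (same i) // -/F !FE // hil hi0 leqnn.
by move=> /(_ isT erefl isT); lia.
Qed.

Lemma extract_left f P (i : 'I_n) : (i < l)%N -> g i = g l -> i != l ->
  (f l <= f i)%N -> (f l <= k)%N -> (P < f l)%N -> extract M l phi (fuse P f) = 0.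
Proof.
move=> il gil il' fli flk Pl; rewrite /extract; case: ifP => // _.
rewrite (@supp_left _ i) ?mulr0 // /split_off eqxx ?(negPf il') /fuse !muE.
  by do !case: ifP; case: leqP; lia.
by case: ifP; lia.
Qed.

Lemma sum_from (b : nat -> int) q : (q < M.+1)%N -> (forall P, P < q -> b P = 0)%N ->
  \sum_(P < M.+1) b P = b q + \sum_(P < M | (q <= P)%N) b P.+1.
Proof.
move=> qM b0; rewrite (bigD1 (Ordinal qM)) //=; congr (_ + _).
rewrite big_mkcond big_ord_recl /= [RHS]big_mkcond /=.
rewrite (_ : (if _ then b _ else _) = 0) ?add0r; last first.
  by case: ifP => // q0; apply: b0; move: q0; rewrite -val_eqE /=; lia.
apply: eq_bigr => P _; rewrite -val_eqE /= /bump leq0n add1n.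
case: (ltngtP P.+1 q) => Pq; last by rewrite leqNgt -Pq ltnSn.
  by rewrite /= b0 // ifN //; lia.
by rewrite ifT.
Qed.

(** The cocycle condition at the partition where [l] is split off expresses [phi f]
    through partitions in which the block of [l] is still a common one. *)
Lemma extract_nonsingle f : valid M.+1 f -> sorted_from l.+1 f -> (f l <= k)%N ->
  (exists2 i : 'I_n, i != l & f i = f l) -> phi f = delta M (extract M l phi) f.
Proof.
move=> vf sf flk [i il fil]; have /andP[fo fc] := vf.
have gil : g i = g l by apply: compat_eq fc fil.
have il' : (i < l)%N.
  case: (ltngtP i l) => [//|li|/val_inj e]; last by rewrite e eqxx in il.
  have := sorted_fromP _ _ sf i l li.
  by rewrite eq_sym il gil fil leqnn => /(_ isT erefl isT); lia.
have os : onto M.+2 (split_off l f) by apply: onto_split_off fo; exists i.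
have lM : (f l < M.+1)%N by have /ontoP[_] := fo.
have := phi_cocycle (introT andP (conj os (compat_split_off l fc))).
rewrite /delta (sum_from (b := fun P => (-1) ^+ P * phi (fuse P (split_off l f))) lM).
  rewrite fuse_split_off => /eqP; rewrite addr_eq0 => /eqP e.
  have e' : phi f = (-1) ^+ f l * ((-1) ^+ f l * phi f).
    by rewrite mulrA -expr2 sqrr_sign mul1r.
  rewrite [LHS]e' e mulrN -mulNr mulr_sumr.
  rewrite big_mkcond; apply: eq_bigr => P _; case: ifPn => Pl; last first.
    by rewrite (@extract_left _ _ i) ?mulr0 ?fil // ltnNge.
  rewrite exprS mulN1r !mulNr mulrN opprK mulrCA; congr (_ * _).
  rewrite fuse_split_off_gt // /extract; case: ifPn => [_|bad].
    by rewrite /fuse muE ltnNge Pl.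
  case: (eqVneq (phi (split_off l (fuse P f))) 0) => [->|/eqP n0]; first by rewrite mulr0.
  by rewrite (split_off_supp _ il' _ gil n0) // in bad; [apply: onto_fuse | rewrite /fuse fil].
move=> P Pl; rewrite (@supp_left _ i) ?mulr0 //; rewrite /fuse /split_off eqxx ?(negPf il) !muE ?fil ?leqnn.
  by do !case: ifP; lia.
by case: ifP; lia.
Qed.

(** If [l] is alone in its block, only the term that merges this block with the
    next one survives in the homotopy, and it gives back [phi f]. *)
Lemma extract_single f : valid M.+1 f -> sorted_from l.+1 f -> (f l <= k)%N ->
  ~~ sorted_from l f -> (forall i, f i = f l -> i = l) ->
  phi f = delta M (extract M l phi) f.
Proof.
move=> vf sf flk nsf single; have /andP[fo fc] := vf; have /ontoP[oP bP] := fo.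
have [i [il gil fli]] : exists i : 'I_n, [/\ (i < l)%N, g i = g l & (f l < f i)%N].
  move: nsf; rewrite negb_forall => /existsP[e]; rewrite negb_forall => /existsP[i].
  rewrite negb_imply -leqNgt => /andP[/and4P[le ie /eqP gie fei] ile].
  case: (ltngtP l e) le => // [le _|/val_inj le _].
    by have := sorted_fromP _ _ sf e i le ie gie fei; lia.
  subst e; exists i; split=> //; first by rewrite ltn_neqAle ile andbT.
  by rewrite ltn_neqAle fei andbT eq_sym; apply: contra ie => /eqP/single ->.
have il' : i != l by apply: contraTneq il => ->; rewrite ltnn.
have lM : (f l < M)%N by have := bP i; lia.
rewrite /delta (bigD1 (Ordinal lM)) //= big1 => [|P Pl]; last first.
  case: (ltngtP P (f l)) => Pl'; last by rewrite -val_eqE /= Pl' eqxx in Pl.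
    by rewrite (@extract_left _ _ i) ?mulr0 // ltnW.
  rewrite /extract; case: ifP => [/andP[_ /andP[/existsP[j /andP[jl /eqP]]]]|_]; last by rewrite mulr0.
  rewrite /fuse !muE => fjl; case/eqP: jl; apply: single.
  by move: fjl; do !case: ifP; lia.
rewrite addr0 /extract.
have mll : fuse (f l) f l = f l by rewrite /fuse muE ltnn.
case: ifPn => [_|bad].
  by rewrite mll split_off_fuse // mulrA -expr2 sqrr_sign mul1r.
rewrite mulr0; case: (eqVneq (phi f) 0) => // /eqP n0.
have [j fj] := oP (f l).+1 (leq_ltn_trans fli (bP i)).
have gj : g j = g l.
  have /compatP c := fc; apply/val_inj/eqP; rewrite /= eqn_leq.
  by rewrite (c l j) ?fj // andbT -gil c // fj.
have jl : j != l by apply/eqP => e; move: fj; rewrite e; lia.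
have jl' : (j < l)%N.
  case: (ltngtP j l) => // [lj|/val_inj e]; last by rewrite e eqxx in jl.
  case: (eqVneq i j) => [e|ij]; first by move: il lj; rewrite e; lia.
  have := sorted_fromP _ _ sf j i lj ij; rewrite gil gj fj => /(_ erefl fli).
  by lia.
have mj : fuse (f l) f j = f l by rewrite /fuse muE fj ltnSn.
have := @split_off_supp (fuse (f l) f) j (onto_fuse lM fo) jl'.
by rewrite split_off_fuse // mll (negPf bad) => /(_ mj gj n0).
Qed.

Lemma sorted_fuse (k' : nat) P f : sorted_from k' (fuse P f) -> sorted_from k' f.
Proof.
move=> /sorted_fromP h; apply/sorted_fromP => e i ke ie gie fei; apply: h => //.
by rewrite /fuse !muE; do !case: ifP; lia.
Qed.

Lemma sorted_split h : top_of_block l h -> sorted_from l.+1 (split_off l h) ->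
  sorted_from l.+1 h.
Proof.
move=> /andP[_ /forallP top] /sorted_fromP s; apply/sorted_fromP => e i le ie gie hei.
have el : e != l by apply/eqP => el; move: le; rewrite el ltnn.
case: (eqVneq i l) => [il|il].
  subst i; case: (ltngtP (h e) (h l)) hei => // hel _.
    by apply: s; rewrite // /split_off eqxx (negPf el); case: leqP; lia.
  by have := implyP (top e); rewrite el hel eqxx => /(_ isT); lia.
apply: s => //; rewrite /split_off (negPf il) (negPf el).
by case: (leqP (h l) (h i)); case: (leqP (h l) (h e)); lia.
Qed.

(** The restriction to ordered partitions keeps the support in the cochains of
    degree [M.+1]. *)
Definition remainder f : int :=
  if onto M.+1 f then phi f - delta M (extract M l phi) f else 0.

Lemma extract_valid f : extract M l phi f <> 0 -> valid M f.
Proof. by rewrite /extract; case: ifP => // /andP[]. Qed.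

Lemma remainder_valid f : remainder f <> 0 -> valid M.+1 f.
Proof.
rewrite /remainder; case: ifP => // fo; rewrite /valid fo.
case: (boolP (compat f)) => // nc.
case: (eqVneq (phi f) 0) => [->|/eqP/phi_valid]; last by rewrite /valid (negPf nc) andbF.
rewrite /delta big1 ?subr0 // => P _.
case: (eqVneq (extract M l phi (fuse P f)) 0) => [->|/eqP/extract_valid]; first by rewrite mulr0.
by move=> /andP[_ /compat_fuse]; rewrite (negPf nc).
Qed.

Lemma remainder_cocycle f : valid M.+2 f -> delta M.+1 remainder f = 0.
Proof.
move=> vf; rewrite -(phi_cocycle vf) -[RHS]subr0 -(delta_delta M (extract M l phi) f).
rewrite -deltaB; apply: eq_bigr => P _; rewrite /remainder onto_fuse //.
by case/andP: vf.
Qed.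

Lemma remainder_supp f : remainder f <> 0 ->
  sorted_from l.+1 f /\ (sorted_from l f \/ (k < f l)%N).
Proof.
move=> rn0; have vf := remainder_valid rn0.
move: rn0; rewrite /remainder; have /andP[-> _] := vf => rn0.
have sf : sorted_from l.+1 f.
  apply: contra_notT rn0 => nsf.
  case: (eqVneq (phi f) 0) => [->|/eqP/phi_supp[]]; last by rewrite (negPf nsf).
  rewrite /delta big1 ?subr0 // => P _.
  rewrite /extract; case: ifP => [/andP[_ top]|_]; last by rewrite mulr0.
  case: (eqVneq (phi (split_off l (fuse P f))) 0) => [->|/eqP/phi_supp[sp _]].
    by rewrite !mulr0.
  by rewrite (sorted_fuse (sorted_split top sp)) in nsf.
split=> //; case: (boolP (sorted_from l f)) => [|nsf]; [by left | right].
rewrite ltnNge; apply: contra_notN rn0 => flk; apply/eqP; rewrite subr_eq0; apply/eqP.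
have [[i il fil]|single] := pselect (exists2 i : 'I_n, i != l & f i = f l).
  by apply: extract_nonsingle => //; exists i.
apply: extract_single => // i fil; apply/eqP; apply: contra_notT single => il.
by exists i.
Qed.

End Step.

Definition cochain N phi := forall f, phi f <> 0 -> valid N f.

Definition cocycle_on N phi := forall f, valid N.+1 f -> delta N phi f = 0.

(** Each application of the homotopy for [l] pushes the unsorted part of the support to
    partitions in which [l] is in a later block; this ends, as there are only
    [M.+1] blocks. *)
Lemma push_right M (l : 'I_n) d : forall k phi, (M.+1 - k <= d)%N ->
  cochain M.+1 phi -> cocycle_on M.+1 phi ->
  (forall f, phi f <> 0 -> sorted_from l.+1 f /\ (sorted_from l f \/ (k <= f l)%N)) ->
  exists psi phi0, [/\ cochain M psi, cochain M.+1 phi0, cocycle_on M.+1 phi0,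
    forall f, phi0 f <> 0 -> sorted_from l f &
    forall f, onto M.+1 f -> phi f = delta M psi f + phi0 f].
Proof.
elim: d => [|d IH] k phi kd phiv phic phis.
  exists (fun=> 0), phi; split=> // [f /[dup] fn0 /phis[_ [//|kf]]|f _].
    have /andP[/ontoP[_ bP] _] := phiv _ fn0.
    by have bl := bP l; exfalso; lia.
  by rewrite /delta big1 ?add0r // => P _; rewrite mulr0.
have [||||psi [phi0 [psiv phi0v phi0c phi0s phiE]]] := IH k.+1 (remainder M l phi).
- by lia.
- exact: remainder_valid.
- exact: remainder_cocycle.
- exact: remainder_supp.
exists (fun f => extract M l phi f + psi f), phi0; split=> // [f|f fo].
  case: (eqVneq (psi f) 0) => [->|/eqP pn0 _]; last exact: psiv.
  by rewrite addr0; apply: extract_valid.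
have := phiE f fo; rewrite /remainder fo => /eqP; rewrite subr_eq => /eqP ->.
by rewrite deltaD addrC addrA.
Qed.

(** Sorting the elements [l] one at a time, from the last one down. This is the
    acyclicity of a product of permutohedra, whose only remaining cell is the
    vertex where every fibre of [g] is in increasing order. *)
Lemma sort_cocycle M phi : cochain M.+1 phi -> cocycle_on M.+1 phi ->
  exists psi phi0, [/\ cochain M psi, cochain M.+1 phi0,
    forall f, phi0 f <> 0 -> sorted_from 0 f &
    forall f, onto M.+1 f -> phi f = delta M psi f + phi0 f].
Proof.
move=> phiv phic.
suff claim d : (d <= n)%N -> exists psi phi0, [/\ cochain M psi, cochain M.+1 phi0,
    cocycle_on M.+1 phi0, forall f, phi0 f <> 0 -> sorted_from (n - d) f &
    forall f, onto M.+1 f -> phi f = delta M psi f + phi0 f].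
  have [psi [phi0 [psiv phi0v _ phi0s phiE]]] := claim n (leqnn n).
  by exists psi, phi0; split=> // f /phi0s; rewrite subnn.
elim: d => [_|d IH dn].
  exists (fun=> 0), phi; split=> // [f _|f _].
    by apply/sorted_fromP => e i; rewrite subn0 leqNgt ltn_ord.
  by rewrite /delta big1 ?add0r // => P _; rewrite mulr0.
have [psi [phi0 [psiv phi0v phi0c phi0s phiE]]] := IH (ltnW dn).
have lP : (n - d.+1 < n)%N by lia.
have [|psi' [phi1 [psiv' phi1v phi1c phi1s phi0E]]] :=
  @push_right M (Ordinal lP) M.+1 0 phi0 (leq_subr _ _) phi0v phi0c.
  move=> f /phi0s; rewrite (_ : (n - d)%N = (Ordinal lP).+1) => [sf|/=]; last lia.
  by split=> //; right.
exists (fun f => psi f + psi' f), phi1; split=> // [f|f fo].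
  case: (eqVneq (psi f) 0) => [->|/eqP pn0 _]; last exact: psiv.
  by rewrite add0r; apply: psiv'.
by rewrite phiE // phi0E // deltaD addrA.
Qed.

(** ** The sorted partition into singletons *)

Definition lexlt (j i : 'I_n) := (g j < g i)%N || (g j == g i) && (j < i)%N.

Definition fsort (i : 'I_n) : nat := #|[pred j | lexlt j i]|.

Lemma lexlt_irr i : lexlt i i = false.
Proof. by rewrite /lexlt ltnn ltnn andbF. Qed.

Lemma lexlt_trans j i k : lexlt i j -> lexlt j k -> lexlt i k.
Proof.
rewrite /lexlt => /orP[ij|/andP[/eqP -> ij]] /orP[jk|/andP[/eqP <- jk]].
- by rewrite (ltn_trans ij jk).
- by rewrite ij.
- by rewrite jk.
- by rewrite eqxx (ltn_trans ij jk) orbT.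
Qed.

Lemma lexlt_total i j : i != j -> lexlt i j || lexlt j i.
Proof.
move=> ij; rewrite /lexlt; case: (ltngtP (g i) (g j)) => [_|_|/val_inj e]; rewrite ?orbT //.
rewrite e eqxx /=; case: (ltngtP i j) => [||/val_inj e'] //.
by rewrite e' eqxx in ij.
Qed.

Lemma fsort_lt i j : lexlt i j -> (fsort i < fsort j)%N.
Proof.
move=> ij; apply: proper_card; apply/properP; split.
  by apply/subsetP => k; rewrite !inE => /lexlt_trans; apply.
by exists i; rewrite inE ?lexlt_irr.
Qed.

Lemma fsort_ltE i j : (fsort i < fsort j)%N = lexlt i j.
Proof.
apply/idP/idP; last exact: fsort_lt.
case: (eqVneq i j) => [->|ij]; first by rewrite ltnn.
case/orP: (lexlt_total ij) => // /fsort_lt; lia.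
Qed.

Lemma fsort_inj : injective fsort.
Proof.
move=> i j e; apply/eqP; apply: contraT => /lexlt_total.
by rewrite -!fsort_ltE e ltnn.
Qed.

Lemma fsort_bound i : (fsort i < n)%N.
Proof.
rewrite -[X in (_ < X)%N](card_ord n); apply: proper_card; apply/properP; split.
  exact/subsetP.
by exists i => //; rewrite inE lexlt_irr.
Qed.

Lemma onto_inj f : injective f -> (forall i, f i < n)%N -> onto n f.
Proof.
move=> fi bf; apply/ontoP; split=> // P Pn.
have hi : injective (fun i => Ordinal (bf i)) by move=> i j [/fi].
have [h' _ hK] := injF_bij hi; exists (h' (Ordinal Pn)).
exact: (congr1 val (hK (Ordinal Pn))).
Qed.

Lemma inj_onto f : onto n f -> injective f.
Proof.
move=> /ontoP[oP bP].
pose h (P : 'I_n) : 'I_n := sval (cid (oP P (ltn_ord P))).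
have hK P : f (h P) = P by rewrite /h; case: (cid _).
have hi : injective h by move=> P Q e; apply: val_inj; rewrite /= -!hK e.
have [h' _ h'K] := injF_bij hi.
move=> i j; rewrite -(h'K i) -(h'K j) !hK => /val_inj e.
by rewrite e.
Qed.

Lemma valid_fsort : valid n fsort.
Proof.
rewrite /valid onto_inj /=; [|exact: fsort_inj|exact: fsort_bound].
apply/compatP => i j; rewrite leqNgt fsort_ltE /lexlt negb_or.
by rewrite -leqNgt => /andP[].
Qed.

Lemma onto_rank N f (i : 'I_n) : onto N f -> injective f -> #|[pred j | (f j < f i)%N]| = f i.
Proof.
move=> /ontoP[oP bP] fi; rewrite cardE -(size_map f) -[RHS](size_iota 0).
apply/perm_size/uniq_perm; rewrite ?iota_uniq ?map_inj_uniq ?enum_uniq // => P.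
rewrite mem_iota add0n; apply/mapP/idP => [[j]|Pi].
  by rewrite mem_enum inE => jP ->.
have [j fj] := oP P (ltn_trans Pi (bP i)); exists j => //.
by rewrite mem_enum inE fj.
Qed.

Lemma valid_bound N f : valid N f -> (N <= n)%N.
Proof.
move=> /andP[/ontoP[oP bP] _].
pose h (P : 'I_N) : 'I_n := sval (cid (oP P (ltn_ord P))).
have hK P : f (h P) = P by rewrite /h; case: (cid _).
have hi : injective h by move=> P Q e; apply: val_inj; rewrite /= -!hK e.
by have := leq_card h hi; rewrite !card_ord.
Qed.

Lemma sorted_fsort N f : valid N f -> sorted_from 0 f -> N = n /\ f = fsort.
Proof.
move=> /andP[fo fc] /sorted_fromP s; have fc' := fc; move: fc' => /compatP c.
have finj : injective f.
  move=> i j e; apply/eqP; apply: contraT => ij; have gij := compat_eq fc e.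
  have ji : j != i by rewrite eq_sym.
  have := s i j isT ji (esym gij) (eq_leq e); have := s j i isT ij gij (eq_leq (esym e)).
  by lia.
have ltE i j : (f i < f j)%N = lexlt i j.
  have imp u v : (f u < f v)%N -> lexlt u v.
    move=> uv; rewrite /lexlt; have := c u v (ltnW uv); rewrite leq_eqVlt.
    case/orP=> [/eqP/val_inj e|->//]; rewrite e eqxx ltnn /=.
    by apply: s; rewrite ?(ltnW uv) //; apply: contraTneq uv => ->; rewrite ltnn.
  apply/idP/idP; first exact: imp.
  move=> ij; case: (ltngtP (f i) (f j)) => // [/imp ji|/finj e].
    by have := lexlt_trans ij ji; rewrite lexlt_irr.
  by rewrite e lexlt_irr in ij.
have [oP bP] := ontoP _ _ fo; split; last first.
  apply/funext => i; rewrite -(onto_rank i fo finj) /fsort; apply: eq_card => j.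
  by rewrite !inE ltE.
apply/eqP; rewrite eqn_leq (@valid_bound N f) /=; last by rewrite /valid fo.
have hi : injective (fun i => Ordinal (bP i)) by move=> i j [/finj].
by have := leq_card _ hi; rewrite !card_ord.
Qed.

Lemma sorted_from_fsort : sorted_from 0 fsort.
Proof.
apply/sorted_fromP => e i _ ie gie; rewrite leq_eqVlt => /orP[/eqP/fsort_inj ei|].
  by rewrite ei eqxx in ie.
by rewrite fsort_ltE /lexlt gie ltnn eqxx.
Qed.

(** A sorted partition consists of singletons, so there is none with fewer than [n]
    blocks. *)
Lemma exact_low N phi : (N < n)%N -> cochain N phi -> cocycle_on N phi ->
  exists psi, cochain N.-1 psi /\ forall f, valid N f -> phi f = delta N.-1 psi f.
Proof.
case: N => [|M] Nn phiv phic.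
  exists (fun=> 0); split=> // f /andP[/ontoP[_ /(_ (Ordinal Nn))]].
  by rewrite ltn0.
have [psi [phi0 [psiv phi0v phi0s phiE]]] := sort_cocycle phiv phic.
exists psi; split=> // f /andP[fo _]; rewrite phiE //.
case: (eqVneq (phi0 f) 0) => [->|/eqP n0]; first by rewrite addr0.
by have [Mn _] := sorted_fsort (phi0v _ n0) (phi0s _ n0); rewrite Mn ltnn in Nn.
Qed.

(** ** The top degree *)

Definition nsgn f : int := sgf (fun i : 'I_n => (f i)%:Z).

(** The functional that detects the top cohomology: the sum over all partitions into
    singletons, with the signs of the orders that they define. *)
Definition top_sum phi : int :=
  \sum_(f : {ffun 'I_n -> 'I_n}) nsgn (fun i => f i) * phi (fun i => f i).

Lemma nsgn_inj f : nsgn f <> 0 -> injective f.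
Proof.
move=> fn0 i j e; apply/eqP; apply: contra_notT fn0 => ij.
wlog ltij : i j e ij / (i < j)%N.
  move=> h; case: (ltngtP i j) => [|ji|/val_inj e']; first exact: h e ij.
    by apply: (h j i); rewrite // eq_sym.
  by rewrite e' eqxx in ij.
by rewrite /nsgn /sgf (bigD1 i) //= (bigD1 j) //= e subrr sgr0 !mul0r.
Qed.

Lemma nsgn_fsort : nsgn fsort * nsgn fsort = 1.
Proof.
rewrite /nsgn /sgf -big_split big1 // => i _; rewrite -big_split big1 //= => j ij.
rewrite -sgrM -expr2 gtr0_sg // exprn_even_gt0 //= subr_eq0 eqz_nat.
by apply: contraTneq ij => /fsort_inj ->; rewrite ltnn.
Qed.

Lemma nsgn_swap (f : {ffun 'I_n -> 'I_n}) (p q : 'I_n) : p != q ->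
  nsgn (fun i => tperm p q (f i)) = - nsgn (fun i => f i).
Proof.
move=> pq; have [fi|nfi] := pselect (injective f); last first.
  rewrite [in RHS](_ : nsgn _ = 0); last first.
    by apply/eqP; apply: contra_notT nfi => /eqP/nsgn_inj fi i j e; apply: fi; rewrite e.
  rewrite oppr0; apply/eqP; apply: contra_notT nfi => /eqP/nsgn_inj fi i j e.
  by apply: fi; rewrite e.
pose u := (perm fi * tperm p q * (perm fi)^-1)%g.
have -> : (fun i => tperm p q (f i) : nat) = (fun i => f (u i) : nat).
  apply/funext => i; have : perm fi (u i) = tperm p q (perm fi i) by rewrite /u !permM permKV.
  by rewrite [perm fi (u i)]permE [perm fi i]permE => ->.
rewrite /nsgn (sgf_perm u (fun i => (f i : nat)%:Z)) /u !odd_permM odd_permV odd_tperm pq.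
by rewrite addbAC addbb addFb expr1 mulN1r.
Qed.

(** Exchanging the numbers [P] and [P.+1] does not change the partition in which
    they are merged, and reverses the sign. *)
Lemma top_sum_delta M psi : n = M.+1 -> top_sum (delta M psi) = 0.
Proof.
move=> nM; rewrite /top_sum.
rewrite (eq_bigr (fun f : {ffun 'I_n -> 'I_n} => \sum_(P < M)
    (-1) ^+ P * (nsgn (fun i => f i) * psi (fuse P (fun i => f i))))); last first.
  by move=> f _; rewrite mulr_sumr; apply: eq_bigr => P _; rewrite mulrCA.
rewrite exchange_big big1 //= => P _; rewrite -mulr_sumr.
have p1 : (P < n)%N by rewrite nM ltnS ltnW.
have p2 : (P.+1 < n)%N by rewrite nM ltnS.
(* The involution [f |-> t \o f] of the index set preserves the argument of [psi]. *)
pose t := tperm (Ordinal p1) (Ordinal p2).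
set S := \sum_f _; suff : S = - S.
  by move=> /eqP; rewrite -addr_eq0 -mulr2n mulrn_eq0 /= => /eqP ->; rewrite mulr0.
have ti : injective (fun f : {ffun 'I_n -> 'I_n} => [ffun i => t (f i)]).
  move=> f f' /ffunP e; apply/ffunP => i; apply: (@perm_inj _ t).
  by have := e i; rewrite !ffunE.
rewrite [LHS](reindex_inj ti) -sumrN; apply: eq_bigr => f _ /=.
have -> : (fun i => [ffun i => t (f i)] i : nat) = (fun i => t (f i) : nat).
  by apply/funext => i; rewrite ffunE.
rewrite nsgn_swap ?mulNr; last by rewrite -val_eqE /= neq_ltn ltnSn.
congr (- (_ * psi _)); apply/funext => i; rewrite /fuse !muE /t.
by case: tpermP => [->|->|] //=; rewrite ?ltnn ?ltnSn.
Qed.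

Lemma top_sum_single phi : (forall f, phi f <> 0 -> f = fsort) ->
  top_sum phi = nsgn fsort * phi fsort.
Proof.
move=> single; pose f0 : {ffun 'I_n -> 'I_n} := [ffun i => Ordinal (fsort_bound i)].
have f0E : (fun i => f0 i : nat) = fsort by apply/funext => i; rewrite ffunE.
rewrite /top_sum (bigD1 f0) // f0E big1 => [|f ff0]; first exact: addr0.
case: (eqVneq (phi (fun i => f i : nat)) 0) => [->|/eqP/single fE]; first exact: mulr0.
by case/eqP: ff0; apply/ffunP => i; apply/val_inj; rewrite ffunE /= -fE.
Qed.

Lemma exact_top phi : cochain n phi -> cocycle_on n phi -> top_sum phi = 0 ->
  exists psi, cochain n.-1 psi /\ forall f, valid n f -> phi f = delta n.-1 psi f.
Proof.
have [n0|npos] := posnP n.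
  move=> _ _ t0; exists (fun=> 0); split=> // f _.
  have no (i : 'I_n) : False by move: (ltn_ord i); rewrite {2}n0.
  move: t0; rewrite /top_sum (bigD1 [ffun i => i]) //= big1 => [|h /eqP[]]; last first.
    by apply/ffunP => i; case: (no i).
  rewrite /nsgn /sgf big1 => [|i]; last by case: (no i).
  rewrite addr0 mul1r (_ : (fun i => _) = f) => [->|]; last by apply/funext => i; case: (no i).
  by rewrite /delta big1 // => P _; rewrite mulr0.
move=> phiv phic t0; have [M nM] : exists M, n = M.+1 by exists n.-1; rewrite prednK.
have nM' : n.-1 = M by rewrite nM.
have phiv' : cochain M.+1 phi by rewrite -nM.
have phic' : cocycle_on M.+1 phi by rewrite -nM.
rewrite nM'; have [psi [phi0 [psiv phi0v phi0s phiE]]] := sort_cocycle phiv' phic'.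
have E f : injective (f : 'I_n -> nat) -> (forall i, f i < n)%N ->
    phi f = delta M psi f + phi0 f.
  by move=> fi bf; apply: phiE; rewrite -nM; apply: onto_inj.
exists psi; split=> // f /andP[fo _]; rewrite phiE -?nM //.
case: (eqVneq (phi0 f) 0) => [->|/eqP pn0]; first by rewrite addr0.
have [_ fE] := sorted_fsort (phi0v _ pn0) (phi0s _ pn0).
case: pn0; rewrite fE.
have : top_sum phi = top_sum (delta M psi) + top_sum phi0.
  rewrite /top_sum -big_split; apply: eq_bigr => h _ /=; rewrite -mulrDr.
  case: (eqVneq (nsgn (fun i => h i)) 0) => [->|/eqP/nsgn_inj hi]; first by rewrite !mul0r.
  by rewrite E // => i.
rewrite t0 top_sum_delta // add0r top_sum_single => [/esym e|h hn0]; last first.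
  exact: (proj2 (sorted_fsort (phi0v _ hn0) (phi0s _ hn0))).
by rewrite -[LHS]mul1r -nsgn_fsort -mulrA e mulr0.
Qed.

End Sorting.

(** ** Invariant cochains *)

Section Invariant.
Variables (m n : nat).
Implicit Types (g : 'I_n -> 'I_m) (f : 'I_n -> nat).

Lemma onto_perm N (t : 'S_n) f : onto N (f \o t) = onto N f.
Proof.
apply/ontoP/ontoP => -[oP bP]; split=> [P /oP [i <-]|i]; last 1 first.
- exact: bP.
- by exists (t i).
- by have := bP ((t^-1)%g i); rewrite /= permKV.
by exists ((t^-1)%g i); rewrite /= permKV.
Qed.

Lemma valid_perm N (t : 'S_n) g f : valid (g \o t) N (f \o t) = valid g N f.
Proof.
rewrite /valid onto_perm; congr (_ && _).
apply/compatP/compatP => c i j; last exact: c.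
by have := c ((t^-1)%g i) ((t^-1)%g j); rewrite /= !permKV.
Qed.

Definition fibre g i := #|[pred k | g k == g i]|.

(** The first fibre with at least two elements is the one in which invariant cochains
    get contracted. An element of its first block is only determined up to a
    permutation that fixes the partition, which invariance makes harmless. *)
Definition selected g f l := [&& (1 < fibre g l)%N,
  [forall i, (g i < g l)%N ==> (fibre g i <= 1)%N] &
  [forall i, (g i == g l) ==> (f l <= f i)%N]].

Lemma selectedP g f l : reflect [/\ (1 < fibre g l)%N,
    forall i, (g i < g l)%N -> (fibre g i <= 1)%N &
    forall i, g i = g l -> (f l <= f i)%N] (selected g f l).
Proof.
apply: (iffP and3P) => -[a b c]; split=> //.
- by move=> i; move/implyP: (forallP b i).
- by move=> i e; move/implyP: (forallP c i); apply; apply/eqP.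
- by apply/forallP => i; apply/implyP/b.
- by apply/forallP => i; apply/implyP => /eqP/c.
Qed.

Lemma selected_unique g f l l' : selected g f l -> selected g f l' -> g l = g l' /\ f l = f l'.
Proof.
move=> /selectedP[a b c] /selectedP[a' b' c'].
have gl : g l = g l'.
  case: (ltngtP (g l) (g l')) => [/b'|/b|/val_inj //]; lia.
by split=> //; apply/eqP; rewrite eqn_leq c ?c'.
Qed.

Lemma selected_exists g f k : (1 < fibre g k)%N -> exists l, selected g f l.
Proof.
move=> fk; pose j := [arg min_(i < k | (1 < fibre g i)%N) (g i : nat)].
have [fj jmin] : (1 < fibre g j)%N /\ forall i, (1 < fibre g i)%N -> (g j <= g i)%N.
  by rewrite /j; case: arg_minnP.
pose l := [arg min_(i < j | g i == g j) (f i)].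
have [/eqP gl lmin] : g l == g j /\ forall i, g i == g j -> (f l <= f i)%N.
  by rewrite /l; case: arg_minnP.
have fib i : g i = g j -> fibre g i = fibre g j by rewrite /fibre => ->.
exists l; apply/selectedP; split=> [|i|i gi]; first by rewrite fib.
  by rewrite gl ltnNge; apply: contraR; rewrite -ltnNge => /jmin.
by apply: lmin; rewrite gi gl.
Qed.

Lemma selected_mono g f f' l : (forall i, f l <= f i -> f' l <= f' i)%N ->
  selected g f l -> selected g f' l.
Proof. by move=> ff /selectedP[a b c]; apply/selectedP; split=> // i /c /ff. Qed.

Lemma fibre_gt1 g a b : a != b -> g a = g b -> (1 < fibre g a)%N.
Proof.
by move=> ab gab; rewrite /fibre (cardD1 a) inE eqxx (cardD1 b) !inE eq_sym ab -gab eqxx.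
Qed.

Lemma compat_fuse_left N g f l P : onto N f -> compat g f -> selected g f l ->
  (P < f l)%N -> compat g (fuse P f) = false.
Proof.
move=> /ontoP[oP bP] /compatP c /selectedP[_ lt1 lmin] Pl; apply/negP => cm.
have := bP l => lN; have [|a fa] := oP P; first lia.
have [|b fb] := oP P.+1; first lia.
have gab : g a = g b by apply: compat_eq cm _; rewrite /fuse fa fb !muE ltnn ltnSn.
have ab : a != b by apply/eqP => e; move: fa; rewrite e fb; lia.
have := c a l; rewrite fa (ltnW Pl) leq_eqVlt => /(_ isT) /orP[/eqP/val_inj/lmin|/lt1].
  by rewrite fa; lia.
by rewrite leqNgt (fibre_gt1 ab gab).
Qed.

Variables (M : nat) (phi : ('I_n -> 'I_m) -> ('I_n -> nat) -> int).
Hypothesis phi_inv : forall (s : 'S_n) g f, phi (g \o s) (f \o s) = phi g f.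

Definition nonsingle f l := [exists i, (i != l) && (f i == f l)].

Definition icontract g f : int :=
  if valid g M f then
    if [pick l | selected g f l && nonsingle f l] is Some l
    then (-1) ^+ f l * phi g (split_off l f) else 0
  else 0.

Lemma split_off_tperm f l l' : f l = f l' ->
  split_off l' f = split_off l f \o tperm l l'.
Proof.
move=> fll; apply/funext => i; rewrite /split_off /= fll; case: tpermP => [->|->|/eqP/negPf il /eqP/negPf il'].
- by rewrite [l' == l]eq_sym; case: eqP => // _; rewrite fll leqnn.
- by rewrite !eqxx.
- by rewrite il il'.
Qed.

Lemma icontractE g f l : valid g M f -> selected g f l ->
  icontract g f = if nonsingle f l then (-1) ^+ f l * phi g (split_off l f) else 0.
Proof.
move=> vf sl; rewrite /icontract vf; case: pickP => [l' /andP[sl' nl']|none].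
  have [gl fl] := selected_unique sl sl'.
  have -> : nonsingle f l.
    case/existsP: nl' => i /andP[il' /eqP fi]; apply/existsP.
    case: (eqVneq i l) => [e|il]; last by exists i; rewrite il fi fl eqxx.
    by exists l'; rewrite fl eqxx andbT eq_sym -e.
  rewrite (split_off_tperm fl) -{1}(_ : g \o tperm l l' = g) ?phi_inv ?fl //.
  by apply/funext => i /=; case: tpermP => [->|->|].
by have := none l; rewrite sl /= => ->.
Qed.

Lemma icontract_inv (s : 'S_n) g f : icontract (g \o s) (f \o s) = icontract g f.
Proof.
have fibE i : fibre (g \o s) i = fibre g (s i).
  rewrite /fibre -!sum1_card [RHS](reindex_inj (@perm_inj _ s)).
  by apply: eq_bigl => k; rewrite !inE.
have selE l : selected (g \o s) (f \o s) l = selected g f (s l).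
  apply/selectedP/selectedP => -[]; rewrite fibE => a b c; split=> // i.
  - by move=> gi; rewrite -[i](permKV s) -fibE; apply: b; rewrite /= permKV.
  - by move=> gi; have := c ((s^-1)%g i); rewrite /= permKV; apply.
  - by rewrite fibE; apply: b.
  - exact: c.
have vE := valid_perm M s g f.
have [vf|nvf] := boolP (valid g M f); last by rewrite /icontract vE (negPf nvf).
have vf' : valid (g \o s) M (f \o s) by rewrite vE.
have nsE l : nonsingle (f \o s) l = nonsingle f (s l).
  apply/existsP/existsP => -[i /andP[il fi]].
    by exists (s i); rewrite (inj_eq perm_inj) il.
  by exists ((s^-1)%g i); rewrite /= permKV fi andbT (canF_eq (permKV s)).
case: (pselect (exists l, selected g f l)) => [[l sl]|nsl].
  have sl' : selected (g \o s) (f \o s) ((s^-1)%g l) by rewrite selE permKV.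
  rewrite (icontractE vf sl) (icontractE vf' sl') nsE permKV /= permKV.
  rewrite (_ : split_off _ (f \o s) = split_off l f \o s) ?phi_inv //.
  by apply/funext => i; rewrite /split_off /= permKV (canF_eq (permK s)).
rewrite /icontract vf vf'; case: pickP => [l /andP[]|_].
  by rewrite selE => sl; case: nsl; exists (s l).
by case: pickP => [l /andP[sl]|//]; case: nsl; exists l.
Qed.

Lemma icontract_valid g f : icontract g f <> 0 -> valid g M f.
Proof. by rewrite /icontract; case: ifP. Qed.

Variable g : 'I_n -> 'I_m.
Hypothesis phi_cochain : cochain g M.+1 (phi g).
Hypothesis phi_cocycle : cocycle_on g M.+1 (phi g).

(** All the fibres before the selected one are singletons, so nothing can be merged to
    the left of [l], and [l] stays in the first block of its fibre when blocks
    on its right are merged. *)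
Lemma icontract_homotopy k f : (1 < fibre g k)%N -> valid g M.+1 f ->
  phi g f = delta M (icontract g) f.
Proof.
move=> fk vf; have /andP[fo fc] := vf; have [oP bP] := ontoP _ _ fo.
have [l sl] := selected_exists f fk; have [l2 llt lmin] := selectedP _ _ _ sl.
have ql := bP l.
have left P : (P < f l)%N -> icontract g (fuse P f) = 0.
  by move=> Pl; rewrite /icontract /valid (compat_fuse_left fo fc sl Pl) andbF.
have mll P : (f l <= P)%N -> fuse P f l = f l by move=> lP; rewrite /fuse muE ltnNge lP.
have sm P : (f l <= P)%N -> selected g (fuse P f) l.
  by move=> lP; apply: selected_mono sl => i; rewrite mll // /fuse muE; case: ifP; lia.
(* If [l] shares its block, the cocycle condition at the partition where it is
   split off applies; otherwise only the merge of its block with the next one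
   contributes. *)
have [ns|nns] := boolP (nonsingle f l).
  have [i /andP[il /eqP fil]] := existsP ns.
  have os : onto M.+2 (split_off l f) by apply: onto_split_off fo; exists i.
  have cs := compat_split_off l fc.
  have := phi_cocycle (introT andP (conj os cs)).
  rewrite /delta (sum_from (b := fun P => (-1) ^+ P * phi g (fuse P (split_off l f))) ql).
    rewrite fuse_split_off => /eqP; rewrite addr_eq0 => /eqP e.
    have e' : phi g f = (-1) ^+ f l * ((-1) ^+ f l * phi g f).
      by rewrite mulrA -expr2 sqrr_sign mul1r.
    rewrite [LHS]e' e mulrN -mulNr mulr_sumr.
    rewrite big_mkcond; apply: eq_bigr => P _; case: ifPn => Pl; last first.
      by rewrite left ?mulr0 // ltnNge.
    rewrite exprS mulN1r !mulNr mulrN opprK mulrCA; congr (_ * _).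
    rewrite fuse_split_off_gt //.
    have gil : g i = g l by apply: compat_eq fc fil.
    have mil : fuse P f i = fuse P f l by rewrite /fuse fil.
    have [vm|nvm] := boolP (valid g M (fuse P f)).
      rewrite (icontractE vm (sm P Pl)) mll // ifT //.
      by apply/existsP; exists i; rewrite il mil eqxx.
    rewrite /icontract (negPf nvm).
    case: (eqVneq (phi g (split_off l (fuse P f))) 0) => [->|/eqP/phi_cochain]; first by rewrite mulr0.
    case/andP => _ /(compat_of_split il mil gil) cm; case/negP: nvm.
    by rewrite /valid cm onto_fuse.
  move=> P Pl; case: (eqVneq (phi g (fuse P (split_off l f))) 0) => [->|/eqP/phi_cochain].
    by rewrite mulr0.
  case/andP => _; have sl' : selected g (split_off l f) l.
    apply: selected_mono sl => j; rewrite /split_off eqxx; case: eqP => [->//|_].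
    by move=> lj; rewrite (leq_trans lj) // leq_addr.
  by rewrite (compat_fuse_left os cs sl') // /split_off eqxx.
have single i : f i = f l -> i = l.
  move=> fi; apply/eqP; apply: contraR nns => il; apply/existsP; exists i.
  by rewrite il fi eqxx.
have [i il gil] : exists2 i, i != l & g i = g l.
  move: l2; rewrite /fibre (cardD1 l) inE eqxx add1n ltnS => /card_gt0P[i].
  by rewrite !inE => /andP[il /eqP gi]; exists i.
have fli : (f l < f i)%N.
  by rewrite ltn_neqAle lmin // andbT eq_sym; apply: contra il => /eqP/single ->.
have lM : (f l < M)%N by have := bP i; lia.
rewrite /delta (bigD1 (Ordinal lM)) //= big1 => [|P Pl]; last first.
  case: (ltngtP P (f l)) => Pl'; last by rewrite -val_eqE /= Pl' eqxx in Pl.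
    by rewrite left ?mulr0.
  have [vm|nvm] := boolP (valid g M (fuse P f)); last by rewrite /icontract (negPf nvm) mulr0.
  rewrite (icontractE vm (sm P (ltnW Pl'))) ifN ?mulr0 //.
  apply/existsP => -[j /andP[jl /eqP]]; rewrite /fuse !muE => fjl; case/eqP: jl; apply: single.
  by move: fjl; do !case: ifP; lia.
have [j fj] := oP (f l).+1 (leq_ltn_trans fli (bP i)).
have gj e : f e = (f l).+1 -> g e = g l.
  move=> fe; have /compatP c := fc; apply/val_inj/eqP; rewrite /= eqn_leq.
  by rewrite (c l e) ?fe // andbT -gil c // fe.
have vm : valid g M (fuse (f l) f).
  rewrite /valid onto_fuse //=; apply/compatP => a b; rewrite /fuse !muE => ab.
  have /compatP c := fc; case: (leqP (f a) (f b)) => [|ba]; first exact: c.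
  have fb : f b = f l by move: ab ba; do !case: ifP; lia.
  have fa : f a = (f l).+1 by move: ab ba; do !case: ifP; lia.
  by rewrite (gj a fa) (single b fb).
rewrite addr0 (icontractE vm (sm _ (leqnn _))) mll // split_off_fuse // ifT.
  by rewrite mulrA -expr2 sqrr_sign mul1r.
apply/existsP; exists j; rewrite mll // /fuse muE fj ltnSn eqxx andbT.
by apply/eqP => e; move: fj; rewrite e; lia.
Qed.

End Invariant.

(** * Shapes and positions *)

Section Positions.
Variable m : nat.
Implicit Types (c : {ffun 'I_m -> nat}) (j l : 'I_m).

Definition offset c j : nat := (\sum_(l < m | l < j) c l)%N.

Definition pos c j o : nat := (offset c j + o)%N.

Lemma offset_next c j l : (j < l)%N -> (offset c j + c j <= offset c l)%N.
Proof.
move=> jl; rewrite /offset [X in (_ <= X)%N](bigD1 j) //= addnC leq_add2l.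
rewrite [X in (X <= _)%N]big_mkcond [X in (_ <= X)%N]big_mkcond.
apply: leq_sum => k _; case: ifP => // kj.
by rewrite (ltn_trans kj jl) ifT // -val_eqE /=; apply/eqP; lia.
Qed.

Lemma offset_total c j : (offset c j + c j <= \sum_l c l)%N.
Proof.
rewrite /offset [X in (_ <= X)%N](bigD1 j) //= addnC leq_add2l.
rewrite [X in (X <= _)%N]big_mkcond [X in (_ <= X)%N]big_mkcond.
apply: leq_sum => k _; case: ifP => // kj.
by rewrite ifT // -val_eqE /=; apply/eqP; lia.
Qed.

Lemma pos_lt c j o : (o < c j)%N -> (pos c j o < \sum_l c l)%N.
Proof. by move=> oc; have := offset_total c j; rewrite /pos; lia. Qed.

Lemma pos_le c j l o o' : (o < c j)%N -> (o' < c l)%N ->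
  (pos c j o <= pos c l o')%N -> (j <= l)%N.
Proof.
move=> oc oc'; rewrite /pos; case: (leqP j l) => // lj.
by have := offset_next c lj; lia.
Qed.

Lemma pos_inj c j l o o' : (o < c j)%N -> (o' < c l)%N -> pos c j o = pos c l o' ->
  j = l /\ o = o'.
Proof.
move=> oc oc' e; have jl : j = l.
  apply/val_inj/eqP; rewrite /= eqn_leq (pos_le oc oc') ?e // (pos_le oc' oc) // e.
  by [].
by subst l; split=> //; apply/eqP; rewrite -(eqn_add2l (offset c j)); apply/eqP.
Qed.

Lemma offset_sumn c j : offset c j = sumn (take j (codom c)).
Proof.
rewrite sumnE (big_nth 0%N) size_take size_codom card_ord ltn_ord.
rewrite (big_nat_widen _ _ m) ?(ltnW (ltn_ord j)) // big_mkord.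
apply: eq_big => l; first by rewrite andTb.
by move=> lj; rewrite nth_take // nth_codom_ord.
Qed.

Lemma posE c j o : pos c j o = flatten_index (codom c) j o.
Proof. by rewrite /pos offset_sumn. Qed.

Lemma pos_exists c P : (P < \sum_l c l)%N -> exists j o, (o < c j)%N /\ P = pos c j o.
Proof.
rewrite -sumn_codom => PN; have jm := reshape_indexP PN; rewrite size_codom card_ord in jm.
exists (Ordinal jm), (reshape_offset (codom c) P); split.
  by rewrite -(nth_codom_ord 0%N c (Ordinal jm)); apply: reshape_offsetP.
by rewrite posE reshape_indexK.
Qed.

Variable N : nat.

Definition slot_of c (cN : (\sum_l c l = N)%N) (P : 'I_N) : 'I_m :=
  sval (cid (@pos_exists c P (eq_ind_r (fun k => P < k)%N (ltn_ord P) cN))).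

Lemma slot_ofP c (cN : (\sum_l c l = N)%N) (P : 'I_N) :
  exists2 o, (o < c (slot_of cN P))%N & P = pos c (slot_of cN P) o :> nat.
Proof. by rewrite /slot_of; case: (cid _) => j /= [o [oc e]]; exists o. Qed.

Lemma slot_of_pos c (cN : (\sum_l c l = N)%N) (P : 'I_N) j o :
  (o < c j)%N -> P = pos c j o :> nat -> slot_of cN P = j.
Proof.
move=> oc e; have [o' oc' e'] := slot_ofP cN P.
by have [] := pos_inj oc' oc (etrans (esym e') e).
Qed.

Lemma big_pos (R : nmodType) c (F : nat -> R) : (\sum_l c l = N)%N ->
  \sum_(P < N) F P = \sum_j \sum_(o < c j) F (pos c j o).
Proof.
move=> cN; rewrite (partition_big (slot_of cN) predT) //=; apply: eq_bigr => j _.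
have inj P : (slot_of cN P == j) = (offset c j <= P < offset c j + c j)%N.
  apply/eqP/andP => [<-|[lo hi]].
    by have [o oc ->] := slot_ofP cN P; rewrite /pos leq_addr ltn_add2l.
  apply: (@slot_of_pos _ _ _ _ (P - offset c j)%N); first by lia.
  by rewrite /pos subnKC.
rewrite (eq_bigl _ _ inj) -(big_mkord (fun P => offset c j <= P < offset c j + c j)%N F).
have le : (offset c j + c j <= N)%N by rewrite -cN offset_total.
rewrite (eq_bigl (fun P => (offset c j <= P) && (P < offset c j + c j))%N) //.
rewrite -(big_nat_widen 0 _ N (fun P => offset c j <= P)%N) //.
rewrite -(big_nat_widenl (offset c j) 0 _ predT) // -{1}[offset c j]add0n big_addn addKn.
by rewrite big_mkord; apply: eq_bigr => o _; rewrite addnC.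
Qed.

(** ** Labels of the blocks of an ordered partition *)

Variable n : nat.
Implicit Types (g : 'I_n -> 'I_m) (f : 'I_n -> nat).

(** The number of blocks that lie in each fibre of [g], which is the shape of the
    generic word to which the partition belongs. *)
Definition blocks g f : {ffun 'I_m -> nat} :=
  [ffun j => #|[pred P : 'I_N | [exists i, (f i == P) && (g i == j)]]|].

(** The label of an element is the word in which the letter with its number
    occurs. *)
Definition labelled c g f := forall i, exists2 o, (o < c (g i))%N & f i = pos c (g i) o.

Definition surjective_on g := [forall j, exists i, g i == j].

Lemma labelled_exists c f : (\sum_l c l = N)%N -> (forall i, f i < N)%N ->
  exists g : {ffun 'I_n -> 'I_m}, labelled c g f.
Proof.
move=> cN bf; exists [ffun i => slot_of cN (Ordinal (bf i))] => i; rewrite ffunE.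
by have [o oc e] := slot_ofP cN (Ordinal (bf i)); exists o.
Qed.

Lemma labelled_unique c g g' f : labelled c g f -> labelled c g' f -> g =1 g'.
Proof.
move=> gl gl' i; have [o oc e] := gl i; have [o' oc' e'] := gl' i.
by have [] := pos_inj oc oc' (etrans (esym e) e').
Qed.

(** As the letters are numbered consecutively through all the words, the labels are
    weakly increasing. So a shape together with a map onto the letters is the same
    thing as a surjection with a refinement of its ordered partition into fibres;
    [valid_labelled] is the converse. *)
Lemma labelled_valid c g f : goodshape N c -> onto N f -> labelled c g f ->
  [/\ valid g N f, surjective_on g & blocks g f = c].
Proof.
case/andP => /eqP cN /forallP cpos fo gl; have [oP bP] := ontoP _ _ fo.
have lab i j o : (o < c j)%N -> f i = pos c j o -> g i = j.
  by move=> oc e; have [o' oc' e'] := gl i; have [] := pos_inj oc' oc (etrans (esym e') e).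
split.
- rewrite /valid fo; apply/compatP => i j ij.
  have [o oc e] := gl i; have [o' oc' e'] := gl j.
  by apply: (pos_le oc oc'); rewrite -e -e'.
- apply/forallP => j; have [|i fi] := oP (pos c j 0); first by rewrite -cN pos_lt.
  by apply/existsP; exists i; rewrite (lab i j 0%N).
apply/ffunP => j; rewrite ffunE -sum1_card big_mkcond /=.
rewrite (eq_bigr (fun P : 'I_N => (slot_of cN P == j : nat))); last first.
  move=> P _; have [i fi] := oP P (ltn_ord P); have [o oc e] := slot_ofP cN P.
  have gi : g i = slot_of cN P by apply: lab oc _; rewrite fi.
  rewrite -gi inE; case: eqP => [gj|gj].
    by rewrite ifT //; apply/existsP; exists i; rewrite fi gj !eqxx.
  rewrite ifF //; apply/existsP => -[k /andP[/eqP fk /eqP gk]]; case: gj.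
  by rewrite gi -gk; apply/esym/(lab k _ o); rewrite // fk.
pose F P := (if insub P is Some Q then slot_of cN Q == j : nat else 0%N).
rewrite (eq_bigr (fun P : 'I_N => F P)); last first.
  by move=> P _; rewrite /F insubT // => PN; congr (nat_of_bool (slot_of cN _ == j)); apply: val_inj.
rewrite (big_pos (c := c) F) // (bigD1 j) //= [X in (_ + X)%R]big1 ?addr0.
  rewrite (eq_bigr (fun=> 1%N)) ?sum1_card ?card_ord // => o _.
  have pN : (pos c j o < N)%N by rewrite -cN pos_lt.
  by rewrite /F insubT (@slot_of_pos _ _ _ j o) ?eqxx.
move=> l lj; rewrite big1 // => o _.
have pN : (pos c l o < N)%N by rewrite -cN pos_lt.
by rewrite /F insubT (@slot_of_pos _ _ _ l o) // (negPf lj).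
Qed.

Lemma valid_labelled g f : valid g N f -> surjective_on g ->
  goodshape N (blocks g f) /\ labelled (blocks g f) g f.
Proof.
move=> /andP[fo fc] /forallP gs; have [oP bP] := ontoP _ _ fo.
pose h (P : 'I_N) : 'I_n := sval (cid (oP P (ltn_ord P))).
have hK P : f (h P) = P by rewrite /h; case: (cid _).
pose lab P := g (h P).
have labE i : lab (Ordinal (bP i)) = g i by apply: compat_eq fc _; rewrite hK.
have bE j : blocks g f j = #|[pred P | lab P == j]|.
  rewrite ffunE; apply: eq_card => P; rewrite !inE; apply/existsP/idP.
    move=> [i /andP[/eqP fi /eqP <-]]; rewrite -labE; apply/eqP; congr lab.
    by apply: val_inj; rewrite /= fi.
  by move=> lP; exists (h P); rewrite hK eqxx.
have offE (Q : pred 'I_m) : (\sum_(l | Q l) blocks g f l = #|[pred P | Q (lab P)]|)%N.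
  rewrite -sum1_card (partition_big lab Q) //=; apply: eq_bigr => l Ql.
  rewrite bE -sum1_card; apply: eq_bigl => P; rewrite !inE.
  by case: eqP => [->|_]; rewrite ?Ql ?andbT ?andbF.
have /compatP c := fc; split.
  apply/andP; split; first by rewrite offE -[X in _ == X]card_ord; apply/eqP/eq_card.
  apply/forallP => j; have /existsP[i /eqP gi] := gs j.
  by rewrite bE; apply/card_gt0P; exists (Ordinal (bP i)); rewrite inE labE gi.
move=> i; have lo : (offset (blocks g f) (g i) <= f i)%N.
  rewrite /offset offE; apply: (@leq_trans #|[pred P : 'I_N | (P < f i)%N]|).
    apply: subset_leq_card; apply/subsetP => P; rewrite !inE => lP.
    by rewrite ltnNge; apply: contraL lP => fP; rewrite -leqNgt; apply: c; rewrite hK.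
  rewrite -sum1_card -(big_mkord (fun P => P < f i)%N (fun=> 1%N)).
  rewrite -(big_nat_widen 0 (f i) N predT) ?(ltnW (bP i)) //.
  by rewrite big_const_nat iter_addn; lia.
have hi : (f i < offset (blocks g f) (g i) + blocks g f (g i))%N.
  have -> : (offset (blocks g f) (g i) + blocks g f (g i) =
      \sum_(l : 'I_m | (l <= g i)%N) blocks g f l)%N.
    rewrite [RHS](bigD1 (g i)) //= addnC /offset; congr (_ + _)%N.
    by apply: eq_bigl => l; rewrite -val_eqE /= ltn_neqAle andbC.
  rewrite offE; apply: (@leq_trans #|[pred P : 'I_N | (P < (f i).+1)%N]|).
    rewrite -sum1_card -(big_mkord (fun P => P < (f i).+1)%N (fun=> 1%N)).
    rewrite -(big_nat_widen 0 (f i).+1 N predT) //.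
    by rewrite big_const_nat iter_addn; lia.
  apply: subset_leq_card; apply/subsetP => P; rewrite !inE ltnS => fP.
  by apply: c; rewrite hK.
by exists (f i - offset (blocks g f) (g i))%N; [lia | rewrite /pos subnKC].
Qed.

End Positions.

(** * Coefficients of tensors *)

Section MultilinearMaps.
Variables (n : nat) (A : zmodType).
Implicit Types x : {ffun 'I_n -> A}.

Section Product.
Variable L : 'I_n -> {additive A -> int}.

Fact prodL_subproof z : multilinear_rel z ->
  zlift (fun x : {ffun 'I_n -> A} => \prod_i L i (x i)) z = 0.
Proof.
move=> [x [i [a [b ->]]]]; rewrite !raddfB /= !zliftU.
have e c : \prod_j L j (upd x i c j) = L i c * \prod_(j | j != i) L j (x j).
  rewrite (bigD1 i) //= ffunE eqxx; congr (_ * _); apply: eq_bigr => j /negPf ji.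
  by rewrite ffunE ji.
by rewrite !e raddfD mulrDl [X in X - _ - _]addrC addrK subrr.
Qed.

Definition prodL : {additive tensor n A -> int} := zquot_lift prodL_subproof.

Lemma prodL_pure x : prodL (pure x) = \prod_i L i (x i).
Proof. exact: etrans (zquot_liftE _ _) (zliftU _ _). Qed.

End Product.

Lemma eq_prodL (L L' : 'I_n -> {additive A -> int}) :
  (forall i, L i =1 L' i) -> prodL L =1 prodL L'.
Proof.
by move=> LL; apply: tensorP => x; rewrite !prodL_pure; apply: eq_bigr => i _; rewrite LL.
Qed.

Lemma prodL0 (L : 'I_n -> {additive A -> int}) i : L i =1 (fun=> 0) -> prodL L =1 (fun=> 0).
Proof.
move=> Li; apply: (tensorP (g := \0)) => x; rewrite prodL_pure (bigD1 i) //= Li.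
by rewrite mul0r.
Qed.

End MultilinearMaps.

Lemma prodL_map n (A B : zmodType) (h : {additive A -> B}) (L : 'I_n -> {additive B -> int}) x :
  prodL L (tensor_map n h x) = prodL (fun i => L i \o h) x.
Proof.
apply: (tensorP (f := prodL L \o tensor_map n h)) => {}x.
rewrite -[LHS]/(prodL L (tensor_map n h (pure x))) tensor_mapE !prodL_pure.
apply: eq_bigr => i _.
by rewrite ffunE.
Qed.

Section Coefficients.
Variables (n N : nat).
Implicit Types (f : 'I_n -> nat) (k : {ffun 'I_n -> 'I_N}).

Definition abpure k : tensor n (ab (FG N)) := pure [ffun i => abgen (k i)].

(** Tensors of basis elements generate, one slot at a time. *)
Lemma tensor_genP (M : zmodType) (u v : {additive tensor n (ab (FG N)) -> M}) :
  (forall k, u (abpure k) = v (abpure k)) -> u =1 v.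
Proof.
move=> uv; apply: tensorP => x.
(* The entries outside [s] are already basis elements. *)
have claim (s : seq 'I_n) : forall x : {ffun 'I_n -> ab (FG N)},
    (forall i, i \notin s -> exists P, x i = abgen P) -> u (pure x) = v (pure x).
  elim: s => [|i s IH] {}x xs.
    have {}xs i : exists P, x i = abgen P by apply: xs.
    rewrite (_ : pure x = abpure [ffun i => sval (cid (xs i))]) //.
    by congr pure; apply/ffunP => i; rewrite !ffunE; case: (cid _).
  have cB : zmod_morphism (fun a => pure (upd x i a)).
    by move=> a b; apply: (addIr (pure (upd x i b))); rewrite -pureD !subrK.
  pose c : {additive ab (FG N) -> tensor n (ab (FG N))} :=
    HB.pack (fun a => pure (upd x i a)) (GRing.isZmodMorphism.Build _ _ _ cB).
  rewrite -(upd_id x i); apply: (ab_free_additiveP (f := u \o c) (g := v \o c)) => P.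
  apply: IH => j js; rewrite ffunE; case: eqP => [_|/eqP ji]; first by exists P.
  by apply: xs; rewrite inE negb_or ji.
by apply: (claim (enum 'I_n)) => i; rewrite mem_enum.
Qed.

Definition ncoord (p : nat) : {additive ab (FG N) -> int} :=
  if insub p is Some Q then @coord N Q else \0.

Lemma ncoord_gen p (Q : 'I_N) : ncoord p (abgen Q) = (Q == p :> nat)%:R.
Proof.
rewrite /ncoord; case: insubP => [R _ Rp|]; last first.
  by case: eqP => // <-; rewrite ltn_ord.
by rewrite coord_gen -Rp.
Qed.

(** The coefficient at a basis tensor. The indices are natural numbers, those out of
    range giving 0, so that they can be changed by [fuse] and [split_off] without
    a change of type. *)
Definition tcoef f : {additive tensor n (ab (FG N)) -> int} := prodL (fun i => ncoord (f i)).

Lemma tcoef_abpure f k : tcoef f (abpure k) = [forall i, k i == f i :> nat]%:R.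
Proof.
rewrite prodL_pure; case: (boolP [forall _, _]) => [/forallP kf|].
  by rewrite big1 // => i _; rewrite ffunE ncoord_gen kf.
rewrite negb_forall => /existsP[i /negPf ki].
by rewrite (bigD1 i) //= ffunE ncoord_gen ki mul0r.
Qed.

Lemma tensor_expand (t : tensor n (ab (FG N))) :
  t = \sum_k abpure k *~ tcoef (fun i => k i) t.
Proof.
pose F (t : tensor n (ab (FG N))) := \sum_k abpure k *~ tcoef (fun i => k i) t.
have FB : zmod_morphism F.
  by move=> v w; rewrite -sumrB; apply: eq_bigr => i _; rewrite raddfB mulrzBr.
pose Fa : {additive tensor n (ab (FG N)) -> tensor n (ab (FG N))} :=
  HB.pack F (GRing.isZmodMorphism.Build _ _ F FB).
apply: (tensor_genP (u := idfun) (v := Fa)) => k.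
rewrite -[RHS]/(F (abpure k)) /F (bigD1 k) // tcoef_abpure (_ : [forall _, _] = true); last first.
  by apply/forallP.
rewrite mulr1z big1 => [|l lk]; first exact/esym/addr0.
rewrite tcoef_abpure.
case: (boolP [forall _, _]) => [/forallP kl|_]; last by rewrite mulr0z.
by case/eqP: lk; apply/ffunP => i; apply/val_inj/esym/eqP/kl.
Qed.

Lemma fmap_kill (P Q : 'I_N) : fmap ab (kill P) (abgen Q) = if Q == P then 0 else abgen Q.
Proof.
by apply: etrans (abel_mapE _ _) _; rewrite kill_gen; case: eqP.
Qed.

Lemma ncoord_kill (P : 'I_N) p u :
  ncoord p (fmap ab (kill P) u) = if p == P then 0 else ncoord p u.
Proof.
pose R : {additive ab (FG N) -> int} := if p == P then (\0 : {additive ab (FG N) -> int}) else ncoord p.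
transitivity (R u); last by rewrite /R; case: eqP.
apply: (ab_free_additiveP (f := ncoord p \o fmap ab (kill P))) => Q.
rewrite -[LHS]/(ncoord p (fmap ab (kill P) (abgen Q))) fmap_kill /R.
case: (eqVneq Q P) => [->|QP]; last first.
  case: (eqVneq p P) => [pP|_] //.
  by rewrite ncoord_gen pP -val_eqE /= in QP *; rewrite (negPf QP).
rewrite raddf0; case: (eqVneq p P) => // pP; rewrite ncoord_gen.
by rewrite eq_sym (negPf pP).
Qed.

Lemma tcoef_kill_miss (P : 'I_N) f t : (forall i, f i <> P) ->
  tcoef f (tensor_map n (fmap ab (kill P)) t) = tcoef f t.
Proof.
move=> fP; rewrite prodL_map; apply: eq_prodL => i u /=.
by rewrite ncoord_kill; case: eqP => // /fP.
Qed.

Lemma tcoef_kill_hit (P : 'I_N) f t i : f i = P ->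
  tcoef f (tensor_map n (fmap ab (kill P)) t) = 0.
Proof.
move=> fP; rewrite prodL_map; apply: (prodL0 (i := i)) => u /=.
by rewrite ncoord_kill fP eqxx.
Qed.

End Coefficients.
Arguments ncoord {N} p.
Arguments tcoef {n N} f.

(** * Natural transformations as functions on refinements of ordered partitions *)

Section Cochains.
Variables (m n N : nat).
Notation TN := (fcomp (Tpow n) ab).
Implicit Types (g : 'I_n -> 'I_m) (f : 'I_n -> nat) (z : natTrans (barF m N) TN).

(** Surjectivity of [g] expresses that no word of the tuple is empty. *)
Definition supported g f := valid g N f && surjective_on g.

(** The value at a generic word is normalized, so its coefficients are indexed by maps
    onto the letters; these carry a unique label [g]. *)
Definition coef z g f : int :=
  if supported g f
  then tcoef f (z (FG N) (sym N (genw N (blocks N g f)))) else 0.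

Lemma coef_supported z g f : coef z g f <> 0 -> supported g f.
Proof. by rewrite /coef; case: ifP. Qed.

Lemma coef_cochain z g : cochain g N (coef z g).
Proof. by move=> f /coef_supported/andP[]. Qed.

Lemma coef_diff z z' g f : coef (z - z') g f = coef z g f - coef z' g f.
Proof. by rewrite /coef; case: ifP => _; [rewrite -raddfB | rewrite subrr]. Qed.

Lemma normalized_miss (y : TN (FG N)) (k : {ffun 'I_n -> 'I_N}) :
  normalized y -> ~~ onto N (fun i => k i) -> tcoef (fun i => k i) y = 0.
Proof.
move=> yN; rewrite negb_and => /orP[|]; last first.
  by rewrite negb_forall => /existsP[i]; rewrite ltn_ord.
rewrite negb_forall => /existsP[P]; rewrite negb_exists => /forallP kP.
rewrite -(@tcoef_kill_miss _ _ P); last by move=> i e; have := kP i; rewrite e eqxx.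
by rewrite [tensor_map _ _ _]yN raddf0.
Qed.

(** A coefficient at a map that misses the letter [P] is unchanged by [kill P],
    which annihilates the value. *)
Lemma coef_eq0 z : (forall g f, coef z g f = 0) -> z = 0.
Proof.
move=> z0; apply: nat_genP => c gc; rewrite [LHS]tensor_expand.
apply: big1 => k _; have [ko|nko] := boolP (onto N (fun i => k i)); last first.
  by rewrite normalized_miss ?mulr0z //; apply: nat_normalized.
have cN : (\sum_j c j)%N = N by case/andP: gc => /eqP.
have [g gl] := labelled_exists cN (fun i => ltn_ord (k i)).
have [gv gs gb] := labelled_valid gc ko gl.
by have := z0 g (fun i => k i); rewrite /coef /supported gv gs gb /= => ->; rewrite mulr0z.
Qed.

Lemma coefP z z' : (forall g f, coef z g f = coef z' g f) -> z = z'.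
Proof.
move=> zz; apply/eqP; rewrite -subr_eq0; apply/eqP/coef_eq0 => g f.
by rewrite coef_diff zz subrr.
Qed.

Section Build.
Variable phi : ('I_n -> 'I_m) -> ('I_n -> nat) -> int.
Hypothesis phi_supported : forall g f, phi g f <> 0 -> supported g f.

Definition built_value (c : {ffun 'I_m -> nat}) : TN (FG N) :=
  \sum_(g : {ffun 'I_n -> 'I_m}) \sum_(k : {ffun 'I_n -> 'I_N})
    if blocks N g (fun i => k i) == c
    then abpure k *~ phi g (fun i => k i) else 0.

Lemma built_value_normalized c : normalized (built_value c).
Proof.
move=> P; rewrite /built_value raddf_sum big1 // => g _; rewrite raddf_sum big1 // => k _.
case: ifP => _; last exact: raddf0.
apply: etrans (raddfMz _ _ _) _.
have [->|/eqP/phi_supported/andP[/andP[/ontoP[kP _] _] _]] := eqVneq (phi g (fun i => k i)) 0.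
  exact: mulr0z.
have [i ki] := kP P (ltn_ord P).
rewrite -[fmap _ _ _]/(tensor_map n (fmap ab (kill P)) (abpure k)) tensor_mapE.
rewrite (@pure0 _ _ _ i) ?mul0rz // !ffunE (val_inj ki : k i = P).
by apply: etrans (fmap_kill P P) _; rewrite eqxx.
Qed.

Lemma tcoef_built_value g f : supported g f ->
  tcoef f (built_value (blocks N g f)) = phi g f.
Proof.
move=> sgf; have /andP[gv gs] := sgf.
have [gc gl] := valid_labelled gv gs; have [_ bf] := ontoP _ _ (proj1 (andP gv)).
pose k : {ffun 'I_n -> 'I_N} := [ffun i => Ordinal (bf i)].
have kf : (fun i => k i : nat) = f by apply/funext => i; rewrite ffunE.
pose G : {ffun 'I_n -> 'I_m} := [ffun i => g i].
have Gg : G = g :> ('I_n -> 'I_m) by apply/funext => i; rewrite ffunE.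
rewrite /built_value raddf_sum (bigD1 G) // raddf_sum (bigD1 k) // Gg kf eqxx.
rewrite raddfMz tcoef_abpure (_ : [forall _, _] = true); last first.
  by apply/forallP => i; rewrite ffunE.
rewrite big1 => [|l lk]; last first.
  case: ifP => _; last exact: raddf0.
  rewrite raddfMz tcoef_abpure; case: (boolP [forall _, _]) => [/forallP kl|_]; last exact: mul0rz.
  by case/eqP: lk; apply/ffunP => i; apply/val_inj/eqP; rewrite ffunE kl.
rewrite big1 => [|G' G'g]; first by do 2 apply: etrans (addr0 _) _; exact: intz.
rewrite raddf_sum big1 // => l _.
case: eqP => [bl|_]; last exact: raddf0.
rewrite raddfMz tcoef_abpure; case: (boolP [forall _, _]) => [/forallP kl|_]; last exact: mul0rz.
have lf : (fun i => l i : nat) = f by apply/funext => i; apply/eqP/kl.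
move: bl; rewrite lf => bl.
have [->|/eqP/phi_supported/andP[v' s']] := eqVneq (phi G' f) 0; first exact: mulr0z.
have [_ gl'] := valid_labelled v' s'; rewrite bl in gl'.
case/eqP: G'g; apply/ffunP => i; rewrite ffunE; exact: labelled_unique gl' gl i.
Qed.

(** Different labels never contribute to the same basis tensor of a value, by
    uniqueness of labels. *)
Lemma coef_exists : exists z, forall g f, coef z g f = phi g f.
Proof.
exists (yo (fun c _ => built_value_normalized c)) => g f; rewrite /coef.
have [sgf|nsgf] := boolP (supported g f); last first.
  by case: (eqVneq (phi g f) 0) => // /eqP/phi_supported; rewrite (negPf nsgf).
rewrite yo_genw ?tcoef_built_value //.
by case/andP: sgf => v s; case: (valid_labelled v s).
Qed.

End Build.
End Cochains.

(** * The bar differential on coefficients *)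

Section BarSum.
Variable G : groupType.
Implicit Types s : seq G.

Definition joinw p s := take p s ++ (nth 1 s p * nth 1 s p.+1)%g :: drop p.+2 s.

Definition delw p s := take p s ++ drop p.+1 s.

Lemma bar_sum s : bar s = \sum_(p < (size s).-1)
  (<< joinw p s >> - << delw p s >> - << delw p.+1 s >>) *~ (-1) ^+ p.
Proof.
elim: s => [|g t IH] /=; first by rewrite big_ord0.
case: t IH => [|h t] IH; first by rewrite big_ord0 raddf0 subrr.
rewrite big_ord_recl {}IH /= expr0 mulr1z; congr (_ + _).
  by rewrite /joinw /delw /= drop0 -!addrA; congr (_ + _); rewrite addrC.
rewrite raddf_sum -sumrN; apply: eq_bigr => p _ /=.
rewrite raddfMz !raddfB /= -/consw !conswU exprS mulN1r mulrNz.
by rewrite /joinw /delw.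
Qed.

End BarSum.

Definition letter N P : fg_group (FG N) := nth 1%g (letters N) P.

Lemma letterE N (P : 'I_N) : letter N P = fgen P.
Proof. exact: nth_letters. Qed.

Section GenericLetters.
Variables (m N : nat) (c : {ffun 'I_m -> nat}).
Hypothesis cN : (\sum_l c l = N)%N.

Lemma genwE l : genw N c l = [seq letter N (pos c l o) | o <- iota 0 (c l)].
Proof.
rewrite ffunE nth_reshape (nth_codom_ord 0%N) -offset_sumn.
have ol : (offset c l + c l <= N)%N by rewrite -cN offset_total.
have sz : size (drop (offset c l) (letters N)) = (N - offset c l)%N.
  by rewrite size_drop size_letters.
apply: (@eq_from_nth _ 1%g); rewrite size_takel ?sz ?size_map ?size_iota //; try lia.
move=> o oc; rewrite (nth_map 0%N) ?size_iota // nth_iota // nth_take // nth_drop.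
by rewrite add0n.
Qed.

Lemma size_genw l : size (genw N c l) = c l.
Proof. by rewrite genwE size_map size_iota. Qed.

Lemma pre_genw l : pre (genw N c) l = offset c l.
Proof. by apply: eq_bigr => k _; rewrite size_genw. Qed.

Lemma genw_delw l p : (p < c l)%N -> delw p (genw N c l) =
  [seq letter N (pos c l o) | o <- iota 0 p ++ iota p.+1 (c l - p.+1)].
Proof.
move=> pc; rewrite /delw genwE -map_take -map_drop take_iota drop_iota map_cat.
by rewrite (minn_idPl (ltnW pc)).
Qed.

(** Hence the terms of the bar differential that drop a letter have no coefficient
    at maps onto the letters, and only those that multiply two letters count. *)
Lemma genw_delw_kill j p (P : 'I_N) : (p < c j)%N -> P = pos c j p :> nat ->
  wmap (fg_morphism (kill P)) (setw (genw N c) j (delw p (genw N c j))) =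
  setw (genw N c) j (delw p (genw N c j)).
Proof.
move=> pc Pp.
have fixed l o : (o < c l)%N -> (l != j) || (o != p) ->
    fg_morphism (kill P) (letter N (pos c l o)) = letter N (pos c l o).
  move=> oc lo.
  have pN : (pos c l o < N)%N by rewrite -cN pos_lt.
  rewrite (letterE (Ordinal pN)) kill_gen; case: eqP => // /(congr1 val) /= e.
  have [elj eop] := pos_inj oc pc (etrans e Pp).
  by case/orP: lo => /eqP ne; case: ne.
apply/ffunP => l; rewrite [LHS]ffunE; case: (eqVneq l j) => [->|lj].
  rewrite setwE genw_delw // -map_comp; apply/eq_in_map => o.
  rewrite mem_cat !mem_iota => oc; apply: fixed; first by lia.
  by rewrite eqxx /=; apply/eqP; lia.
rewrite setw_neq // genwE -map_comp; apply/eq_in_map => o; rewrite mem_iota => oc.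
by apply: fixed; [lia | rewrite lj].
Qed.

End GenericLetters.

Section Join.
Variables (m N : nat) (c : {ffun 'I_m -> nat}) (j : 'I_m) (p : nat).
Hypothesis cN : (\sum_l c l = N.+1)%N.
Hypothesis pc : (p.+1 < c j)%N.
Local Notation P := (pos c j p).

Definition shrink : {ffun 'I_m -> nat} := [ffun l => if l == j then (c l).-1 else c l].

Lemma sum_shrink : (\sum_l shrink l = N)%N.
Proof.
apply: succn_inj; rewrite -cN (bigD1 j) //= [in RHS](bigD1 j) //= ffunE eqxx.
rewrite (eq_bigr c) => [|l /negPf lj]; last by rewrite ffunE lj.
by rewrite -addSn prednK //; lia.
Qed.

Lemma offset_shrink l : (offset shrink l + (j < l) = offset c l)%N.
Proof.
case: (ltnP j l) => jl; last first.
  rewrite addn0; apply: eq_bigr => k kl; rewrite ffunE ifF //.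
  by apply/eqP => kj; rewrite kj ltnNge jl in kl.
rewrite /offset (bigD1 j) //= [in RHS](bigD1 j) //= ffunE eqxx addn1.
rewrite (eq_bigr c) => [|k /andP[_ /negPf kj]]; last by rewrite ffunE kj.
by rewrite -addSn prednK //; lia.
Qed.

Lemma pos_next l o : (o < c l)%N -> (j < l)%N -> (P.+1 < pos c l o)%N.
Proof. by move=> oc jl; have := offset_next c jl; rewrite /pos; lia. Qed.

Lemma pos_prev l o : (o < c l)%N -> (l < j)%N -> (pos c l o < P)%N.
Proof. by move=> oc jl; have := offset_next c jl; rewrite /pos; lia. Qed.

Lemma P_lt : (P.+1 < N.+1)%N.
Proof. by rewrite -cN; have := pos_lt pc; rewrite /pos addnS. Qed.

(** The morphism that carries the generic word to the one with two consecutive letters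
    multiplied. *)
Definition joinh : Defs.hom (FG N) (FG N.+1) :=
  fhom (fun Q : 'I_N => if (Q < P)%N then letter N.+1 Q else
    if Q == P :> nat then (letter N.+1 P * letter N.+1 P.+1)%g else letter N.+1 Q.+1).

Lemma joinh_letter Q : (Q < N)%N -> fg_morphism joinh (letter N Q) =
  if (Q < P)%N then letter N.+1 Q else
  if Q == P :> nat then (letter N.+1 P * letter N.+1 P.+1)%g else letter N.+1 Q.+1.
Proof. by move=> QN; rewrite (letterE (Ordinal QN)); apply: fhom_gen. Qed.

Lemma genw_joinw : setw (genw N.+1 c) j (joinw p (genw N.+1 c j)) =
  wmap (fg_morphism joinh) (genw N shrink).
Proof.
apply/ffunP => l; rewrite [RHS]ffunE (genwE sum_shrink) -map_comp.
have shl : forall o, o \in iota 0 (shrink l) -> (pos shrink l o < N)%N.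
  by move=> o; rewrite mem_iota -sum_shrink => oc; apply: pos_lt; lia.
case: (eqVneq l j) => [lj|lj].
  subst l; rewrite setwE; have pE o : pos shrink j o = pos c j o.
    by rewrite /pos -(offset_shrink j) ltnn addn0.
  rewrite /joinw !(genwE cN) -map_take -map_drop take_iota drop_iota.
  have p1 : (p < c j)%N := ltnW pc.
  rewrite (minn_idPl (ltnW p1)) !(nth_map 0%N) ?size_iota // !nth_iota // !add0n.
  have -> : shrink j = (p + (c j - p.+2).+1)%N by rewrite ffunE eqxx; lia.
  have shl' o : (o < (c j).-1)%N -> (pos shrink j o < N)%N.
    by move=> oc; apply: shl; rewrite mem_iota ffunE eqxx.
  rewrite iotaD map_cat; congr (_ ++ _).
    apply/eq_in_map => o; rewrite mem_iota => oc.
    rewrite -[RHS]/(fg_morphism joinh (letter N (pos shrink j o))) joinh_letter ?shl' ?pE //.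
      by rewrite ltn_add2l ifT //; lia.
    by lia.
  rewrite [iota (0 + p) _]/= map_cons; congr (_ :: _).
    rewrite -[RHS]/(fg_morphism joinh (letter N (pos shrink j p))) joinh_letter ?shl' ?pE //.
      by rewrite ltnn eqxx /pos addnS.
    by lia.
  rewrite (iotaDl 1 p.+1) -map_comp; apply/eq_in_map => o.
  rewrite mem_iota => oc.
  rewrite -[RHS]/(fg_morphism joinh (letter N (pos shrink j o))) joinh_letter; last by apply: shl'; lia.
  rewrite -[LHS]/(letter N.+1 (pos c j (1 + o))) pE.
  by rewrite /pos ltn_add2l eqn_add2l ifF ?ifF ?addnS //; lia.
have cl : shrink l = c l by rewrite ffunE (negPf lj).
rewrite setw_neq // (genwE cN) cl; apply/eq_in_map => o; rewrite mem_iota => oc.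
have oc' : (o < c l)%N by lia.
rewrite -[RHS]/(fg_morphism joinh (letter N (pos shrink l o))) joinh_letter ?shl ?mem_iota ?cl //.
have := offset_shrink l; case: (ltngtP j l) => jl off.
- by have := pos_next oc' jl; rewrite /pos -off => lt; rewrite ifF; [rewrite ifF; [congr (letter _ _) |] |]; lia.
- by have := pos_prev oc' jl; rewrite /pos -off addn0 => ->.
- by rewrite (val_inj jl) eqxx in lj.
Qed.

Lemma ncoord_letter K q Q : (Q < K)%N -> ncoord q (abel_pi (letter K Q)) = (Q == q)%:R.
Proof. by move=> QK; rewrite (letterE (Ordinal QK)); apply: (ncoord_gen q (Ordinal QK)). Qed.

(** A product of two letters becomes a sum in the abelianization: the coefficient at
    [f] collects the maps that send an element to either factor. *)
Lemma tcoef_joinh n (f : 'I_n -> nat) t :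
  tcoef f (tensor_map n (fmap ab joinh) t) = tcoef (fuse P f) t.
Proof.
rewrite prodL_map; apply: eq_prodL => i.
apply: (ab_free_additiveP (f := ncoord (f i) \o fmap ab joinh) (g := ncoord (fuse P f i))).
move=> Q; rewrite -[LHS]/(ncoord (f i) (fmap ab joinh (abgen Q))) ncoord_gen.
have -> : fmap ab joinh (abgen Q) = abel_pi (fg_morphism joinh (letter N Q)).
  by rewrite letterE; apply: abel_mapE.
have PN := P_lt; have QN := ltn_ord Q.
rewrite joinh_letter // /fuse muE; case: (ltngtP Q P) => QP.
- rewrite ncoord_letter; last by lia.
  by congr (nat_of_bool _)%:R; case: ifP => Pf; lia.
- rewrite ncoord_letter; last by lia.
  by congr (nat_of_bool _)%:R; case: ifP => Pf; lia.
rewrite abel_piM raddfD /= !ncoord_letter ?(ltnW PN) // -natrD; congr (_ %:R).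
by case: ifP => Pf; lia.
Qed.

Lemma goodshape_shrink : goodshape N.+1 c -> goodshape N shrink.
Proof.
case/andP => _ /forallP cpos; rewrite /goodshape sum_shrink eqxx.
apply/forallP => l; rewrite ffunE; case: eqP => [->|_]; last exact: cpos.
by lia.
Qed.

Lemma labelled_shrink n (g : 'I_n -> 'I_m) f : labelled c g f -> labelled shrink g (fuse P f).
Proof.
move=> gl i; have [o oc e] := gl i; rewrite /fuse muE e.
have := offset_shrink (g i); case: (ltngtP j (g i)) => jl off.
- have := pos_next oc jl; rewrite /pos -off => ?; exists o; last by rewrite ifT; lia.
  by rewrite ffunE -val_eqE /= gtn_eqF.
- have := pos_prev oc jl; rewrite /pos -off addn0 => ?; exists o.
    by rewrite ffunE -val_eqE /= ltn_eqF.
  by rewrite ifF //; lia.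
have {jl} jl := val_inj jl; move: oc off; rewrite -jl /pos => oc off.
exists (o - (p < o))%N; first by rewrite ffunE eqxx; lia.
by rewrite ltn_add2l; case: ifP; lia.
Qed.

End Join.

Section CoefDelta.
Variables (m n N : nat) (z : natTrans (barF m N) (fcomp (Tpow n) ab)).
Variables (g : 'I_n -> 'I_m) (f : 'I_n -> nat).
Hypothesis fo : onto N.+1 f.

Lemma coef_fuse_last : coef z g (fuse N f) = 0.
Proof.
apply/eqP; apply: contraT => /eqP/coef_supported/andP[/andP[/ontoP[_ b] _] _].
have [oP _] := ontoP _ _ fo; have [i fi] := oP N (ltnSn N).
by have := b i; rewrite /fuse muE fi ltnn ltnn.
Qed.

Lemma coef_fuse_invalid P : ~~ compat g (fuse P f) -> coef z g (fuse P f) = 0.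
Proof. by move=> nc; rewrite /coef /supported /valid (negPf nc) andbF. Qed.

Section Supported.
Hypotheses (fc : compat g f) (gs : surjective_on g).
Let c := blocks N.+1 g f.

Let gc : goodshape N.+1 c.
Proof. by have [] := @valid_labelled m N.+1 n g f _ gs; rewrite ?/valid ?fo. Qed.

Let gl : labelled c g f.
Proof. by have [] := @valid_labelled m N.+1 n g f _ gs; rewrite ?/valid ?fo. Qed.

Let cN : (\sum_l c l = N.+1)%N.
Proof. by case/andP: gc => /eqP. Qed.

Let cpos l : (0 < c l)%N.
Proof. by case/andP: gc => _ /forallP. Qed.

Let w := genw N.+1 c.

(** Merging the last letter of a word with the first letter of the next one
    is not compatible with the labels, so that the sum over all merges reduces to the
    merges inside the words. *)
Lemma coef_fuse_end j : coef z g (fuse (pos c j (c j).-1) f) = 0.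
Proof.
set P := pos c j _; have PN : (P < N.+1)%N by rewrite -cN pos_lt // prednK.
have [PN'|PN'] := ltnP P N; last first.
  by have -> : P = N; [lia | exact: coef_fuse_last].
apply: coef_fuse_invalid; apply/negP => cm.
have [oP _] := ontoP _ _ fo; have [i fi] := oP P PN; have [i' fi'] := oP P.+1 PN'.
have gi : g i = g i'.
  by apply: compat_eq cm _; rewrite /fuse !muE fi fi' ltnn ltnSn.
have [o oc e] := gl i; have [o' oc' e'] := gl i'.
have oj : ((c j).-1 < c j)%N by rewrite prednK.
have [gj _] := pos_inj oj oc (etrans (esym fi) e).
by move: e' oc'; rewrite fi' -gi -gj /P /pos; lia.
Qed.

Lemma tcoef_delw j p : (p < c j)%N ->
  tcoef f (z (FG N.+1) (sym N (setw w j (delw p (w j))))) = 0.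
Proof.
move=> pc; have PN : (pos c j p < N.+1)%N by rewrite -cN pos_lt.
have [oP _] := ontoP _ _ fo; have [i fi] := oP _ PN.
rewrite -(genw_delw_kill cN (P := Ordinal PN) pc) //.
have -> : sym N (wmap (fg_morphism (kill (Ordinal PN))) (setw (genw N.+1 c) j (delw p (genw N.+1 c j))))
   = fmap (barF m N) (kill (Ordinal PN)) (sym N (setw w j (delw p (w j)))).
  by apply: esym; exact: barmap_sym.
rewrite napp_nat; apply: (@tcoef_kill_hit _ _ _ f _ i).
exact: fi.
Qed.

Lemma tcoef_joinw j p : (p.+1 < c j)%N ->
  tcoef f (z (FG N.+1) (sym N (setw w j (joinw p (w j))))) = coef z g (fuse (pos c j p) f).
Proof.
move=> pc; rewrite (genw_joinw cN pc).
have -> : sym N (wmap (fg_morphism (joinh N c j p)) (genw N (shrink c j))) =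
   fmap (barF m N) (joinh N c j p) (sym N (genw N (shrink c j))).
  by apply: esym; exact: barmap_sym.
rewrite napp_nat; apply: etrans (tcoef_joinh cN pc f _) _.
have PN : (pos c j p < N)%N by have := P_lt cN pc.
have fo' := onto_fuse PN fo.
have [v s b] := labelled_valid (goodshape_shrink cN pc gc) fo' (labelled_shrink cN pc gl).
by rewrite /coef /supported v s b.
Qed.

Lemma coef_barD_supported : coef (nat_comp z (barD m N)) g f = delta N (coef z g) f.
Proof.
(* Merging the last letter of all contributes nothing, so that [delta] can be
   summed over all letters, word by word. *)
have -> : delta N (coef z g) f = \sum_j \sum_(o < (c j).-1)
    (-1) ^+ pos c j o * coef z g (fuse (pos c j o) f).
  have := @big_pos m N.+1 int c (fun P => (-1) ^+ P * coef z g (fuse P f)) cN.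
  rewrite big_ord_recr /= coef_fuse_last mulr0 addr0 /delta => ->; apply: eq_bigr => j _.
  have drop_last (k : nat) (F : nat -> int) : (0 < k)%N -> F k.-1 = 0 ->
      \sum_(o < k) F o = \sum_(o < k.-1) F o.
    by case: k => // k _ /= F0; rewrite big_ord_recr /= F0 addr0.
  apply: (drop_last _ (fun o => (-1) ^+ pos c j o * coef z g (fuse (pos c j o) f))) => //.
  by rewrite coef_fuse_end mulr0.
have [T TE] : exists T : {additive {freeg {ffun 'I_m -> seq (fg_group (FG N.+1))}} -> int},
    forall x, T x = tcoef f (z (FG N.+1) (zpi (badrel N) x)).
  by exists ((tcoef f : {additive fcomp (Tpow n) ab (FG N.+1) -> int}) \o
    ((z (FG N.+1) : {additive barF m N (FG N.+1) -> fcomp (Tpow n) ab (FG N.+1)}) \o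
    (zpi (badrel N) : {additive _ -> barF m N (FG N.+1)}))).
have -> : coef (nat_comp z (barD m N)) g f = T (dtot << w >>).
  rewrite TE -bardiffE /coef ifT //.
  by rewrite /supported /valid fo fc gs.
rewrite /dtot raddf_sum; apply: eq_bigr => j _.
rewrite sslotU bar_sum size_genw // raddf_sum mulrz_suml raddf_sum; apply: eq_bigr => p _.
have pc : (p.+1 < c j)%N by have := ltn_ord p; lia.
have TU t : T (fgmap (setw w j) << t >>) = tcoef f (z (FG N.+1) (sym N (setw w j t))).
  by rewrite TE fgmapU.
rewrite !raddfMz !raddfB !TU tcoef_joinw // !tcoef_delw // ?(ltnW pc) // !subr0.
rewrite -mulrzA -mulrzr intz mulrC /sgn_pre pre_genw // -exprD.
by congr (_ ^+ _ * _); rewrite /pos addnC.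
Qed.

End Supported.

(** On coefficients, the bar differential is the merging of consecutive blocks, one
    surjection [g] at a time. *)
Lemma coef_barD : coef (nat_comp z (barD m N)) g f = delta N (coef z g) f.
Proof.
have [sg|nsg] := boolP (surjective_on g); last first.
  rewrite /coef /supported (negPf nsg) andbF /delta big1 // => P _.
  by rewrite andbF mulr0.
have [fc|nfc] := boolP (compat g f); first exact: coef_barD_supported.
rewrite {1}/coef /supported /valid (negPf nfc) andbF /= /delta big1 // => P _.
rewrite coef_fuse_invalid ?mulr0 //; apply: contra nfc; exact: compat_fuse.
Qed.

End CoefDelta.

(** * Reading off extension groups from coefficients *)

Lemma coeff_fgmap (K : choiceType) (f : K -> K) : injective f ->
  forall (D : {freeg K}) k, coeff (f k) (fgmap f D) = coeff k D.
Proof.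
move=> fI D k.
apply: (freeg_additiveP (f := coeff (f k) \o fgmap f) (g := coeff k)) => l.
by rewrite /= fgmapU !coeffU (inj_eq fI).
Qed.

Section FreeExt.
Variables (C : category) (R : augmented_resolution C) (G : functor C) (i : nat).
Variables (K : choiceType) (S : seq K) (F : K -> {additive natTrans (R i.+1) G -> int}).
Hypothesis S_uniq : uniq S.
Hypothesis S_full : forall k, k \in S.

Definition combine z : {freeg K} := \sum_(k <- S) << k >> *~ F k z.

Fact combine_is_additive : zmod_morphism combine.
Proof. by move=> x y; rewrite /combine -sumrB; apply: eq_bigr => k _; rewrite raddfB mulrzBr. Qed.
HB.instance Definition _ := GRing.isZmodMorphism.Build _ _ combine combine_is_additive.

Lemma coeff_sum (a : K -> int) k : coeff k (\sum_(l <- S) << l >> *~ a l) = a k.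
Proof.
rewrite raddf_sum (bigD1_seq k) //= raddfMz /= coeffU eqxx intz big1 ?addr0 // => l lk.
by rewrite raddfMz /= coeffU (negPf lk) mul0rz.
Qed.

Lemma ext_iso_coeffs :
  (forall z : natTrans (R i.+1) G, is_cocycle z -> (forall k, F k z = 0) <-> is_coboundary z) ->
  (forall a : K -> int, exists z, is_cocycle z /\ forall k, F k z = a k) ->
  exists phi : {additive Ext i (R 0) G -> {freeg K}}, bijective phi /\
    forall z (zP : is_cocycle z) k, coeff k (phi (ext_class zP)) = F k z.
Proof.
move=> F_ker F_surj.
have combineK z k : coeff k (combine z) = F k z by rewrite coeff_sum.
have [|y|phi [phi_bij phiE]] := ext_iso (Phi := combine : {additive _ -> _}).
- move=> z /F_ker <-; split=> [z0 k|z0]; first by rewrite -combineK [combine z]z0 coeff0.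
  by apply: big1 => k _; rewrite z0 mulr0z.
- have [z [zP Fz]] := F_surj (fun k => coeff k y); exists z; split=> //.
  by apply/eqP/freeg_eqP => k; rewrite [LHS]combineK.
by exists phi; split=> // z zP k; rewrite phiE combineK.
Qed.

End FreeExt.

(** ** Cocycles and coboundaries in terms of coefficients *)

Section CoefCocycles.
Variables (m n : nat).
Notation TN := (fcomp (Tpow n) ab).
Notation R := (bar_resolution m).

Lemma supported_bounds N (g : 'I_n -> 'I_m) f : supported N g f -> (m <= N <= n)%N.
Proof.
case/andP => v s; have [/andP[/eqP cN /forallP cpos] _] := valid_labelled v s.
rewrite (valid_bound v) andbT -{1}(card_ord m) -sum1_card -cN.
by apply: leq_sum => j _; apply: cpos.
Qed.

Lemma coef_cocycle N (z : natTrans (barF m N) TN) g :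
  nat_comp z (barD m N) = 0 -> cocycle_on g N (coef z g).
Proof.
move=> dz f /andP[fo _]; rewrite -coef_barD // dz /coef.
by case: ifP => // _; exact: raddf0.
Qed.

Lemma cocycle_top (z : natTrans (barF m n) TN) : nat_comp z (barD m n) = 0.
Proof.
apply: coef_eq0 => g f; apply/eqP; apply: contraT => /eqP/coef_supported/supported_bounds.
by case/andP => _; rewrite ltnn.
Qed.

Lemma coef_of_coboundary M (y : natTrans (barF m M) TN)
    (psi : ('I_n -> 'I_m) -> ('I_n -> nat) -> int) z :
  (forall g f, coef y g f = psi g f) ->
  (forall g f, supported M.+1 g f -> coef z g f = delta M (psi g) f) ->
  z = nat_comp y (barD m M).
Proof.
move=> yE zE; apply: coefP => g f.
have [s|ns] := boolP (supported M.+1 g f); last first.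
  by rewrite /coef (negPf ns).
have /andP[/andP[fo _] _] := s.
rewrite zE // coef_barD //; congr delta.
by apply/funext => f'; rewrite yE.
Qed.

Lemma is_coboundary0 i (G : functor gr) : is_coboundary (0 : natTrans (R i.+1) G).
Proof. by case: i => [//|j]; exists 0; rewrite nat_comp0l. Qed.

(** In degree 0 the hypothesis forces the cocycle to vanish, as no refinement
    of a surjection onto ['I_m] has fewer than [m] blocks. *)
Lemma coboundary_of_cochains i (z : natTrans (R i.+1) TN) :
  (forall g, surjective_on g -> exists psi, cochain g (i + m).-1 psi /\
     forall f, valid g (i + m) f ->
       coef (z : natTrans (barF m (i + m)) TN) g f = delta (i + m).-1 psi f) ->
  is_coboundary z.
Proof.
move=> zP.
have psiP g : exists psi, surjective_on g -> cochain g (i + m).-1 psi /\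
    forall f, valid g (i + m) f ->
       coef (z : natTrans (barF m (i + m)) TN) g f = delta (i + m).-1 psi f.
  have [/zP [psi psiP]|_] := boolP (surjective_on g); first by exists psi.
  by exists (fun=> 0).
have [psi {}psiP] : exists psi : ('I_n -> 'I_m) -> ('I_n -> nat) -> int, forall g,
    surjective_on g -> cochain g (i + m).-1 (psi g) /\ forall f, valid g (i + m) f ->
       coef (z : natTrans (barF m (i + m)) TN) g f = delta (i + m).-1 (psi g) f.
  by exists (fun g => sval (cid (psiP g))) => g; exact: svalP (cid (psiP g)).
case: i z zP psi psiP => [|j] z zP psi psiP.
  apply: (@coef_eq0 m n m) => g f; apply/eqP; apply: contraT => /eqP zn.
  have /andP[v s] := coef_supported zn; have [pc zE] := psiP g s.
  case: zn; rewrite zE // /delta big1 // => P _.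
  case: (eqVneq (psi g (fuse P f)) 0) => [->|/eqP/pc v']; first exact: mulr0.
  have : supported (0 + m).-1 g (fuse P f) by rewrite /supported v'.
  by move/supported_bounds; have := ltn_ord P; lia.
pose phi g f := if surjective_on g then psi g f else 0.
have phi_supp g f : phi g f <> 0 -> supported (j + m) g f.
  by rewrite /phi /supported; case: ifP => // s /(proj1 (psiP g s)) ->.
have [y yE] := coef_exists phi_supp; exists y.
apply: (coef_of_coboundary yE) => g f /andP[v s].
by have [_ ->] := psiP g s; rewrite // /phi s.
Qed.

Lemma vanish_low i (z : natTrans (R i.+1) TN) : (i + m < n)%N -> is_cocycle z ->
  is_coboundary z.
Proof.
move=> lt zP; apply: coboundary_of_cochains => g gs.
apply: exact_low => //; first exact: coef_cochain.
exact: coef_cocycle zP.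
Qed.

Lemma vanish_high i (z : natTrans (R i.+1) TN) : (n < i + m)%N -> is_coboundary z.
Proof.
move=> lt; rewrite (_ : z = 0); first exact: is_coboundary0.
apply: (@coef_eq0 m n (i + m)) => g f; apply/eqP; apply: contraT.
by move=> /eqP/coef_supported/supported_bounds; lia.
Qed.

End CoefCocycles.

(** * The actions of the symmetric groups on coefficients *)

(** ** Permuting the factors of the target *)

Section TargetAction.
Variables (m n N : nat) (t : 'S_n).
Implicit Types (g : 'I_n -> 'I_m) (f : 'I_n -> nat).

Lemma surjective_on_perm g : surjective_on (g \o t) = surjective_on g.
Proof.
apply: eq_forallb => j; apply/existsP/existsP => -[i /eqP e].
  by exists (t i); rewrite -e.
by exists ((t^-1)%g i); rewrite /= permKV e.
Qed.

Lemma supported_perm g f : supported N (g \o t) (f \o t) = supported N g f.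
Proof. by rewrite /supported valid_perm surjective_on_perm. Qed.

Lemma blocks_perm g f : blocks N (g \o t) (f \o t) = blocks N g f.
Proof.
apply/ffunP => j; rewrite !ffunE; apply: eq_card => P; rewrite !inE.
apply/existsP/existsP => -[i e]; first by exists (t i).
by exists ((t^-1)%g i); rewrite /= permKV.
Qed.

Lemma tcoef_perm f (x : tensor n (ab (FG N))) :
  tcoef f (tensor_perm t _ x) = tcoef (f \o t) x.
Proof.
apply: (tensorP (f := tcoef f \o tensor_perm t _)) => {}x.
rewrite -[LHS]/(tcoef f (tensor_perm t _ (pure x))) tensor_permE !prodL_pure.
rewrite (reindex_inj (@perm_inj _ t)); apply: eq_bigr => i _.
by rewrite ffunE permK.
Qed.

Lemma coef_target (z : natTrans (barF m N) (fcomp (Tpow n) ab)) g f :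
  coef (nat_comp (Tpow_perm t ab) z) g f = coef z (g \o t) (f \o t).
Proof.
rewrite /coef supported_perm blocks_perm; case: ifP => // _.
exact: tcoef_perm.
Qed.

End TargetAction.

(** The sign representation of the symmetric group of the target enters here. *)
Lemma top_sum_perm n (t : 'S_n) (phi : ('I_n -> nat) -> int) :
  top_sum (fun f => phi (f \o t)) = (-1) ^+ t * top_sum phi.
Proof.
pose h (f : {ffun 'I_n -> 'I_n}) : {ffun 'I_n -> 'I_n} := [ffun i => f (t i)].
have hI : injective h.
  move=> f f' e; apply/ffunP => i; have /ffunP/(_ ((t^-1)%g i)) := e.
  by rewrite !ffunE permKV.
rewrite /top_sum [in RHS](reindex_inj hI) mulr_sumr; apply: eq_bigr => f _.
have hf : (fun i => h f i : nat) = (fun i => f i : nat) \o t.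
  by apply/funext => i; rewrite ffunE.
rewrite hf mulrA; congr (_ * _).
rewrite -[X in _ = _ * X]/(sgf (fun i => (fun j => (f j : nat)%:Z) (t i))) sgf_perm.
by rewrite mulrA -expr2 sqrr_sign mul1r.
Qed.

(** ** Permuting the words of the source *)

Section Relabel.
Variables (m n N : nat) (s : 'S_m) (g : 'I_n -> 'I_m) (f : 'I_n -> nat).
Hypothesis fg : supported N g f.
Let c := blocks N g f.

Let gc : goodshape N c.
Proof. by case/andP: fg => v e; case: (valid_labelled v e). Qed.
Let gl : labelled c g f.
Proof. by case/andP: fg => v e; case: (valid_labelled v e). Qed.
Let cN : (\sum_l c l = N)%N. Proof. by case/andP: gc => /eqP. Qed.

Definition pshape : {ffun 'I_m -> nat} := [ffun l => c (s l)].

Definition plabel i := (s^-1)%g (g i).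

(** Permutes the blocks in the way in which [s] permutes the words. *)
Definition pfun i := (offset pshape (plabel i) + (f i - offset c (g i)))%N.

Lemma sum_pshape : (\sum_l pshape l = N)%N.
Proof.
rewrite -cN [RHS](reindex_inj (@perm_inj _ s)) /=.
by apply: eq_bigr => l _; rewrite ffunE.
Qed.

Lemma goodshape_pshape : goodshape N pshape.
Proof.
rewrite /goodshape sum_pshape eqxx; apply/forallP => l; rewrite ffunE.
by case/andP: gc => _ /forallP.
Qed.

Lemma labelled_pfun : labelled pshape plabel pfun.
Proof.
move=> i; have [o oc e] := gl i; exists o; first by rewrite ffunE permKV.
by rewrite /pfun e /pos addKn.
Qed.

Lemma pfun_pos i l o : (o < pshape l)%N -> (pfun i == pos pshape l o) = (f i == pos c (s l) o).
Proof.
move=> oc; have oc' : (o < c (s l))%N by rewrite ffunE in oc.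
have [o' oc1 e'] := gl i; have oc2 : (o' < pshape (plabel i))%N by rewrite ffunE permKV.
have -> : pfun i = pos pshape (plabel i) o' by rewrite /pfun e' /pos addKn.
rewrite e'; apply/eqP/eqP => e.
  have [<- <-] := pos_inj oc2 oc e; by rewrite permKV.
by have [e1 <-] := pos_inj oc1 oc' e; rewrite /plabel e1 permK.
Qed.

Lemma onto_pfun : onto N pfun.
Proof.
have /andP[/andP[/ontoP[oP bP] _] _] := fg; apply/ontoP; split=> [P PN|i].
  have [|l [o [oc ->]]] := @pos_exists _ pshape P; first by rewrite sum_pshape.
  have [|i fi] := oP (pos c (s l) o); first by rewrite -cN pos_lt //; rewrite ffunE in oc.
  by exists i; apply/eqP; rewrite pfun_pos // fi.
by have [o oc ->] := labelled_pfun i; rewrite -sum_pshape pos_lt.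
Qed.

Lemma supported_pfun : supported N plabel pfun.
Proof.
have [v e _] := labelled_valid goodshape_pshape onto_pfun labelled_pfun.
by rewrite /supported v e.
Qed.

Lemma blocks_pfun : blocks N plabel pfun = pshape.
Proof. by have [] := labelled_valid goodshape_pshape onto_pfun labelled_pfun. Qed.

Lemma pfun_le i j : g i = g j -> (pfun i <= pfun j)%N = (f i <= f j)%N.
Proof.
move=> gij; have [o oc e] := gl i; have [o' oc' e'] := gl j.
by rewrite /pfun /plabel e e' gij /pos !addKn !leq_add2l.
Qed.

(** The order within each fibre does not change. *)
Lemma sorted_pfun : sorted_from plabel 0 pfun = sorted_from g 0 f.
Proof.
apply/sorted_fromP/sorted_fromP => h e i ke ie gie fei; apply: h => //.
- by rewrite /plabel gie.
- by rewrite pfun_le.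
- by apply: (@perm_inj _ (s^-1)%g).
- by rewrite -pfun_le //; apply: (@perm_inj _ (s^-1)%g).
Qed.

Definition phom : Defs.hom (FG N) (FG N) :=
  fhom (fun Q : 'I_N => let l := slot_of sum_pshape Q in
    letter N (pos c (s l) (Q - offset pshape l))).

Lemma phom_letter l o : (o < pshape l)%N ->
  fg_morphism phom (letter N (pos pshape l o)) = letter N (pos c (s l) o).
Proof.
move=> oc; have QN : (pos pshape l o < N)%N by rewrite -sum_pshape pos_lt.
rewrite (letterE (Ordinal QN)); apply: etrans (fhom_gen _ _) _.
by rewrite (@slot_of_pos _ _ _ _ _ l o) // /pos addKn.
Qed.

Lemma permw_genw : permw s (genw N c) = wmap (fg_morphism phom) (genw N pshape).
Proof.
apply/ffunP => l; rewrite [LHS]ffunE [RHS]ffunE (genwE cN) (genwE sum_pshape) -map_comp.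
have -> : c (s l) = pshape l by rewrite [RHS]ffunE.
apply/eq_in_map => o; rewrite mem_iota => /andP[_ oc].
by rewrite -[RHS]/(fg_morphism phom (letter N (pos pshape l o))) phom_letter.
Qed.

Lemma tcoef_phom k (h h' : 'I_k -> nat) (x : tensor k (ab (FG N))) :
  (forall i l o, (o < pshape l)%N -> (h' i == pos pshape l o) = (h i == pos c (s l) o)) ->
  tcoef h (tensor_map k (fmap ab phom) x) = tcoef h' x.
Proof.
move=> hh; rewrite prodL_map; apply: eq_prodL => i.
apply: (ab_free_additiveP (f := ncoord (h i) \o fmap ab phom) (g := ncoord (h' i))) => Q.
rewrite -[LHS]/(ncoord (h i) (fmap ab phom (abgen Q))) ncoord_gen.
have [o oc e] := slot_ofP sum_pshape Q; set l := slot_of _ _ in oc e *.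
have -> : fmap ab phom (abgen Q) = abel_pi (letter N (pos c (s l) o)).
  rewrite -phom_letter // -e letterE; exact: abel_mapE.
rewrite ncoord_letter; first by rewrite eq_sym -hh // eq_sym -e.
by rewrite -cN pos_lt //; rewrite ffunE in oc.
Qed.

Lemma nat_source (H : functor gr) (z : natTrans (barF m N) H) :
  nat_comp z (bactF s N) (FG N) (sym N (genw N c)) =
  fmap H phom (z (FG N) (sym N (genw N pshape))) *~ koszul s pshape.
Proof.
rewrite -[LHS]/(z (FG N) (bact s (fg_group (FG N)) N (sym N (genw N c)))) bact_sym.
rewrite raddfMz permw_genw; congr (_ *~ _).
  by rewrite -napp_nat; congr (z _ _); apply: esym; exact: barmap_sym.
rewrite /ksign /koszul; apply: eq_bigr => k _; apply: eq_bigr => l _.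
by rewrite !size_genw // !ffunE.
Qed.

Lemma coef_source (z : natTrans (barF m N) (fcomp (Tpow n) ab)) :
  coef (nat_comp z (bactF s N)) g f = coef z plabel pfun * koszul s pshape.
Proof.
rewrite /coef fg supported_pfun blocks_pfun nat_source raddfMz -mulrzr intz.
by congr (_ * _); apply: tcoef_phom; exact: pfun_pos.
Qed.

End Relabel.

(** ** Signs *)

Section KoszulPairs.
Variables (m n : nat).

(** Each pair of labels [k < l] occurs at as many pairs of indices as the
    product of the two multiplicities. *)
Lemma prod_pairs_fibres (F : 'I_m -> 'I_m -> int) (h : 'I_n -> 'I_m) :
  (forall k l, F k l = F l k) -> (forall k, F k k = 1) ->
  \prod_(i < n) \prod_(j < n | (i < j)%N) F (h i) (h j) =
  \prod_(k < m) \prod_(l < m | (k < l)%N)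
     F k l ^+ (#|[pred i | h i == k]| * #|[pred i | h i == l]|).
Proof.
move=> FC F1.
(* The exponent of [F k l] is the number of pairs [i < j] with labels [k] and
   [l] in some order. *)
pose a k i : nat := h i == k.
have Fij i j : F (h i) (h j) = \prod_(k < m) \prod_(l < m | (k < l)%N)
    F k l ^+ (a k i * a l j + a l i * a k j).
  case: (ltngtP (h i) (h j)) => hij.
  - rewrite (bigD1 (h i)) //= (bigD1 (h j)) //= /a !eqxx.
    rewrite (_ : (h i == h j) = false) ?(ltn_eqF) //; last first.
      by apply/eqP => e; rewrite e ltnn in hij.
    rewrite muln1 mul0n addn0 expr1 big1 => [|l /andP[_ /negPf lj]]; last first.
      rewrite [h j == l]eq_sym lj muln0 add0n [h j == h i]eq_sym.
      by rewrite (_ : (h i == h j) = false) ?muln0 //; apply/eqP => e; rewrite e ltnn in hij.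
    rewrite mulr1 big1 ?mulr1 // => k /negPf ki; rewrite big1 // => l kl.
    rewrite [h i == k]eq_sym ki mul0n add0n; case: eqP => [il|_]; last by rewrite mul0n.
    by case: eqP => [jk|_]; [move: kl; rewrite -il -jk => kl; lia | rewrite muln0].
  - rewrite (bigD1 (h j)) //= (bigD1 (h i)) //= /a !eqxx.
    have ne : (h i == h j) = false by apply/eqP => e; rewrite e ltnn in hij.
    rewrite ne mul0n muln1 add0n expr1 FC big1 => [|l /andP[_ /negPf lj]]; last first.
      by rewrite mul0n [h i == l]eq_sym lj mul0n.
    rewrite mulr1 big1 ?mulr1 // => k /negPf ki; rewrite big1 // => l kl.
    rewrite [h j == k]eq_sym ki muln0 addn0; case: eqP => [il|_]; last by rewrite mul0n.
    by case: eqP => [jk|_]; [move: kl; rewrite -il -jk => kl; lia | rewrite muln0].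
  rewrite /a (val_inj hij) F1 big1 // => k _; rewrite big1 // => l kl.
  case: eqP => [ik|_]; last by rewrite !(mul0n, muln0).
  case: eqP => [il|_]; last by rewrite !(mul0n, muln0).
  by move: kl; rewrite -ik -il ltnn.
rewrite (eq_bigr (fun i : 'I_n => \prod_(k < m) \prod_(l < m | (k < l)%N)
    \prod_(j < n | (i < j)%N) F k l ^+ (a k i * a l j + a l i * a k j))); last first.
  move=> i _; rewrite (eq_bigr _ (fun j _ => Fij i j)) exchange_big /=.
  by apply: eq_bigr => k _; rewrite exchange_big.
rewrite exchange_big /=; apply: eq_bigr => k _; rewrite exchange_big /=; apply: eq_bigr => l kl.
rewrite (eq_bigr (fun i : 'I_n => F k l ^+ (\sum_(j < n | (i < j)%N)
    (a k i * a l j + a l i * a k j)))%N); last first.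
  by move=> i _; rewrite -expr_sum.
rewrite -expr_sum; congr (_ ^+ _).
have cardE q : #|[pred i | h i == q]| = (\sum_i a q i)%N.
  by rewrite -sum1_card big_mkcond; apply: eq_bigr => i _; rewrite inE /a; case: eqP.
rewrite !cardE big_distrl /=.
transitivity (\sum_(i < n) \sum_(j < n | (i < j)%N) a k i * a l j +
   \sum_(i < n) \sum_(j < n | (j < i)%N) a k i * a l j)%N.
  rewrite [X in (_ + X)%N](exchange_big_dep predT) //= -big_split; apply: eq_bigr => i _ /=.
  rewrite -big_split; apply: eq_bigr => j _ /=.
  by rewrite [(a k j * _)%N]mulnC.
rewrite -big_split; apply: eq_bigr => i _ /=; rewrite big_distrr /=.
rewrite [X in (X + _)%N]big_mkcond [X in (_ + X)%N]big_mkcond -big_split.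
apply: eq_bigr => j _ /=; case: (ltngtP i j) => //= [|/val_inj <-]; first by rewrite addn0.
rewrite addn0 /a; case: eqP => [->|_] //; case: eqP => // e.
by move: kl; rewrite e ltnn.
Qed.

Lemma flip_same (s : 'S_m) k : flip s k k = 1.
Proof. by rewrite /flip !ltnn expr0. Qed.

Variables (s : 'S_m) (g : 'I_n -> 'I_m) (f : 'I_n -> nat).
Hypothesis fg : supported n g f.

Lemma koszul_pshape : koszul s (pshape n s g f) =
  \prod_(i < n) \prod_(j < n | (i < j)%N) flip s (plabel s g i) (plabel s g j).
Proof.
rewrite (prod_pairs_fibres (F := flip s)); [|exact: flipC|exact: flip_same].
have /andP[/andP[fo _] _] := fg; have fI := inj_onto fo; have [_ bP] := ontoP _ _ fo.
have cE k : pshape n s g f k = #|[pred i | plabel s g i == k]|.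
  rewrite !ffunE; pose F i := Ordinal (bP i).
  have FI : injective F by move=> i j /(congr1 val)/fI.
  rewrite -[RHS](card_imset _ FI); apply: eq_card => P; rewrite [LHS]inE.
  apply/existsP/imsetP => [[i /andP[/eqP fi /eqP gi]]|[i gi ->]].
    by exists i; [rewrite inE /plabel gi permK | apply: val_inj].
  by exists i; rewrite /= eqxx -(eqP (gi : _ == k)) /plabel permKV eqxx.
by apply: eq_bigr => k _; apply: eq_bigr => l _; rewrite !cE.
Qed.

(** For singletons the Koszul sign of the words is the sign of the permutation of the
    letters: two elements are exchanged if and only if their words are. *)
Lemma nsgn_pfun : nsgn (pfun n s g f) = nsgn f * koszul s (pshape n s g f).
Proof.
rewrite koszul_pshape /nsgn /sgf -big_split; apply: eq_bigr => i _ /=.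
rewrite -big_split; apply: eq_bigr => j ij /=.
have ij' : i != j by apply: contraTneq ij => ->; rewrite ltnn.
have /andP[/andP[fo /compatP fc] _] := fg; have fI := inj_onto fo.
have /andP[/andP[fo' /compatP fc'] _] := supported_pfun s fg; have fI' := inj_onto fo'.
rewrite !sg_natB; try by apply: contraNneq ij' => e; apply/eqP/esym; first [exact: fI e | exact: fI' e].
rewrite /flip -signr_addb; congr (_ ^+ nat_of_bool _).
have lt (h : 'I_n -> nat) p q : (h p < h q)%N = ~~ (h q <= h p)%N by rewrite ltnNge.
case: (eqVneq (g i) (g j)) => [gij|gij].
  by rewrite /plabel gij !ltnn /= addbF [in LHS]ltnNge [in RHS]ltnNge pfun_le.
have mono (u : 'I_n -> 'I_m) (h : 'I_n -> nat) : (forall i j, h i <= h j -> u i <= u j)%N ->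
    u i != u j -> (h j < h i)%N = ~~ (u i < u j)%N.
  move=> hu uij; rewrite ltnNge; congr (~~ _); apply/idP/idP => [/hu|lt'].
    by rewrite leq_eqVlt => /orP[/eqP/val_inj e|//]; rewrite e eqxx in uij.
  by rewrite leqNgt; apply/negP => /ltnW/hu; rewrite leqNgt lt'.
rewrite (mono (plabel s g)) //; last by rewrite (inj_eq perm_inj).
rewrite (mono g) // /plabel !permKV.
by case: (_ < _)%N; case: (_ < _)%N.
Qed.

End KoszulPairs.

(** * Extensions between tensor powers *)

Lemma nat_compMz (C : category) (F G H : functor C) (b : natTrans G H)
  (a : natTrans F G) (c : int) : nat_comp b (a *~ c) = nat_comp b a *~ c.
Proof. by apply: natTransP => X x; rewrite /= !natMzE /= raddfMz. Qed.

Section TopCoefficient.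
Variables (m n : nat).
Notation TN := (fcomp (Tpow n) ab).

Definition topc (g : 'I_n -> 'I_m) (z : natTrans (barF m n) TN) : int := top_sum (coef z g).

Fact topc_is_additive g : zmod_morphism (topc g).
Proof.
move=> x y; rewrite /topc /top_sum -sumrB; apply: eq_bigr => f _.
by rewrite coef_diff mulrBr.
Qed.
HB.instance Definition _ g :=
  GRing.isZmodMorphism.Build (natTrans (barF m n) TN) int (topc g) (topc_is_additive g).

Lemma topc_target (t : 'S_n) g z :
  topc g (nat_comp (Tpow_perm t ab) z) = (-1) ^+ t * topc (g \o t) z.
Proof.
rewrite /topc -top_sum_perm; congr top_sum; apply/funext => f.
exact: coef_target.
Qed.

(** Each cohomology class has a representative of this kind, on which the sum
    [top_sum] is a single term. *)
Definition concentrated (z : natTrans (barF m n) TN) :=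
  forall g f, coef z g f <> 0 -> f = fsort g.

(** The only sorted partition is carried to the only sorted partition, and the
    Koszul sign cancels against the change of orientation. *)
Lemma topc_source (s : 'S_m) g z : concentrated z -> surjective_on g ->
  topc g (nat_comp z (bactF s n)) = topc ((s^-1)%g \o g) z.
Proof.
move=> zc gs; have fg : supported n g (fsort g) by rewrite /supported valid_fsort.
have pf : pfun n s g (fsort g) = fsort (plabel s g).
  have /andP[v _] := supported_pfun s fg.
  by apply: (proj2 (sorted_fsort v _)); rewrite sorted_pfun // sorted_from_fsort.
rewrite /topc (@top_sum_single _ _ g); last first.
  move=> f fn0; have fs := coef_supported fn0; have /andP[v _] := fs.
  apply: (proj2 (sorted_fsort v _)); rewrite -(sorted_pfun s fs).
  rewrite (zc (plabel s g) (pfun n s g f)) ?sorted_from_fsort //.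
  by move=> z0; apply: fn0; rewrite coef_source // z0 mul0r.
rewrite (@top_sum_single _ _ ((s^-1)%g \o g)); last by move=> f; apply: zc.
rewrite coef_source // -[in RHS]pf -[X in _ = _ * coef z X _]/(plabel s g) pf.
rewrite -[in RHS]pf nsgn_pfun // -mulrA; congr (_ * _).
rewrite pf mulrC.
by [].
Qed.

Lemma concentrated_exists (a : ('I_n -> 'I_m) -> int) :
  exists2 z, concentrated z & forall g, surjective_on g -> topc g z = a g.
Proof.
pose phi g f := if surjective_on g && [forall i, f i == fsort g i]
  then a g * nsgn (fsort g) else 0.
have phi_supp g f : phi g f <> 0 -> supported n g f.
  rewrite /phi; case: ifP => // /andP[gs /forallP ff] _.
  have -> : f = fsort g by apply/funext => i; apply/eqP.
  by rewrite /supported valid_fsort.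
have [z zE] := coef_exists phi_supp; have zc : concentrated z.
  move=> g f; rewrite zE /phi; case: ifP => // /andP[_ /forallP ff] _.
  by apply/funext => i; apply/eqP.
exists z => // g gs; rewrite /topc (top_sum_single (zc g)) zE /phi gs /=.
rewrite ifT; first by rewrite mulrCA nsgn_fsort mulr1.
by apply/forallP.
Qed.

Lemma topc_coboundary M (y : natTrans (barF m M) TN) (e : n = M.+1)
    (z : natTrans (barF m n) TN) :
  (forall g f, onto n f -> coef z g f = delta M (coef y g) f) -> forall g, topc g z = 0.
Proof.
move=> zy g; rewrite -(top_sum_delta (coef y g) e) /topc; apply: eq_bigr => f _.
case: (eqVneq (nsgn (fun i => f i : nat)) 0) => [->|/eqP/nsgn_inj fI]; first by rewrite !mul0r.
by rewrite zy //; apply: onto_inj.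
Qed.

End TopCoefficient.

Lemma topc_is_coboundary m i (z : natTrans (bar_resolution m i.+1) (fcomp (Tpow (i + m)) ab)) :
  is_coboundary z -> forall g, @topc m (i + m) g z = 0.
Proof.
case: i z => [|j] z; first by move=> /= -> g; exact: raddf0.
move=> [y zy] g; apply: (@topc_coboundary m (j.+1 + m) (j + m) y) => // g' f fo.
by rewrite zy coef_barD.
Qed.

(** In degree [n - m] the functional [topc] identifies the cohomology at each
    surjection; in the other degrees the complex is exact or zero. *)
Lemma tensor_ext (m n i : nat) :
  ((i + m)%N = n ->
     exists phi : {additive Ext i (fcomp (Tpow m) ab) (fcomp (Tpow n) ab)
                            -> {freeg (Sur n m)}},
       bijective phi /\
       forall (s : 'S_m) (t : 'S_n) x,
         phi (ext_act i s t x) = sur_twisted_act s t (phi x)) /\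
  ((i + m)%N <> n -> forall x : Ext i (fcomp (Tpow m) ab) (fcomp (Tpow n) ab), x = 0).
Proof.
split; last first.
  move=> ne; apply: (ext_vanish (R := bar_resolution m)) => z zP.
  case: (ltngtP (i + m) n) => // [lt|lt]; first exact: vanish_low zP.
  exact: vanish_high.
move=> ?; subst n; set n := (i + m)%N.
pose TN := fcomp (Tpow n) ab; pose R := bar_resolution m.
pose F (k : Sur n m) : {additive natTrans (R i.+1) TN -> int} := @topc m n (val k).
pose S : seq (Sur n m) := enum [the finType of {f : {ffun 'I_n -> 'I_m} | surj_pred f}].
have S_full k : k \in S by rewrite /S mem_enum.
have raw (k : Sur n m) : surjective_on (val k) := valP k.
have lift (g : 'I_n -> 'I_m) : surjective_on g -> exists k : Sur n m, val k = g :> ('I_n -> 'I_m).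
  move=> gs; have eg : [ffun i => g i] = g :> ('I_n -> 'I_m) by apply/funext => j; rewrite ffunE.
  have ks : surj_pred [ffun i => g i] by rewrite -[surj_pred _]/(surjective_on [ffun i => g i]) eg.
  by exists (exist _ [ffun i => g i] ks).
have nice (a : Sur n m -> int) : exists2 z : natTrans (R i.+1) TN,
    concentrated (z : natTrans (barF m n) TN) & forall k, F k z = a k.
  have [z zc zE] := @concentrated_exists m n
    (fun g => if pselect (exists k : Sur n m, val k = g :> ('I_n -> 'I_m)) is left h
              then a (sval (cid h)) else 0).
  exists z => // k; rewrite [F k z]zE //; case: pselect => [h|[]]; last by exists k.
  congr a; apply/val_inj/ffunP => j.
  by have := svalP (cid h) => /(congr1 (fun u => u j)).
have [||phi [phi_bij phiE]] := @ext_iso_coeffs gr R TN i (Sur n m) S F (enum_uniq _) S_full.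
- move=> z zP; split=> [z0|zb k]; last exact: topc_is_coboundary.
  apply: coboundary_of_cochains => g /lift [k <-].
  by apply: exact_top; [exact: coef_cochain | exact: coef_cocycle zP | exact: z0].
- move=> a; have [z _ zE] := nice a; exists z; split=> //.
  exact: cocycle_top.
exists phi; split=> // s t x.
have [z zc zE] := nice (fun k => coeff k (phi x)).
have zP : @is_cocycle gr R TN i z by exact: cocycle_top.
have -> : x = ext_class zP.
  apply: (bij_inj phi_bij); apply/eqP/freeg_eqP => k.
  by rewrite phiE zE.
have zP' : @is_cocycle gr R TN i (nat_comp (Tpow_perm t ab) (nat_comp z (bact_chain s i.+1))).
  exact: cocycle_top.
rewrite [ext_act _ _ _ _](ext_map_class zP zP' (@bact_chainP m s) erefl).
apply/eqP/freeg_eqP => k; rewrite phiE.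
pose k0 := sur_act (s^-1)%g (t^-1)%g k.
have actK : sur_act s t k0 = k.
  by apply/val_inj/ffunP => j; rewrite !ffunE invgK !permKV.
have act_inj : injective (@sur_act n m s t).
  move=> f f' /(congr1 val)/ffunP e; apply/val_inj/ffunP => j; apply: (@perm_inj _ s).
  by have := e (t j); rewrite !ffunE permK.
rewrite /sur_twisted_act coeffZ -{2}actK coeff_fgmap // phiE.
rewrite [F k _]topc_target nat_compMz raddfMz -mulrzr intz.
have gs : surjective_on (val k \o t) by rewrite surjective_on_perm.
rewrite [_ (nat_comp z _)](topc_source s zc gs) mulrA mulrAC.
rewrite [X in X * _]mulrC; congr (_ * _); rewrite /F; congr (topc _ z).
by apply/funext => j; rewrite /= ffunE invgK.
Qed.

(** * Extensions into divided powers *)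

Section Invariants.
Variable n : nat.
Notation GN := (fcomp (Gpow n) ab).
Notation TN := (fcomp (Tpow n) ab).

Definition gamma_incl : natTrans GN TN :=
  @nat_of gr GN TN (fun X => val : {additive gamma n (ab X) -> tensor n (ab X)})
    (fun X Y h x => erefl).

Lemma gamma_incl_inj (A : functor gr) (a b : natTrans A GN) :
  nat_comp gamma_incl a = nat_comp gamma_incl b -> a = b.
Proof.
move=> ab_eq; apply: natTransP => X x; apply: val_inj.
by have /= := congr1 (fun u => napp u X x) ab_eq.
Qed.

Lemma gamma_incl_perm (t : 'S_n) : nat_comp (Tpow_perm t ab) gamma_incl = gamma_incl.
Proof. by apply: natTransP => X x; case: x => x /= /forallP/(_ t)/eqP. Qed.

Lemma gamma_lift (A : functor gr) (w : natTrans A TN) :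
  (forall t, nat_comp (Tpow_perm t ab) w = w) -> exists y, nat_comp gamma_incl y = w.
Proof.
move=> wP; have wS X x : w X x \in @sym_tensor n (ab X).
  by apply/forallP => t; apply/eqP; have /= := congr1 (fun u => napp u X x) (wP t).
pose y X x : GN X := Gamma (wS X x).
have yB X : zmod_morphism (y X) by move=> u v; apply: val_inj; rewrite /= raddfB.
have yN X Y (h : Defs.hom X Y) x : y Y (fmap A h x) = fmap GN h (y X x).
  by apply: val_inj; rewrite /= napp_nat.
by exists (NatTrans yB yN); apply: natTransP.
Qed.

Section Coefficients.
Variables (m N : nat).

Definition gcoef (z : natTrans (barF m N) GN) g f := coef (nat_comp gamma_incl z) g f.

Lemma gcoef_perm z (t : 'S_n) g f : gcoef z (g \o t) (f \o t) = gcoef z g f.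
Proof. by rewrite /gcoef -coef_target nat_compA gamma_incl_perm. Qed.

Lemma gcoef_exists (psi : ('I_n -> 'I_m) -> ('I_n -> nat) -> int) :
  (forall g f, psi g f <> 0 -> supported N g f) ->
  (forall (t : 'S_n) g f, psi (g \o t) (f \o t) = psi g f) ->
  exists z, forall g f, gcoef z g f = psi g f.
Proof.
move=> /coef_exists[w wE] psi_perm; have [|z zw] := @gamma_lift (barF m N) w.
  by move=> t; apply: coefP => g f; rewrite coef_target !wE psi_perm.
by exists z => g f; rewrite /gcoef zw.
Qed.

Lemma gcoef_eq0 z : (forall g f, gcoef z g f = 0) -> z = 0.
Proof. by move/coef_eq0 => z0; apply: gamma_incl_inj; rewrite z0 nat_comp0r. Qed.

End Coefficients.
End Invariants.

Section VanishingDivided.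
Variables (m n i : nat).
Notation GN := (fcomp (Gpow n) ab).
Notation R := (bar_resolution m).

(** If [m < n], every [g] has a fibre with at least two elements, and the invariant
    contraction applies; its result is invariant and therefore lifts to
    divided powers. *)
Lemma gamma_vanish (z : natTrans (R i.+1) GN) :
  ~ (i = 0%N /\ m = n) -> is_cocycle z -> is_coboundary z.
Proof.
move=> ne zP; have [lt|le] := ltnP n (i + m).
  rewrite (_ : z = 0); first exact: is_coboundary0.
  apply: (@gcoef_eq0 n m (i + m)) => g f; apply/eqP; apply: contraT.
  by move=> /eqP/coef_supported/supported_bounds; lia.
have mn : (m < n)%N by case: (ltnP m n) => // nm; case: ne; split; lia.
pose zt : natTrans (barF m (i + m)) (fcomp (Tpow n) ab) := nat_comp (gamma_incl n) z.
have ztP : nat_comp zt (barD m (i + m)) = 0.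
  by rewrite /zt -nat_compA [nat_comp z _]zP nat_comp0r.
have zt_inv (t : 'S_n) g f : coef zt (g \o t) (f \o t) = coef zt g f by exact: gcoef_perm.
have [N0|Npos] := posnP (i + m).
  rewrite (_ : z = 0); first exact: is_coboundary0.
  apply: (@gcoef_eq0 n m (i + m)) => g f; apply/eqP; apply: contraT.
  move=> /eqP/coef_supported/andP[/andP[/ontoP[_ b] _] _].
  have n0 : (0 < n)%N by lia.
  by have := b (Ordinal n0); lia.
have crowded (g : 'I_n -> 'I_m) : exists k, (1 < fibre g k)%N.
  have [|ninj] := boolP (injectiveb g).
    by move=> /injectiveP/leq_card; rewrite !card_ord leqNgt mn.
  move/injectivePn: ninj => [k [l kl gkl]]; exists k.
  exact: fibre_gt1 kl gkl.
have homotopy g f : valid g (i + m) f ->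
    coef zt g f = delta (i + m).-1 (icontract (i + m).-1 (coef zt) g) f.
  move=> v; have [k gk] := crowded g.
  by apply: (icontract_homotopy zt_inv _ _ gk); rewrite prednK //;
    [exact: coef_cochain | exact: coef_cocycle].
have zE : nat_comp (gamma_incl n) z = zt by [].
case: i z zP zt {ztP} zt_inv Npos homotopy zE {ne le} => [|j] z zP zt zt_inv Npos homotopy zE.
  apply: gamma_incl_inj; rewrite nat_comp0r zE.
  apply: (@coboundary_of_cochains m n 0 zt) => g gs; exists (icontract (0 + m).-1 (coef zt) g).
  by split=> [f|f v]; [exact: icontract_valid | exact: homotopy].
pose psi g f := if surjective_on g then icontract (j + m) (coef zt) g f else 0.
have psi_supp g f : psi g f <> 0 -> supported (j + m) g f.
  by rewrite /psi /supported; case: ifP => // gs /icontract_valid ->.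
have psi_perm (t : 'S_n) g f : psi (g \o t) (f \o t) = psi g f.
  by rewrite /psi icontract_inv // surjective_on_perm.
have [y yE] := gcoef_exists psi_supp psi_perm; exists y.
apply: gamma_incl_inj; rewrite nat_compA zE.
apply: (coef_of_coboundary yE) => g f /andP[v gs].
by rewrite [LHS]homotopy // /psi gs.
Qed.

End VanishingDivided.

Section DividedTop.
Variable m : nat.
Notation GN := (fcomp (Gpow m) ab).
Implicit Types (g : 'I_m -> 'I_m) (f : 'I_m -> nat).

Lemma supported_one_shape g f : supported m g f -> blocks m g f = [ffun=> 1%N].
Proof.
case/andP => v s; have [/andP[/eqP cN /forallP cpos] _] := valid_labelled v s.
set c := blocks m g f in cN cpos *.
have e : (\sum_j (c j - 1) = 0)%N.
  have sum1 : (\sum_(j < m) 1 = m)%N by rewrite sum1_card card_ord.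
  have : (\sum_(j < m) 1 + \sum_j (c j - 1) = \sum_j c j)%N.
    by rewrite -big_split; apply: eq_bigr => j _; rewrite /= subnKC.
  by rewrite sum1 cN; lia.
apply/ffunP => j; rewrite [RHS]ffunE; move/eqP: e; rewrite sum_nat_eq0 => /forallP/(_ j) /=.
by have := cpos j; lia.
Qed.

(** With [m] blocks and [m] labels every block has its own label, so that [g] and [f]
    are the same bijection. *)
Lemma supported_orbit g f : supported m g f ->
  exists t : 'S_m, g = id \o t /\ f = (fun i : 'I_m => i : nat) \o t.
Proof.
move=> gf; have c1 := supported_one_shape gf; have /andP[v s] := gf.
have [_ gl] := valid_labelled v s; rewrite c1 in gl.
have fE i : f i = g i.
  have [o] := gl i; rewrite ffunE ltnS leqn0 => /eqP -> ->.
  rewrite /pos /offset addn0 (eq_bigr (fun=> 1%N)) => [|l _]; last by rewrite ffunE.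
  rewrite -(big_mkord (fun l => l < g i)%N (fun=> 1%N)).
  rewrite -(big_nat_widen 0 (g i) m predT) ?(ltnW (ltn_ord _)) //.
  by rewrite big_const_nat iter_addn; lia.
have fI := inj_onto (proj1 (andP v)).
have gI : injective g by move=> i j e; apply: fI; rewrite !fE e.
exists (perm gI); split; apply/funext => i; rewrite /= permE //.
Qed.

Lemma supported_id : supported m (fun i : 'I_m => i) (fun i : 'I_m => i).
Proof.
rewrite /supported /valid; apply/andP; split; [apply/andP; split|].
- by apply/ontoP; split=> [P Pm|i]; [exists (Ordinal Pm) | exact: ltn_ord].
- by apply/compatP.
by apply/forallP => j; apply/existsP; exists j.
Qed.

Definition gtop (z : natTrans (barF m m) GN) : int :=
  gcoef z (fun i : 'I_m => i) (fun i : 'I_m => i).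

Fact gtop_is_additive : zmod_morphism gtop.
Proof. by move=> x y; rewrite /gtop /gcoef nat_compBr coef_diff. Qed.
HB.instance Definition _ :=
  GRing.isZmodMorphism.Build (natTrans (barF m m) GN) int gtop gtop_is_additive.

Lemma gcoef_gtop z g f : supported m g f -> gcoef z g f = gtop z.
Proof. by move=> /supported_orbit[t [-> ->]]; rewrite gcoef_perm. Qed.

(** Invariance makes the coefficient independent of the block permutation, and the
    Koszul sign of words of length one is the sign of [s]. *)
Lemma gtop_source (s : 'S_m) z : gtop (nat_comp z (bactF s m)) = (-1) ^+ s * gtop z.
Proof.
rewrite /gtop /gcoef nat_compA coef_source ?supported_id // mulrC.
rewrite -/(gcoef z _ _) gcoef_gtop ?supported_pfun ?supported_id //; congr (_ * _).
rewrite -flip_sign; apply: eq_bigr => k _; apply: eq_bigr => l _.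
rewrite /pshape (supported_one_shape supported_id) !ffunE.
by rewrite expr1.
Qed.

Lemma gtop_exists (a : int) : exists z, gtop z = a.
Proof.
have [||z zE] := @gcoef_exists m m m (fun g f => if supported m g f then a else 0).
- by move=> g f; case: ifP.
- by move=> t g f; rewrite supported_perm.
by exists z; rewrite /gtop zE supported_id.
Qed.

Lemma gtop_eq0 z : gtop z = 0 -> z = 0.
Proof.
move=> z0; apply: gcoef_eq0 => g f; have [gf|ngf] := boolP (supported m g f).
  by rewrite gcoef_gtop.
by rewrite /gcoef /coef (negPf ngf).
Qed.

Lemma gcocycle_top (z : natTrans (barF m m) GN) : nat_comp z (barD m m) = 0.
Proof. by apply: gamma_incl_inj; rewrite nat_comp0r nat_compA cocycle_top. Qed.

End DividedTop.

Lemma divided_ext (m n i : nat) :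
  (i = 0%N /\ m = n ->
     exists phi : {additive Ext i (fcomp (Tpow m) ab) (fcomp (Gpow n) ab) -> int},
       bijective phi /\
       forall (s : 'S_m) x, phi (ext_act_l i s (fcomp (Gpow n) ab) x) = phi x) /\
  (~ (i = 0%N /\ m = n) ->
     forall x : Ext i (fcomp (Tpow m) ab) (fcomp (Gpow n) ab), x = 0).
Proof.
split; last first.
  move=> ne; apply: (ext_vanish (R := bar_resolution m)) => z.
  exact: gamma_vanish.
move=> [? ?]; subst i n; pose GN := fcomp (Gpow m) ab; pose R := bar_resolution m.
pose F : {additive natTrans (R 1%N) GN -> int} := @gtop m.
have [||phi [phi_bij phiE]] := @ext_iso gr R GN 0 int F.
- by move=> z _; split=> [/gtop_eq0 //|/= ->]; exact: raddf0.
- by move=> a; have [z zE] := @gtop_exists m a; exists z; split=> //; exact: gcocycle_top.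
exists phi; split=> // s x; have [z [zP ->]] := @ext_class_surj gr R GN 0 x.
have zP' : @is_cocycle gr R GN 0 (nat_comp (nat_id GN) (nat_comp z (bact_chain s 1))).
  exact: gcocycle_top.
rewrite [ext_act_l _ _ _ _](ext_map_class zP zP' (@bact_chainP m s) erefl).
rewrite !phiE nat_comp1l nat_compMz raddfMz -mulrzr intz [F _]gtop_source.
by rewrite mulrAC -expr2 sqrr_sign mul1r.
Qed.

(** * Extensions into exterior powers *)

Section Wedge.
Variables (n : nat) (A : zmodType).
Implicit Types x : {ffun 'I_n -> A}.

Definition wedge x : exterior n A := zpi (@alternating_rel n A) (pure x).

Lemma wedge_alt x i j : i != j -> x i = x j -> wedge x = 0.
Proof. by move=> ij xij; apply/zpi_eq0/gen_in; exists x, i, j. Qed.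

Lemma wedgeD x i a b : wedge (upd x i (a + b)) = wedge (upd x i a) + wedge (upd x i b).
Proof. by rewrite /wedge pureD raddfD. Qed.

Lemma wedge_tperm x i j : i != j -> wedge [ffun l => x (tperm i j l)] = - wedge x.
Proof.
move=> ij; pose w a b := wedge (upd (upd x i a) j b).
have wj a b b' : w a (b + b') = w a b + w a b' by exact: wedgeD.
have updC a b : upd (upd x i a) j b = upd (upd x j b) i a.
  apply/ffunP => l; rewrite !ffunE; case: (eqVneq l j) => // ->.
  by rewrite eq_sym (negPf ij).
have wi a a' b : w (a + a') b = w a b + w a' b by rewrite /w !updC wedgeD.
have ww a : w a a = 0.
  by apply: (wedge_alt ij); rewrite !ffunE !eqxx (negPf ij).
have <- : w (x i) (x j) = wedge x.
  congr wedge; apply/ffunP => l; rewrite !ffunE.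
  by case: eqP => [->|_] //; case: eqP => [->|].
have -> : wedge [ffun l => x (tperm i j l)] = w (x j) (x i).
  congr wedge; apply/ffunP => l; rewrite !ffunE.
  case: tpermP => [->|->|/eqP/negPf li /eqP/negPf lj]; rewrite ?eqxx ?li ?lj //.
  by rewrite (negPf ij).
have := ww (x i + x j); rewrite wi !wj !ww addr0 add0r addrC => /eqP.
by rewrite addr_eq0 => /eqP.
Qed.

Lemma wedge_perm x (s : 'S_n) : exists a : int, wedge [ffun l => x (s l)] = wedge x *~ a.
Proof.
have [ts -> /allP tsP] := prod_tpermP s; elim: ts x tsP => [|[i j] ts IH] x tsP.
  exists 1; rewrite mulr1z big_nil; congr wedge.
  by apply/ffunP => l; rewrite ffunE perm1.
have [|a e] := IH x; first by move=> t tts; apply: tsP; rewrite inE tts orbT.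
exists (- a); rewrite mulrNz -e -(@wedge_tperm _ i j); last first.
  by apply: (tsP (i, j)); rewrite inE eqxx.
by congr wedge; apply/ffunP => l; rewrite big_cons !ffunE permM.
Qed.

End Wedge.

Lemma wedge_map n (A B : zmodType) (h : {additive A -> B}) (x : {ffun 'I_n -> A}) :
  exterior_map n h (wedge x) = wedge (ffun_map h x).
Proof. by rewrite exterior_mapE tensor_mapE. Qed.

Section ExteriorOfFree.
Variables (n N : nat).

Definition abwedge (k : 'I_n -> 'I_N) : exterior n (ab (FG N)) := wedge [ffun i => abgen (k i)].

Lemma abwedge_kill (P : 'I_N) (k : {ffun 'I_n -> 'I_N}) :
  exterior_map n (fmap ab (kill P)) (abwedge k) = if P \in codom k then 0 else abwedge k.
Proof.
rewrite wedge_map; case: (boolP (P \in codom k)) => [/codomP[i ->]|nP].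
  rewrite /wedge (@pure0 _ _ _ i) ?raddf0 // !ffunE.
  by apply: etrans (fmap_kill _ _) _; rewrite eqxx.
congr wedge; apply/ffunP => i; rewrite !ffunE; apply: etrans (fmap_kill _ _) _.
by rewrite ifF //; apply: contraNF nP => /eqP <-; apply: codom_f.
Qed.

(** Each application of [1 - kill P] removes the basis vectors that do not
    involve the generator number [P], and fixes the others. *)
Lemma normalized_wedge (y : exterior n (ab (FG N))) :
  (forall P, exterior_map n (fmap ab (kill P)) y = 0) ->
  exists a : {ffun 'I_n -> 'I_N} -> int,
    y = \sum_(k : {ffun 'I_n -> 'I_N} | [forall P, P \in codom k]) abwedge k *~ a k.
Proof.
move=> yP; pose a (k : {ffun 'I_n -> 'I_N}) := tcoef (fun i => k i : nat) (zrepr y).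
exists a.
(* After the projectors [1 - kill P] for [P] in [s]. *)
have claim (s : seq 'I_N) :
    y = \sum_(k : {ffun 'I_n -> 'I_N} | all (fun P => P \in codom k) s) abwedge k *~ a k.
  elim: s => [|P s IH].
    rewrite -{1}[y]zreprK {1}[zrepr y]tensor_expand raddf_sum.
    by apply: eq_bigr => k _; rewrite raddfMz.
  rewrite -[LHS]subr0 -[X in _ - X](yP P) {1 2}IH raddf_sum -sumrB.
  transitivity (\sum_(k : {ffun 'I_n -> 'I_N} |
    (P \in codom k) && all (fun P => P \in codom k) s) abwedge k *~ a k); last by [].
  rewrite big_mkcondl.
  apply: eq_bigr => k _; rewrite raddfMz -mulrzBl [X in (_ - X) *~ _]abwedge_kill.
  by case: ifP => _; rewrite ?subr0 // subrr mul0rz.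
rewrite {1}(claim (enum 'I_N)); apply: eq_bigl => k.
by apply/allP/forallP => [h P|h P _]; [apply: h; rewrite mem_enum | exact: h].
Qed.

(** A wedge of [n] generators among [N] in which all occur needs [N <= n], and has a
    repeated factor if [N < n]. *)
Lemma normalized_wedge0 (y : exterior n (ab (FG N))) : N <> n ->
  (forall P, exterior_map n (fmap ab (kill P)) y = 0) -> y = 0.
Proof.
move=> Nn /normalized_wedge[a ->]; apply: big1 => k /forallP kP.
have [/injectiveP kI|/injectivePn[i [j ij kij]]] := boolP (injectiveb k).
  case: Nn; apply/eqP; rewrite eqn_leq; apply/andP; split; last first.
    by have := leq_card k kI; rewrite !card_ord.
  rewrite -{1}(size_enum_ord N) -[X in (_ <= X)%N](card_ord n) -(size_codom k).
  by apply: uniq_leq_size (enum_uniq _) _ => P _; exact: kP.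
by rewrite /abwedge (@wedge_alt _ _ _ j i) ?mul0rz 1?eq_sym // !ffunE kij.
Qed.

End ExteriorOfFree.
Arguments abwedge {n N} k.

Section Determinant.
Variable n : nat.
Notation A := (ab (FG n)).

Definition coord_mx (x : {ffun 'I_n -> A}) : 'M[int]_n := \matrix_(i, j) coord j (x i).

Fact tdet_subproof z : multilinear_rel z -> zlift (fun x => \det (coord_mx x)) z = 0.
Proof.
move=> [x [i [a [b ->]]]]; rewrite !raddfB /= !zliftU.
rewrite (@determinant_multilinear _ _ (coord_mx (upd x i (a + b)))
  (coord_mx (upd x i a)) (coord_mx (upd x i b)) i 1 1).
- by rewrite !mul1r [X in X - _ - _]addrC addrK subrr.
- by apply/rowP => j; rewrite !mxE !ffunE eqxx raddfD !mul1r.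
- by apply/matrixP => k j; rewrite !mxE !ffunE eq_sym (negPf (neq_lift _ _)).
- by apply/matrixP => k j; rewrite !mxE !ffunE eq_sym (negPf (neq_lift _ _)).
Qed.

Definition tdet : {additive tensor n A -> int} := zquot_lift tdet_subproof.

Lemma tdet_pure x : tdet (pure x) = \det (coord_mx x).
Proof. exact: etrans (zquot_liftE _ _) (zliftU _ _). Qed.

Fact wdet_subproof z : alternating_rel z -> tdet z = 0.
Proof.
move=> [x [i [j [ij xij ->]]]]; rewrite tdet_pure (@determinant_alternate _ _ _ i j) //.
by move=> k; rewrite !mxE xij.
Qed.

(** The coefficient of the standard generator of the top exterior power. *)
Definition wdet : {additive exterior n A -> int} := zquot_lift wdet_subproof.

Lemma wdet_wedge x : wdet (wedge x) = \det (coord_mx x).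
Proof. exact: etrans (zquot_liftE _ _) (tdet_pure x). Qed.

Lemma wdet_abwedge (s : 'S_n) : wdet (abwedge s) = (-1) ^+ s.
Proof.
rewrite wdet_wedge -det_perm; congr (\det _); apply/matrixP => i j.
by rewrite !mxE ffunE coord_gen.
Qed.

Lemma wdet_id : wdet (abwedge id) = 1.
Proof.
transitivity ((-1) ^+ (1%g : 'S_n) : int); last by rewrite odd_perm1.
rewrite -wdet_abwedge; congr (wdet (wedge _)).
by apply/ffunP => i; rewrite !ffunE perm1.
Qed.

Lemma normalized_top (y : exterior n A) :
  (forall P, exterior_map n (fmap ab (kill P)) y = 0) -> y = abwedge id *~ wdet y.
Proof.
move=> /normalized_wedge[a ->].
have [b ->] : exists b, \sum_(k : {ffun 'I_n -> 'I_n} | [forall P, P \in codom k]) abwedge k *~ a k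
    = abwedge id *~ b.
  elim/big_ind: _ => [|u v [b ->] [b' ->]|k /forallP kP].
  - by exists 0; rewrite mulr0z.
  - by exists (b + b'); rewrite mulrzDr.
  have kI : injective k.
    apply/injectiveP; rewrite -[injectiveb _]/(uniq (codom k)).
    apply: (leq_size_uniq (enum_uniq 'I_n)) => [P _|]; first exact: kP.
    by rewrite size_codom size_enum_ord card_ord.
  have [b e] := wedge_perm [ffun i => abgen i] (perm kI); exists (b * a k).
  rewrite mulrzA; congr (_ *~ _).
  have -> : abwedge id = wedge [ffun i => abgen i] by [].
  by rewrite -e; congr wedge; apply/ffunP => i; rewrite !ffunE permE.
by rewrite raddfMz wdet_id intz.
Qed.

End Determinant.
Arguments wdet {n}.

Section ExteriorCoefficients.
Variables (m n : nat).
Notation LN := (fcomp (Lpow n) ab).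
Implicit Types c : {ffun 'I_m -> nat}.

Lemma wedge_eq0 N (z : natTrans (barF m N) LN) : N <> n -> z = 0.
Proof.
move=> Nn; apply: nat_genP => c gc.
by apply: normalized_wedge0 Nn _ => P; exact: (nat_normalized z gc).
Qed.

Definition wtop c (z : natTrans (barF m n) LN) : int := wdet (z (FG n) (sym n (genw n c))).

Fact wtop_is_additive c : zmod_morphism (wtop c).
Proof. by move=> x y; rewrite /wtop -raddfB. Qed.
HB.instance Definition _ c :=
  GRing.isZmodMorphism.Build (natTrans (barF m n) LN) int (wtop c) (wtop_is_additive c).

Lemma wtopE c (z : natTrans (barF m n) LN) : goodshape n c ->
  z (FG n) (sym n (genw n c)) = abwedge id *~ wtop c z.
Proof. by move=> gc; apply: normalized_top => P; exact: (nat_normalized z gc). Qed.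

Lemma wtop_eq0 (z : natTrans (barF m n) LN) : (forall c, goodshape n c -> wtop c z = 0) -> z = 0.
Proof. by move=> z0; apply: nat_genP => c gc; rewrite wtopE // z0 // mulr0z. Qed.

Lemma wtop_exists (a : {ffun 'I_m -> nat} -> int) :
  exists z, forall c, goodshape n c -> wtop c z = a c.
Proof.
have yP c : goodshape n c -> normalized (H := LN) (abwedge id *~ a c).
  move=> _ P; apply: etrans (raddfMz (fmap LN (kill P)) _ _) _.
  have := abwedge_kill P [ffun i => i]; rewrite ifT; last first.
    by apply/codomP; exists P; rewrite ffunE.
  have -> : abwedge [ffun i : 'I_n => i] = abwedge id.
    by congr wedge; apply/ffunP => i; rewrite !ffunE.
  by move=> e; rewrite [fmap _ _ _]e mul0rz.
exists (yo yP) => c gc; rewrite /wtop yo_genw // raddfMz.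
by rewrite [wdet _](wdet_id n) intz.
Qed.

(** The Koszul sign with which the words are permuted is the sign of the
    induced permutation of their letters, so that the two cancel. *)
Lemma wtop_source (s : 'S_m) c (z : natTrans (barF m n) LN) : goodshape n c ->
  wtop c (nat_comp z (bactF s n)) = wtop [ffun l => c (s l)] z.
Proof.
move=> gc; have cN : (\sum_l c l = n)%N by case/andP: gc => /eqP.
pose f (i : 'I_n) : nat := i.
have fo : onto n f.
  by apply/ontoP; split=> [P Pn|i]; [exists (Ordinal Pn) | exact: ltn_ord].
have [g gl] := labelled_exists cN (fun i : 'I_n => ltn_ord i).
have [v e b] := labelled_valid gc fo gl.
have fg : supported n g f by rewrite /supported v e.
have cE : pshape n s g f = [ffun l => c (s l)] by rewrite /pshape b.
have gc' : goodshape n (pshape n s g f) := goodshape_pshape s fg.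
have {1}-> : wtop c (nat_comp z (bactF s n)) =
    wdet (exterior_map n (fmap ab (phom s fg)) (abwedge id)) *
      (wtop (pshape n s g f) z * koszul s (pshape n s g f)).
  rewrite [LHS]/wtop -{1}b (nat_source s fg) wtopE // raddfMz.
  rewrite [fmap LN _ _](raddfMz (exterior_map n (fmap ab (phom s fg)))) raddfMz.
  by rewrite -mulrzA -mulrzr intz.
have sP (P : 'I_n) : (pfun n s g f P < n)%N.
  by have [_] := ontoP _ _ (onto_pfun s fg).
pose F (P : 'I_n) : 'I_n := Ordinal (sP P).
have FI : injective F by move=> P Q /(congr1 val); apply: inj_onto (onto_pfun s fg) _ _.
pose q := (perm FI)^-1%g.
have qE : exterior_map n (fmap ab (phom s fg)) (abwedge id) = abwedge q.
  rewrite wedge_map; congr wedge; apply/ffunP => P; rewrite !ffunE.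
  have [o oc e'] := slot_ofP (sum_pshape s fg) P; set l := slot_of _ _ in oc e'.
  have fP : f (q P) = pos (blocks n g f) (s l) o.
    apply/eqP; rewrite -(pfun_pos fg _ oc) -e'.
    by rewrite -[pfun _ _ _ _ _]/(val (F (q P))) -(permE FI) permKV.
  have qn : (pos (blocks n g f) (s l) o < n)%N by rewrite -fP ltn_ord.
  apply: etrans (abel_mapE _ _) _; rewrite -letterE e' phom_letter //.
  by rewrite (letterE (Ordinal qn)); congr abel_pi; congr fgen; apply: val_inj.
rewrite qE wdet_abwedge -cE mulrCA -[RHS]mulr1; congr (_ * _).
have -> : koszul s (pshape n s g f) = nsgn (pfun n s g f).
  by rewrite nsgn_pfun // [nsgn f]sgf_id mul1r.
have e1 : nsgn (fun P => pfun n s g f (q P)) = 1.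
  rewrite -[RHS](sgf_id n); congr sgf; apply/funext => P; congr (_%:Z).
  by rewrite -[pfun _ _ _ _ _]/(val (F (q P))) -(permE FI) permKV.
rewrite -[RHS]e1.
by rewrite -[RHS]/(sgf (fun P => (fun i => (pfun n s g f i)%:Z) (q P))) sgf_perm.
Qed.

Lemma ecocycle_top (z : natTrans (barF m n) LN) : nat_comp z (barD m n) = 0.
Proof. by apply: wedge_eq0; lia. Qed.

End ExteriorCoefficients.

Lemma exterior_coboundary m i
    (z : natTrans (bar_resolution m i.+1) (fcomp (Lpow (i + m)) ab)) :
  is_coboundary z -> z = 0.
Proof.
case: i z => [//|j] z [y ->]; rewrite (wedge_eq0 y) ?nat_comp0l //; lia.
Qed.

Lemma comp_enum n m : exists S : seq (Comp n m), uniq S /\ forall c, c \in S.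
Proof.
pose trial (h : {ffun 'I_m -> 'I_n.+1}) : option (Comp n m) :=
  insub [ffun j => h j : nat].
exists (undup (pmap trial (enum {ffun 'I_m -> 'I_n.+1}))); split; first exact: undup_uniq.
move=> c; rewrite mem_undup mem_pmap.
have cb j : (val c j < n.+1)%N.
  by case: c => c /= /andP[_ /eqP <-]; rewrite ltnS (bigD1 j) //= leq_addr.
apply/mapP; exists [ffun j => Ordinal (cb j)]; first by rewrite mem_enum.
rewrite /trial (_ : [ffun j => _] = val c) ?valK //.
by apply/ffunP => j; rewrite !ffunE.
Qed.

(** The complex of normalized values vanishes outside degree [n - m], where it is free
    on the shapes. *)
Lemma exterior_ext (m n i : nat) :
  ((i + m)%N = n ->
     exists phi : {additive Ext i (fcomp (Tpow m) ab) (fcomp (Lpow n) ab)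
                            -> {freeg (Comp n m)}},
       bijective phi /\
       forall (s : 'S_m) x,
         phi (ext_act_l i s (fcomp (Lpow n) ab) x) = comp_twisted_act s (phi x)) /\
  ((i + m)%N <> n ->
     forall x : Ext i (fcomp (Tpow m) ab) (fcomp (Lpow n) ab), x = 0).
Proof.
split; last first.
  move=> ne; apply: (ext_vanish (R := bar_resolution m)) => z _.
  by rewrite (wedge_eq0 z ne); exact: is_coboundary0.
move=> ?; subst n; set n := (i + m)%N.
pose LN := fcomp (Lpow n) ab; pose R := bar_resolution m.
pose F (c : Comp n m) : {additive natTrans (R i.+1) LN -> int} := @wtop m n (val c).
have [S [S_uniq S_full]] := comp_enum n m.
have shapeP (c : Comp n m) : goodshape n (val c) by case: c => c /= /andP[c0 cn]; rewrite /goodshape cn.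
have liftP c : goodshape n c -> exists k : Comp n m, val k = c.
  move=> /andP[cn c0]; have kP : composition_pred n c by rewrite /composition_pred c0.
  by exists (exist _ c kP).
have [||phi [phi_bij phiE]] := @ext_iso_coeffs gr R LN i (Comp n m) S F S_uniq S_full.
- move=> z zP; split=> [z0|zb k].
    rewrite (_ : z = 0); first exact: is_coboundary0.
    by apply: (@wtop_eq0 m n) => c /liftP[k <-]; exact: z0.
  by rewrite (exterior_coboundary zb) raddf0.
- move=> a; have [z zE] := @wtop_exists m n (fun c =>
    if pselect (exists k : Comp n m, val k = c) is left h then a (sval (cid h)) else 0).
  exists z; split=> [|k]; first exact: ecocycle_top.
  rewrite [F k z]zE //; case: pselect => [h|[]]; last by exists k.
  by congr a; apply/val_inj; exact: svalP (cid h).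
exists phi; split=> // s x; have [z [zP ->]] := @ext_class_surj gr R LN i x.
have zP' : @is_cocycle gr R LN i (nat_comp (nat_id LN) (nat_comp z (bact_chain s i.+1))).
  exact: ecocycle_top.
rewrite [ext_act_l _ _ _ _](ext_map_class zP zP' (@bact_chainP m s) erefl).
apply/eqP/freeg_eqP => k; rewrite phiE nat_comp1l nat_compMz raddfMz -mulrzr intz.
pose k0 := comp_act (s^-1)%g k.
have actK : comp_act s k0 = k.
  by apply/val_inj/ffunP => j; rewrite !ffunE invgK permKV.
have act_inj : injective (@comp_act n m s).
  move=> c c' /(congr1 val)/ffunP e; apply/val_inj/ffunP => j.
  by have := e (s j); rewrite !ffunE permK.
rewrite /comp_twisted_act coeffZ -{2}actK coeff_fgmap // phiE mulrC; congr (_ * _).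
rewrite [LHS](wtop_source s z (shapeP k)); congr (wtop _ z).
by apply/ffunP => j; rewrite !ffunE invgK.
Qed.
Theorem corollary11p4 (m n : nat) :
  [/\ forall i : nat,
        ((i + m)%N = n ->
           exists phi : {additive Ext i (fcomp (Tpow m) ab) (fcomp (Tpow n) ab)
                                  -> {freeg (Sur n m)}},
             bijective phi /\
             forall (s : 'S_m) (t : 'S_n) x,
               phi (ext_act i s t x) =
                 sur_twisted_act s t (phi x)) /\
        ((i + m)%N <> n ->
           forall x : Ext i (fcomp (Tpow m) ab) (fcomp (Tpow n) ab), x = 0),
      forall i : nat,
        ((i + m)%N = n ->
           exists phi : {additive Ext i (fcomp (Tpow m) ab) (fcomp (Lpow n) ab)
                                  -> {freeg (Comp n m)}},
             bijective phi /\
             forall (s : 'S_m) x,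
               phi (ext_act_l i s (fcomp (Lpow n) ab) x) =
                 comp_twisted_act s (phi x)) /\
        ((i + m)%N <> n ->
           forall x : Ext i (fcomp (Tpow m) ab) (fcomp (Lpow n) ab), x = 0)
    & forall i : nat,
        (i = 0%N /\ m = n ->
           exists phi : {additive Ext i (fcomp (Tpow m) ab) (fcomp (Gpow n) ab)
                                  -> int},
             bijective phi /\
             forall (s : 'S_m) x,
               phi (ext_act_l i s (fcomp (Gpow n) ab) x) = phi x) /\
        (~ (i = 0%N /\ m = n) ->
           forall x : Ext i (fcomp (Tpow m) ab) (fcomp (Gpow n) ab), x = 0)].
Proof.
split=> i; first exact: tensor_ext.
  exact: exterior_ext.
exact: divided_ext.
Qed.
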